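(* Let $E$ be a real-valued function on $k$-partite pure states that is fully additive, monotone on average under LOCC, and satisfies $E(\mathrm{GHZ})=1$. The following are equivalent: (1) $E$ is asymptotically continuous; (2) $E\in\mathcal{F}^{\mathrm{pure}}_k$, i.e. $\varphi\ge\psi$ implies $E(\varphi)\ge E(\psi)$ for all pure states; (3) for all $k$-partite state vectors $\varphi,\psi$ and $p\in[0,1]$, $E(\sqrt{p}\,\varphi\oplus\sqrt{1-p}\,\psi)=pE(\varphi)+(1-p)E(\psi)+h(p)$; (4) for all unit vectors $\varphi,\psi\in\mathcal{H}$ (same $k$-partite space $\mathcal{H}$), writing $\delta=D(|\varphi\rangle\langle\varphi|,|\psi\rangle\langle\psi|)$, \[ |E(\varphi)-E(\psi)|\le a(\delta)\log\dim\mathcal{H}+b(\delta), \] where \[ a(\delta)=\frac{\left(1+\delta^{\frac{2}{k+1}}\right)^{k+1}-1+\delta^2}{1-\delta^2},\qquad b(\delta)=\frac{\left(1+\delta^{\frac{2}{k+1}}\right)^{k+1}}{1-\delta^2}\,h\!\left(\left(1+\delta^{\frac{2}{k+1}}\right)^{-1}\right). \]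
   Context: Logs base 2; $h(p)=-p\log p-(1-p)\log(1-p)$. $k$-partite pure states are unit vectors in $\mathcal{H}=\mathcal{H}_1\otimes\cdots\otimes\mathcal{H}_k$ (finite-dimensional factors, arbitrary dimensions), $\dim\mathcal{H}=\prod_j\dim\mathcal{H}_j$; $E(\varphi)$ means $E(|\varphi\rangle\langle\varphi|)$; tensor products group factors per party. $\mathrm{GHZ}$ has vector $2^{-1/2}(|0\ldots0\rangle+|1\ldots1\rangle)\in(\mathbb{C}^2)^{\otimes k}$. For $\varphi\in\mathcal{H}$, $\psi\in\mathcal{K}$, $a\varphi\oplus b\psi$ is the vector $a\varphi+b\psi$ in $(\mathcal{H}_1\oplus\mathcal{K}_1)\otimes\cdots\otimes(\mathcal{H}_k\oplus\mathcal{K}_k)$. Purified distance $D(\rho,\sigma)=\sqrt{1-F(\rho,\sigma)^2}$, $F(\rho,\sigma)=\operatorname{Tr}\sqrt{\sigma^{1/2}\rho\sigma^{1/2}}$. $\rho\to_\epsilon\sigma$ means some LOCC channel $\Lambda$ has $D(\Lambda(\rho),\sigma)\le\epsilon$; for pure states, $\varphi\ge\psi$ iff $\limsup_{n\to\infty}\inf\{\epsilon\ge0:|\varphi\rangle\langle\varphi|^{\otimes n}\to_\epsilon|\psi\rangle\langle\psi|^{\otimes n}\}=0$ (the LOCC output may be mixed). $\mathcal{F}^{\mathrm{pure}}_k$ is the set of functions $E$ on pure $k$-partite states with $E(\mathrm{GHZ})=1$, $E(\varphi\otimes\psi)=E(\varphi)+E(\psi)$, and $\varphi\ge\psi\Rightarrow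 E(\varphi)\ge E(\psi)$. Fully additive: $E(\varphi\otimes\psi)=E(\varphi)+E(\psi)$. Monotone on average under LOCC: whenever an LOCC channel maps $|\varphi\rangle\langle\varphi|$ to $\sum_{x\in\mathcal{X}}P(x)|x\rangle\langle x|\otimes|\varphi_x\rangle\langle\varphi_x|$ (finite $\mathcal{X}$, classical flag known to all parties), $E(\varphi)\ge\sum_xP(x)E(\varphi_x)$. Asymptotic continuity: regard the disjoint union of pure state sets on all $\mathbb{C}^{d_1}\otimes\cdots\otimes\mathbb{C}^{d_k}$ as a metric space with purified distance between states on the same space and distance $1$ between states on different spaces; $E$ is asymptotically continuous if $E/(1+\log\dim\mathcal{H})$ is uniformly continuous on it. *)

(* Defs.v *)
From HB Require Import structures.
From mathcomp Require Import all_boot all_order all_algebra.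
From mathcomp Require Import reals exp.
From mathcomp Require Import complex.

Set Implicit Arguments.
Unset Strict Implicit.
Unset Printing Implicit Defensive.

Import Order.TTheory GRing.Theory Num.Theory.
Local Open Scope ring_scope.

Section QIT.
Context {R : realType} {k : nat}.
Local Notation C := (R[i]).
Local Notation conj x := (conjc x).

(* Basis index of the k-partite space H_1 (x) ... (x) H_k, where the local
   space H_j = C^{T j} has the finite set T j as orthonormal basis. *)
Definition idx (T : 'I_k -> finType) : finType := {dffun forall j : 'I_k, T j}.

Definition vec (T : 'I_k -> finType) := idx T -> C.
Definition linop (U T : 'I_k -> finType) := idx U -> idx T -> C.
Definition dens (T : 'I_k -> finType) := idx T -> idx T -> C.

Definition unitv {T} (phi : vec T) : Prop := \sum_i conj (phi i) * phi i = 1.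

Definition proj {T} (phi : vec T) : dens T := fun i i' => phi i * conj (phi i').

(* Squared fidelity F(rho, |psi><psi|)^2 = <psi|rho|psi> (psi a unit vector). *)
Definition fid2 {T} (rho : dens T) (psi : vec T) : R :=
  complex.Re (\sum_i \sum_i' conj (psi i) * rho i i' * psi i').

Definition pdist {T} (rho : dens T) (psi : vec T) : R :=
  Num.sqrt (1 - fid2 rho psi).

Definition prodop {T U : 'I_k -> finType} (A : forall l : 'I_k, U l -> T l -> C)
  : linop U T := fun o i => \prod_l A l (o l) (i l).

Definition kraus_apply {T U} (K : linop U T) (rho : dens T) : dens U :=
  fun o o' => \sum_i \sum_i' K o i * rho i i' * conj (K o' i').

(* LOCC channels (finite-round protocols).  A round: party j performs a
   quantum instrument with outcomes x : X (broadcast to all parties), outcome x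
   being implemented by Kraus operators indexed by m : M; the operators of the
   other parties are fixed (outcome independent) local operators; the whole
   round is trace preserving.  Then, depending on x, an LOCC protocol L x is
   performed. *)
Inductive LOCC : forall T W : 'I_k -> finType, (dens T -> dens W) -> Prop :=
| LOCC_id (T : 'I_k -> finType) : LOCC (fun rho : dens T => rho)
| LOCC_round (T U W : 'I_k -> finType) (j : 'I_k) (X M : finType)
    (A : X -> M -> forall l : 'I_k, U l -> T l -> C)
    (L : X -> dens U -> dens W) :
    (forall x m x' m' l, l != j -> A x m l = A x' m' l) ->
    (forall i i0 : idx T,
        \sum_(x : X) \sum_(m : M) \sum_(o : idx U)
          conj (prodop (A x m) o i) * prodop (A x m) o i0 = (i == i0)%:R) ->
    (forall x, LOCC (L x)) ->
    LOCC (fun rho o o' =>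
            \sum_(x : X) L x (fun i i' => \sum_(m : M)
                                kraus_apply (prodop (A x m)) rho i i') o o').

Definition tens {T U : 'I_k -> finType} (phi : vec T) (psi : vec U)
  : vec (fun j => (T j * U j)%type : finType) :=
  fun i => phi (finfun (fun j => (i j).1)) * psi (finfun (fun j => (i j).2)).

Definition tpow {T : 'I_k -> finType} (n : nat) (phi : vec T)
  : vec (fun j => {ffun 'I_n -> T j} : finType) :=
  fun i => \prod_(t < n) phi (finfun (fun j => i j t)).
Arguments tpow {T} n phi.

Definition dsum {T U : 'I_k -> finType} (a b : C) (phi : vec T) (psi : vec U)
  : vec (fun j => (T j + U j)%type : finType) :=
  fun i => a * \sum_(i0 : idx T) (i == finfun (fun j => inl (i0 j)))%:R * phi i0
         + b * \sum_(i1 : idx U) (i == finfun (fun j => inr (i1 j)))%:R * psi i1.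

Definition flagged {X : finType} {U : 'I_k -> finType} (x : X) (phi : vec U)
  : vec (fun j => (X * U j)%type : finType) :=
  fun i => \sum_(i0 : idx U) (i == finfun (fun j => (x, i0 j)))%:R * phi i0.

Definition GHZ : vec (fun _ => 'I_2 : finType) :=
  fun i => if [forall j, i j == ord0] || [forall j, i j == ord_max]
           then ((Num.sqrt (2 : R))^-1)%:C%C else 0.

Definition log2 (x : R) : R := ln x / ln 2.
Definition xlogx (x : R) : R := if x == 0 then 0 else x * log2 x.
Definition hbin (p : R) : R := - xlogx p - xlogx (1 - p).

Definition Ep (E : forall T : 'I_k -> finType, dens T -> R) {T} (phi : vec T) : R :=
  E T (proj phi).

Definition fully_additive (E : forall T : 'I_k -> finType, dens T -> R) : Prop :=
  forall (T U : 'I_k -> finType) (phi : vec T) (psi : vec U),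
    unitv phi -> unitv psi -> Ep E (tens phi psi) = Ep E phi + Ep E psi.

Definition monotone_on_average (E : forall T : 'I_k -> finType, dens T -> R) : Prop :=
  forall (T U : 'I_k -> finType) (X : finType)
         (Lam : dens T -> dens (fun j => (X * U j)%type : finType))
         (phi : vec T) (P : X -> R) (phix : X -> vec U),
    LOCC Lam -> unitv phi -> (forall x, unitv (phix x)) ->
    Lam (proj phi) = (fun o o' => \sum_(x : X) (P x)%:C%C * proj (flagged x (phix x)) o o') ->
    \sum_(x : X) P x * Ep E (phix x) <= Ep E phi.

(* asymptotic LOCC convertibility phi >= psi:
   limsup_n inf { eps >= 0 : phi^{(x)n} ->_eps psi^{(x)n} } = 0 *)
Definition asym_ge {T U : 'I_k -> finType} (phi : vec T) (psi : vec U) : Prop :=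
  forall eps : R, 0 < eps -> exists N : nat, forall n : nat, (N <= n)%N ->
    exists Lam : dens (fun j => {ffun 'I_n -> T j} : finType) ->
                 dens (fun j => {ffun 'I_n -> U j} : finType),
      LOCC Lam /\ pdist (Lam (proj (tpow n phi))) (tpow n psi) <= eps.

Definition in_Fpure (E : forall T : 'I_k -> finType, dens T -> R) : Prop :=
  [/\ Ep E GHZ = 1, fully_additive E &
      forall (T U : 'I_k -> finType) (phi : vec T) (psi : vec U),
        unitv phi -> unitv psi -> asym_ge phi psi -> Ep E psi <= Ep E phi].

Definition cdims (d : 'I_k -> nat) : 'I_k -> finType := fun j => 'I_(d j) : finType.

Definition Enorm (E : forall T : 'I_k -> finType, dens T -> R) (d : 'I_k -> nat)
  (phi : vec (cdims d)) : R :=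
  Ep E phi / (1 + log2 (#|idx (cdims d)|)%:R).

(* uniform continuity of E / (1 + log dim H) on the disjoint union of the sets
   of pure states, with purified distance on each space and distance 1
   between states on different spaces *)
Definition asym_continuous (E : forall T : 'I_k -> finType, dens T -> R) : Prop :=
  forall eps : R, 0 < eps -> exists eta : R, 0 < eta /\
    (forall (d : 'I_k -> nat) (phi psi : vec (cdims d)),
        unitv phi -> unitv psi -> pdist (proj phi) psi < eta ->
        `|Enorm E phi - Enorm E psi| < eps) /\
    (1 < eta -> forall (d d' : 'I_k -> nat) (phi : vec (cdims d)) (psi : vec (cdims d')),
        unitv phi -> unitv psi -> d <> d' ->
        `|Enorm E phi - Enorm E psi| < eps).

Definition cond_sum (E : forall T : 'I_k -> finType, dens T -> R) : Prop :=
  forall (T U : 'I_k -> finType) (phi : vec T) (psi : vec U) (p : R),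
    unitv phi -> unitv psi -> 0 <= p <= 1 ->
    Ep E (dsum (Num.sqrt p)%:C%C (Num.sqrt (1 - p))%:C%C phi psi)
      = p * Ep E phi + (1 - p) * Ep E psi + hbin p.

Definition cont_a (delta : R) : R :=
  ((1 + powR delta (2 / (k.+1)%:R)) ^+ k.+1 - 1 + delta ^+ 2) / (1 - delta ^+ 2).
Definition cont_b (delta : R) : R :=
  (1 + powR delta (2 / (k.+1)%:R)) ^+ k.+1 / (1 - delta ^+ 2)
  * hbin ((1 + powR delta (2 / (k.+1)%:R))^-1).

(* The bound is stated for delta < 1; for delta = 1 its right-hand side is +oo. *)
Definition cond_bound (E : forall T : 'I_k -> finType, dens T -> R) : Prop :=
  forall (T : 'I_k -> finType) (phi psi : vec T),
    unitv phi -> unitv psi ->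
    let delta := pdist (proj phi) psi in
    delta < 1 ->
    `|Ep E phi - Ep E psi| <= cont_a delta * log2 (#|idx T|)%:R + cont_b delta.

End QIT.

(* Main.v *)
(** Every outcome of a local instrument can be announced to all parties, so [E] is
    monotone on average under arbitrary products of local instruments; in particular
    it is invariant under local isometries, nonnegative and at most [log dim], since
    a GHZ state on [dim] labels can be turned into any state by erasing the labels
    with random local signs, and additivity fixes its value on GHZ states.

    (1) -> (2): the fidelity with the target is linear in the output ensemble, and
    continuity bounds [E] from below on the members close to the target.

    (2) -> (3): the [N]-th power of [sqrt p phi (+) sqrt (1-p) psi] is a superposition
    over patterns in [{phi, psi}^N].  Measuring the number of [phi]'s gives a GHZ state
    on the type class tensored with powers of [phi] and [psi], whence ">=".  For "<=",
    the typical part is prepared from slightly fewer than [N p] copies of [phi] and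
    [N (1-p)] copies of [psi], placed as the pattern dictates, while the pattern and
    the few remaining positions are created from GHZ states.

    (3) -> (4): [phi] is proportional to [psi + delta chi] for a unit vector [chi]; it
    is obtained with known probability by locally merging the two summands of
    [sqrt p psi (+) sqrt (1-p) chi], where [p = 1/(1+t)] and [t^(k+1) = delta^2]. *)

Require Import Defs.
From HB Require Import structures.
From mathcomp Require Import all_boot all_order all_algebra.
From mathcomp Require Import reals sequences exp.
From mathcomp Require Import complex.
From mathcomp Require Import fingroup perm boolp.
From mathcomp Require Import ring lra zify.
Import Order.TTheory GRing.Theory Num.Theory.
Set Implicit Arguments.
Unset Strict Implicit.
Unset Printing Implicit Defensive.
Local Open Scope ring_scope.

(** * Local operators and LOCC channels *)

(** The relation [asym_ge] concerns [n] copies of fixed states, so the inequality [<=] of (2) -> (3)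
    works on two scales: a block of [N] copies, whose ingredients come in integer numbers strictly
    below the mean, and [n] such blocks. For fixed [N] this gap makes the atypical weight decay
    exponentially in [n]; rounding costs an amount independent of [N], which is negligible per copy
    as [N] grows. The reverse inequality holds for every admissible [E], without (2).

    A superposition prepared from a GHZ state leaves its label in the hands of the parties, where it
    would destroy coherence. It can be erased when the parties jointly hold the label in their
    outputs, each reading its own share: the signs left by the erasing measurement then factor into
    locally known ones.

    In (3) -> (4) the exponent [k + 1] counts one amplitude from the direct sum and one from each of
    the [k] local projections. The common factor of [a + 1] and [b] is the inverse of the success
    probability. *)

Lemma prod_sum_dffun (S : comPzSemiRingType) (I : finType) (T : I -> finType)
    (F : forall l, T l -> S) :
  \prod_l \sum_(t : T l) F l t
  = \sum_(i : {dffun forall l, T l}) \prod_l F l (i l).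
Proof.
rewrite (reindex (@dffun_of_fprod _ T)); last first.
  exact/onW_bij/dffun_of_fprod_bij.
transitivity (\sum_(t : fprod T | predT (fprod_fun t)) \prod_l finfun (@F l) (t l));
  last by apply: eq_bigr => t _; apply: eq_bigr => l _; rewrite !ffunE.
(* Dependent functions are traded for functions into the disjoint union of the [T l], where ordinary
   distributivity applies. *)
rewrite big_fprod_dep.
transitivity (\sum_(g in family (tagged_with T)) \prod_l untag 0 (finfun (@F l)) (g l));
  last by apply: eq_bigl => g; rewrite andbT.
rewrite -(bigA_distr_big_dep _ (fun l g => untag 0 (finfun (@F l)) g)).
apply: eq_bigr => l _; transitivity (\sum_(t : T l) finfun (@F l) t);
  last by rewrite (big_tag (fun i => finfun (@F i) : T i -> S)).
by apply: eq_bigr => t _; rewrite ffunE.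
Qed.

Section Vectors.
Context {R : realType} {k : nat}.
Local Notation C := (R[i]).
Local Notation conj x := (conjc x).
Local Notation vec := (@vec R k).
Local Notation dens := (@dens R k).
Local Notation linop := (@linop R k).
Local Notation LOCC := (@LOCC R k _ _).
Implicit Types T U W : 'I_k -> finType.

(** The squared modulus, taken in [R] rather than in [C] so that probabilities live in a totally
    ordered field. *)
Definition csq (z : C) : R := complex.Re (conj z * z).

Lemma csqE z : (csq z)%:C%C = conj z * z.
Proof. by case: z => a b; rewrite /csq /=; simpc; congr (_ +i* _)%C; ring. Qed.
Lemma csq_ge0 z : 0 <= csq z.
Proof. by case: z => a b; rewrite /csq /=; nra. Qed.
Lemma csqM z w : csq (z * w) = csq z * csq w.
Proof. by case: z w => a b [c d]; rewrite /csq /=; ring. Qed.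
Lemma csq_real (x : R) : csq x%:C%C = x ^+ 2.
Proof. by rewrite /csq /=; ring. Qed.
Lemma csq0 : csq 0 = 0. Proof. by rewrite /csq mulr0. Qed.
Lemma csq1 : csq 1 = 1. Proof. by rewrite /csq /=; ring. Qed.
Lemma csq_eq0 z : (csq z == 0) = (z == 0).
Proof.
have [->|z0] := eqVneq z 0; first by rewrite csq0 eqxx.
apply/negbTE/eqP => h; move: (csqE z); rewrite h => /esym/eqP.
by rewrite mulf_eq0 conjc_eq0 (negbTE z0).
Qed.

Definition nrm T (v : vec T) : R := \sum_i csq (v i).
Lemma nrm_ge0 T (v : vec T) : 0 <= nrm v.
Proof. by apply: sumr_ge0 => i _; exact: csq_ge0. Qed.
Lemma nrmE T (v : vec T) : (nrm v)%:C%C = \sum_i conj (v i) * v i.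
Proof. by rewrite /nrm rmorph_sum; apply: eq_bigr => i _; rewrite -csqE. Qed.
Lemma unitvP T (v : vec T) : unitv v <-> nrm v = 1.
Proof.
rewrite /unitv -nrmE; split => [h|->//].
by apply: (@complexI R); rewrite h.
Qed.

Definition scl T (c : C) (v : vec T) : vec T := fun i => c * v i.
Lemma nrm_scl T c (v : vec T) : nrm (scl c v) = csq c * nrm v.
Proof. by rewrite /nrm mulr_sumr; apply: eq_bigr => i _; rewrite csqM. Qed.
Lemma nrm_eq0 T (v : vec T) : nrm v = 0 -> v = fun _ => 0.
Proof.
move=> h; apply: funext => i; apply/eqP; rewrite -csq_eq0.
have /psumr_eq0P h2 : forall i, true -> 0 <= csq (v i).
  by move=> j _; exact: csq_ge0.
by rewrite h2.
Qed.

(** The vector [u] is a stand-in direction for [v = 0]: outcomes of probability zero still have to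
    carry a unit vector. *)
Lemma normalize T (v u : vec T) : unitv u ->
  exists c v', [/\ unitv v', v = scl c v' & csq c = nrm v].
Proof.
move=> hu; have [h|h] := eqVneq (nrm v) 0.
  exists 0, u; split => //; last by rewrite csq0 h.
  by rewrite (nrm_eq0 h); apply: funext => i; rewrite /scl mul0r.
have hp : 0 < nrm v by rewrite lt_neqAle eq_sym h nrm_ge0.
have h0 : (Num.sqrt (nrm v))%:C%C != 0 :> C.
  by rewrite (inj_eq (@complexI R) _ 0) gt_eqF// sqrtr_gt0.
exists (Num.sqrt (nrm v))%:C%C, (scl ((Num.sqrt (nrm v))^-1)%:C%C v); split.
- apply/unitvP; rewrite nrm_scl csq_real exprVn sqr_sqrtr ?nrm_ge0//.
  by rewrite mulVf.
- by apply: funext => i; rewrite /scl mulrA -rmorphM divff ?rmorph1 ?mul1r// gt_eqF// sqrtr_gt0.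
- by rewrite csq_real sqr_sqrtr// nrm_ge0.
Qed.

Definition app T U (K : linop U T) (v : vec T) : vec U :=
  fun o => \sum_i K o i * v i.

Lemma kraus_proj T U (K : linop U T) (v : vec T) :
  kraus_apply K (proj v) = proj (app K v).
Proof.
apply: funext => o; apply: funext => o'; rewrite /kraus_apply /proj /app.
rewrite rmorph_sum mulr_suml; apply: eq_bigr => i _.
rewrite mulr_sumr; apply: eq_bigr => i' _; rewrite rmorphM; ring.
Qed.

Lemma proj_scl T c (v : vec T) :
  proj (scl c v) = fun i i' => (csq c)%:C%C * proj v i i'.
Proof.
apply: funext => i; apply: funext => i'; rewrite /proj /scl csqE rmorphM; ring.
Qed.

Definition lop U T := forall l, U l -> T l -> C.
Definition mulop W U T (B : lop W U) (A : lop U T) : lop W T :=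
  fun l w t => \sum_u B l w u * A l u t.

Lemma app_prodopM W U T (B : lop W U) (A : lop U T) (v : vec T) :
  app (prodop B) (app (prodop A) v) = app (prodop (mulop B A)) v.
Proof.
apply: funext => w; rewrite /app.
under eq_bigr => u _ do rewrite mulr_sumr.
rewrite exchange_big; apply: eq_bigr => t _ /=.
under eq_bigr => u _ do rewrite mulrA -big_split.
rewrite -mulr_suml; congr (_ * _).
by rewrite /prodop /mulop prod_sum_dffun.
Qed.

Lemma kraus_prodopM W U T (B : lop W U) (A : lop U T) (rho : dens T) :
  kraus_apply (prodop B) (kraus_apply (prodop A) rho)
  = kraus_apply (prodop (mulop B A)) rho.
Proof.
have H w t : prodop (mulop B A) w t = \sum_u prodop B w u * prodop A u t.
  by rewrite /prodop /mulop prod_sum_dffun; apply: eq_bigr => u _; rewrite big_split.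
apply: funext => w; apply: funext => w'; rewrite /kraus_apply.
pose F u u' i i' := prodop B w u * prodop A u i * rho i i' *
  conj (prodop A u' i') * conj (prodop B w' u').
transitivity (\sum_u \sum_u' \sum_i \sum_i' F u u' i i').
  apply: eq_bigr => u _; apply: eq_bigr => u' _.
  rewrite mulr_sumr mulr_suml; apply: eq_bigr => i _.
  rewrite mulr_sumr mulr_suml; apply: eq_bigr => i' _; rewrite /F; ring.
transitivity (\sum_i \sum_i' \sum_u \sum_u' F u u' i i').
  under eq_bigr => u _ do rewrite exchange_big.
  rewrite exchange_big; apply: eq_bigr => i _ /=.
  under eq_bigr => u _ do rewrite exchange_big.
  by rewrite exchange_big.
apply: eq_bigr => i _; apply: eq_bigr => i' _.
rewrite !H rmorph_sum !mulr_suml; apply: eq_bigr => u _.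
rewrite mulr_sumr; apply: eq_bigr => u' _; rewrite /F rmorphM; ring.
Qed.

Lemma prod_delta T (i i0 : idx T) :
  \prod_l ((i l == i0 l)%:R : C) = (i == i0)%:R.
Proof.
have [->|h] := eqVneq i i0; first by rewrite big1// => l _; rewrite eqxx.
case: (pickP (fun l => i l != i0 l)) => [l hl|hn].
  by rewrite (bigD1 l)//= (negbTE hl) mul0r.
by case/eqP: h; apply/ffunP => l; apply/eqP; move: (hn l) => /negbFE.
Qed.

(** Entries of the adjoint of [A l] times [A l]; isometry and trace preservation become equations
    between such entries, one party at a time. *)
Definition gram T U (A : lop U T) l t t0 : C := \sum_o conj (A l o t) * A l o t0.

Lemma prodop_gram T U (A : lop U T) i i0 :
  \sum_o conj (prodop A o i) * prodop A o i0 = \prod_l gram A (i l) (i0 l).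
Proof.
rewrite /gram prod_sum_dffun /prodop; apply: eq_bigr => o _.
by rewrite rmorph_prod -big_split.
Qed.

Lemma LOCC_ext T W (f g : dens T -> dens W) : LOCC f ->
  (forall rho o o', f rho o o' = g rho o o') -> LOCC g.
Proof.
move=> hf h; have <- // : f = g.
by apply: funext => rho; apply: funext => o; apply: funext => o'.
Qed.

(** A channel is a function on all matrices, so linearity is not built in; a round is linear through
    its Kraus form, and the continuations are by induction. *)
Lemma LOCC_linear T W (Lam : dens T -> dens W) : LOCC Lam ->
  forall (X : finType) (a : X -> C) (rho : X -> dens T),
  Lam (fun i i' => \sum_x a x * rho x i i')
  = fun o o' => \sum_x a x * Lam (rho x) o o'.
Proof.
elim=> {T W Lam} [T//|T U W j X M A L _ _ _ IH] Y a rho.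
apply: funext => o; apply: funext => o'.
under [RHS]eq_bigr => y _ do rewrite mulr_sumr.
rewrite exchange_big; apply: eq_bigr => x _ /=.
rewrite -(congr1 (fun f => f o o') (IH x Y a _)); congr (L x _ o o').
apply: funext => u; apply: funext => u'; rewrite /kraus_apply.
pose F m y i i' := a y * (prodop (A x m) u i * rho y i i' * conj (prodop (A x m) u' i')).
transitivity (\sum_m \sum_i \sum_i' \sum_y F m y i i').
  apply: eq_bigr => m _; apply: eq_bigr => i _; apply: eq_bigr => i' _.
  rewrite mulr_sumr mulr_suml; apply: eq_bigr => y _; rewrite /F; ring.
transitivity (\sum_y \sum_m \sum_i \sum_i' F m y i i').
  rewrite [RHS]exchange_big; apply: eq_bigr => m _ /=.
  rewrite [RHS]exchange_big; apply: eq_bigr => i _ /=.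
  by rewrite exchange_big.
apply: eq_bigr => y _; rewrite mulr_sumr; apply: eq_bigr => m _.
by rewrite mulr_sumr; apply: eq_bigr => i _; rewrite mulr_sumr.
Qed.

Lemma LOCC_sum T W (Lam : dens T -> dens W) : LOCC Lam ->
  forall (X : finType) (rho : X -> dens T),
  Lam (fun i i' => \sum_x rho x i i') = fun o o' => \sum_x Lam (rho x) o o'.
Proof.
move=> hL X rho; have := LOCC_linear hL (fun=> 1) rho.
have -> : (fun i i' => \sum_x 1 * rho x i i') = (fun i i' => \sum_x rho x i i').
  by apply: funext => i; apply: funext => i'; apply: eq_bigr => x _; rewrite mul1r.
move=> ->; apply: funext => i; apply: funext => i'; apply: eq_bigr => x _.
by rewrite mul1r.
Qed.

Lemma LOCC_scale T W (Lam : dens T -> dens W) : LOCC Lam ->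
  forall a (rho : dens T),
  Lam (fun i i' => a * rho i i') = fun o o' => a * Lam rho o o'.
Proof.
move=> hL a rho; have := @LOCC_linear _ _ _ hL unit (fun=> a) (fun=> rho).
have H V (r : dens V) :
  (fun i i' => \sum_(x : unit) a * r i i') = (fun i i' => a * r i i').
  by apply: funext => i; apply: funext => i'; rewrite big_const card_unit /= addr0.
by rewrite !H.
Qed.

Lemma LOCC_trace T W (Lam : dens T -> dens W) : LOCC Lam ->
  forall rho, \sum_o Lam rho o o = \sum_i rho i i.
Proof.
elim=> {T W Lam} [T//|T U W j X M A L _ hTP _ IH] rho.
rewrite exchange_big /=.
under eq_bigr => x _ do rewrite IH.
rewrite /kraus_apply.
pose F x m o i i' := rho i i' * (conj (prodop (A x m) o i') * prodop (A x m) o i).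
transitivity (\sum_x \sum_m \sum_o \sum_i \sum_i' F x m o i i').
  apply: eq_bigr => x _; rewrite exchange_big; apply: eq_bigr => m _ /=.
  apply: eq_bigr => o _; apply: eq_bigr => i _; apply: eq_bigr => i' _.
  rewrite /F; ring.
transitivity (\sum_i \sum_i' \sum_x \sum_m \sum_o F x m o i i').
  rewrite [RHS](eq_bigr _ (fun i _ => exchange_big _ _ _ _ _ _)) [RHS]exchange_big.
  apply: eq_bigr => x _ /=.
  rewrite [RHS](eq_bigr _ (fun i _ => exchange_big _ _ _ _ _ _)) [RHS]exchange_big.
  apply: eq_bigr => m _ /=.
  rewrite [RHS](eq_bigr _ (fun i _ => exchange_big _ _ _ _ _ _)) [RHS]exchange_big.
  by apply: eq_bigr.
apply: eq_bigr => i _; transitivity (\sum_i' rho i i' * (i' == i)%:R).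
  apply: eq_bigr => i' _; rewrite -hTP mulr_sumr; apply: eq_bigr => x _.
  rewrite mulr_sumr; apply: eq_bigr => m _.
  by rewrite mulr_sumr.
rewrite (bigD1 i)//= eqxx mulr1 big1 ?addr0// => i' /negbTE ->.
by rewrite mulr0.
Qed.

(** Protocols only grow inside the continuations of a round, so [g] is moved through the sum over
    outcomes by linearity and absorbed into each continuation. *)
Lemma LOCC_comp T U W (f : dens T -> dens U) (g : dens U -> dens W) :
  LOCC f -> LOCC g -> LOCC (fun rho => g (f rho)).
Proof.
move=> hf; elim: hf W g => {T U f} [T|T U V j X M A L hA hTP hL IH] W g hg //.
have -> : (fun rho : dens T => g (fun o o' => \sum_x L x (fun i i' =>
    \sum_m kraus_apply (prodop (A x m)) rho i i') o o')) =
  (fun rho o o' => \sum_x g (L x (fun i i' =>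
    \sum_m kraus_apply (prodop (A x m)) rho i i')) o o').
  by apply: funext => rho; rewrite (LOCC_sum hg).
by apply: (@LOCC_round _ _ _ _ _ j X M A (fun x rho => g (L x rho))) => // x; exact: IH.
Qed.

(** The instrument [A] is realizable with its outcome known to all parties. The outcome exists only
    for the rest of the protocol, hence the quantification over all continuations [L]. *)
Definition impl (X : finType) T U (A : X -> linop U T) : Prop :=
  forall W (L : X -> dens U -> dens W), (forall x, LOCC (L x)) ->
  LOCC (fun rho o o' => \sum_x L x (kraus_apply (A x) rho) o o').

Lemma impl_round (X : finType) T U (j : 'I_k) (A : X -> lop U T) :
  (forall x x' l, l != j -> A x l = A x' l) ->
  (forall i i0 : idx T, \sum_x \prod_l gram (A x) (i l) (i0 l) = (i == i0)%:R) ->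
  impl (fun x => prodop (A x)).
Proof.
move=> hA hTP W L hL.
have -> : (fun rho o o' => \sum_x L x (kraus_apply (prodop (A x)) rho) o o')
  = (fun rho o o' => \sum_x L x (fun i i' => \sum_(m : unit)
       kraus_apply (prodop (A x)) rho i i') o o').
  apply: funext => rho; apply: funext => o; apply: funext => o'.
  apply: eq_bigr => x _; congr (L x _ o o').
  by apply: funext => i; apply: funext => i'; rewrite big_const card_unit /= addr0.
apply: (@LOCC_round _ _ _ _ _ j X unit (fun x _ => A x) L) => //.
- by move=> x _ x' _ l; exact: hA.
- move=> i i0; rewrite -hTP; apply: eq_bigr => x _.
  by rewrite big_const card_unit /= addr0 prodop_gram.
Qed.

(** In a round the parties other than [j] may apply fixed local operators, so isometries at all
    parties fit into one round with a single outcome; [hk] provides the party [j]. *)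
Lemma impl_local_isometry T U (hk : (0 < k)%N) (A : lop U T) :
  (forall l t t0, gram A t t0 = (t == t0 :> T l)%:R) ->
  impl (fun _ : unit => prodop A).
Proof.
move=> hA; apply: (@impl_round unit _ _ (Ordinal hk) (fun=> A)) => // i i0.
rewrite big_const card_unit /= addr0 -prod_delta.
by apply: eq_bigr => l _; rewrite hA.
Qed.

Lemma impl_one_party (X : finType) T (j : 'I_k) (A : X -> lop T T) :
  (forall x l, l != j -> A x l = fun t t0 => (t == t0)%:R) ->
  (forall t t0, \sum_x gram (A x) t t0 = (t == t0 :> T j)%:R) ->
  impl (fun x => prodop (A x)).
Proof.
move=> hA hTP; apply: (impl_round (j := j)).
  by move=> x x' l hl; rewrite !hA.
move=> i i0; rewrite -prod_delta (bigD1 j)//= -hTP mulr_suml.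
apply: eq_bigr => x _; rewrite (bigD1 j)//=; congr (_ * _).
apply: eq_bigr => l hl; rewrite /gram hA//.
rewrite (bigD1 (i l))//= eqxx rmorph1 mul1r big1 ?addr0// => o /negbTE ho.
by rewrite ho rmorph0 mul0r.
Qed.

Lemma gram_delta (V : finType) (t t0 : V) :
  \sum_(o : V) conj ((o == t)%:R : C) * (o == t0)%:R = (t == t0)%:R.
Proof.
rewrite (bigD1 t)//= eqxx rmorph1 mul1r big1 ?addr0// => o /negbTE ho.
by rewrite ho rmorph0 mul0r.
Qed.

Lemma sum_deltal (V : finType) (o : V) (F : V -> C) :
  \sum_u (o == u)%:R * F u = F o.
Proof.
rewrite (bigD1 o)//= eqxx mul1r big1 ?addr0// => u /negbTE hu.
by rewrite eq_sym hu mul0r.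
Qed.

Lemma sum_deltar (V : finType) (o : V) (F : V -> C) :
  \sum_u F u * (u == o)%:R = F o.
Proof.
rewrite (bigD1 o)//= eqxx mulr1 big1 ?addr0// => u /negbTE hu.
by rewrite hu mulr0.
Qed.

(** * Instruments at all parties, performed one after another *)

Section ProductInstrument.
Variables (T U X : 'I_k -> finType) (K : forall l, X l -> U l -> T l -> C).
Hypothesis hk : (0 < k)%N.
Hypothesis hTP : forall l t t0,
  \sum_(x : X l) \sum_o conj (K x o t) * K x o t0 = (t == t0)%:R.

Definition hyb (n : nat) (l : 'I_k) : finType := if (l < n)%N then U l else T l.

(** The operator from stage [b'] to stage [b] of party [l], where [true] means that it has measured:
    [A] is the measurement, equal stages give the identity, and the impossible way back is a dummy
    zero. *)
Definition hop (b b' : bool) l (A : U l -> T l -> C) :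
  ((if b then U l else T l) : finType) -> ((if b' then U l else T l) : finType) -> C :=
  match b, b' with
  | true, true => fun o i => (o == i)%:R
  | true, false => A
  | false, true => fun _ _ => 0
  | false, false => fun o i => (o == i)%:R
  end.

Definition upd (x : forall l, X l) j (y : X j) : forall l, X l := dfwith x y.

(* Backward induction on the number [n] of parties that have already measured;
   [x] records their outcomes and is irrelevant on the remaining parties. *)
Lemma product_instrument_from n W (L : idx X -> dens U -> dens W) :
  (forall x, LOCC (L x)) -> (n <= k)%N -> forall x : (forall l, X l),
  LOCC (fun (rho : dens (hyb n)) o o' =>
    \sum_(x' : idx X | [forall l : 'I_k, (l < n)%N ==> (x' l == x l)])
      L x' (kraus_apply (prodop (fun l : 'I_k => @hop true (l < n)%N l (@K l (x' l)))) rho) o o').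
Proof.
move=> hL hn; rewrite -(subKn hn); move: (k - n)%N (leq_subr n k) => m {n hn}.
elim: m => [|m IH] hm x.
  rewrite subn0.
  have hx (x' : idx X) : [forall l : 'I_k, (l < k)%N ==> (x' l == x l)] = (x' == finfun x).
    apply/forallP/eqP => [h|-> l]; last by rewrite ffunE eqxx implybT.
    by apply/ffunP => l; rewrite ffunE; move: (h l); rewrite ltn_ord => /eqP.
  have hI : impl (fun _ : unit =>
      prodop (fun l : 'I_k => @hop true (l < k)%N l (@K l (finfun x l)))).
    apply: impl_local_isometry => // l.
    by rewrite /gram /hyb /=; case: (l < k)%N (ltn_ord l) => // _; exact: gram_delta.
  apply: (LOCC_ext (hI _ (fun=> L (finfun x)) (fun=> hL _))) => rho o o' /=.
  by rewrite big_const card_unit /= addr0 (eq_bigl _ _ hx) big_pred1_eq.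
have hmk : (m <= k)%N by apply: ltnW.
have En : (k - m = (k - m.+1).+1)%N by lia.
have hnk : (k - m.+1 < k)%N by lia.
move: IH => /(_ hmk); rewrite {}En; move: (k - m.+1)%N hnk => n hnk IH.
pose j := Ordinal hnk.
pose A (y : X j) : lop (hyb n.+1) (hyb n) :=
  fun l => @hop (l < n.+1)%N (l < n)%N l (@K l (upd x y l)).
have hI : impl (fun y => prodop (A y)).
  apply: (impl_round (j := j)) => [y y' l hl|i i0].
    have : (l < n.+1)%N = (l < n)%N.
      by rewrite ltnS leq_eqVlt; move: hl; rewrite -val_eqE /= => /negbTE ->.
    rewrite /A /hop /hyb; case: (l < n.+1)%N; case: (l < n)%N => //.
  rewrite -prod_delta (bigD1 j)//=.
  have hj (y y' : X j) l : l != j -> gram (A y) (i l) (i0 l) = (i l == i0 l)%:R.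
    move=> hl; have : (l < n.+1)%N = (l < n)%N.
      by rewrite ltnS leq_eqVlt; move: hl; rewrite -val_eqE /= => /negbTE ->.
    move: (i l) (i0 l); rewrite /A /gram /hop /hyb.
    by case: (l < n.+1)%N; case: (l < n)%N => // a b _; exact: gram_delta.
  transitivity (\sum_(y : X j) gram (A y) (i j) (i0 j) *
      \prod_(l | l != j) ((i l == i0 l)%:R : C)).
    apply: eq_bigr => y _; rewrite (bigD1 j)//=; congr (_ * _).
    by apply: eq_bigr => l; exact: hj.
  rewrite -mulr_suml; congr (_ * _).
  rewrite /gram /A; move: (i j) (i0 j); rewrite /hyb /hop /= ltnn ltnSn => a b.
  rewrite -hTP; apply: eq_bigr => y _; apply: eq_bigr => o _.
  by rewrite /upd dfwith_in.
apply: (LOCC_ext (hI _ _ (fun y => IH (upd x y)))) => rho o o' /=.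
(* Outcome strings are grouped by the entry of party [j]: its round comes first, then the inductive
   protocol for the record [upd x y]. *)
rewrite (partition_big (fun x' : idx X => x' j) predT)//=.
apply: eq_bigr => y _; apply: eq_big => [x'|x' hx'].
  apply/forallP/andP => [h|[/forallP h /eqP hy] l].
    split; last first.
      by move: (h j); rewrite ltnSn /upd dfwith_in.
    apply/forallP => l; apply/implyP => hl; move: (h l).
    rewrite ltnS (ltnW hl) /upd dfwith_out// -val_eqE /= gtn_eqF//.
  apply/implyP; rewrite ltnS leq_eqVlt => /orP[/eqP hl|hl].
    have -> : l = j by apply: val_inj.
    by rewrite /upd dfwith_in hy.
  rewrite /upd dfwith_out; first by move: (h l); rewrite hl.
  by rewrite -val_eqE /= gtn_eqF.
congr (L x' _ o o'); rewrite kraus_prodopM; congr (kraus_apply (prodop _) rho).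
apply: functional_extensionality_dep => l; apply: funext => w; apply: funext => t.
rewrite /mulop /A.
have hx'l : (l < n.+1)%N -> (l < n)%N = false -> upd x y l = x' l.
  by move=> hl _; move/forallP: hx' => /(_ l); rewrite hl => /eqP.
have hlt : (l < n)%N -> (l < n.+1)%N by move=> hl; rewrite ltnS ltnW.
move: w t hx'l hlt; rewrite /hyb /hop.
case: (l < n.+1)%N; case: (l < n)%N => w t h1 h2.
- exact: sum_deltal.
- by rewrite sum_deltal h1.
- by have := h2 isT.
- exact: sum_deltar.
Qed.

Lemma impl_prod (x0 : idx X) :
  impl (fun x : idx X => prodop (fun l => @K l (x l))).
Proof.
move=> W L hL; have := @product_instrument_from 0 W L hL (leq0n k) x0.
move=> h; apply: (LOCC_ext h) => rho o o' /=.
by apply: eq_bigl => x; rewrite /= (introT forallP).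
Qed.
End ProductInstrument.
End Vectors.

(** * Exact conversions between pure states *)

Lemma big_option (S : nmodType) (V : finType) (F : option V -> S) :
  \sum_x F x = F None + \sum_u F (Some u).
Proof.
rewrite (bigD1 None)//=; congr (_ + _).
rewrite (reindex_omap Some id) => [|[u|//] _ //].
by apply: eq_bigl => u; rewrite eqxx.
Qed.

Lemma sqrtr_exp (R : realType) (x : R) n : 0 <= x ->
  Num.sqrt (x ^+ n) = Num.sqrt x ^+ n.
Proof.
move=> hx; elim: n => [|n IH]; first by rewrite !expr0 sqrtr1.
by rewrite !exprS sqrtrM// IH.
Qed.

Section Conversions.
Context {R : realType} {k : nat}.
Local Notation C := (R[i]).
Local Notation conj x := (conjc x).
Local Notation vec := (@vec R k).
Local Notation dens := (@dens R k).
Local Notation linop := (@linop R k).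
Local Notation lop := (@lop R k).
Local Notation LOCC := (@LOCC R k _ _).
Implicit Types T U W : 'I_k -> finType.
Hypothesis hk : (0 < k)%N.

Definition fmap T U (f : forall l, T l -> U l) (i : idx T) : idx U :=
  finfun (fun l => f l (i l)).

(** Linear extension of a relabelling of the local bases, a product of local isometries when [f] is
    injective. Both halves of [dsum] and the vectors [flagged] have literally this form. *)
Definition push T U (f : forall l, T l -> U l) (v : vec T) : vec U :=
  fun o => \sum_i (o == fmap f i)%:R * v i.

Lemma fmap_inj T U (f : forall l, T l -> U l) :
  (forall l, injective (f l)) -> injective (fmap f).
Proof.
move=> hf i i' /ffunP h; apply/ffunP => l.
by apply: hf; move: (h l); rewrite !ffunE.
Qed.

Lemma push_fmap T U (f : forall l, T l -> U l) (v : vec T) i :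
  injective (fmap f) -> push f v (fmap f i) = v i.
Proof.
move=> hf; rewrite /push (bigD1 i)//= eqxx mul1r big1 ?addr0// => j hj.
by rewrite (inj_eq hf) eq_sym (negbTE hj) mul0r.
Qed.

Lemma push_out T U (f : forall l, T l -> U l) (v : vec T) o :
  (forall i, o != fmap f i) -> push f v o = 0.
Proof. by move=> h; rewrite /push big1// => i _; rewrite (negbTE (h i)) mul0r. Qed.

Lemma push_eq T U (f : forall l, T l -> U l) (v : vec T) (w : vec U) :
  injective (fmap f) -> (forall i, w (fmap f i) = v i) ->
  (forall o, (forall i, o != fmap f i) -> w o = 0) -> w = push f v.
Proof.
move=> hf h1 h0; apply: funext => o.
case: (pickP (fun i => o == fmap f i)) => [i /eqP ->|hn].
  by rewrite push_fmap.
have hn' i : o != fmap f i by rewrite hn.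
by rewrite push_out// h0.
Qed.

Lemma push_bij_eq T U (f : forall l, T l -> U l) (g : forall l, U l -> T l)
    (v : vec T) (w : vec U) :
  (forall l, cancel (f l) (g l)) -> (forall l, cancel (g l) (f l)) ->
  (forall i, w (fmap f i) = v i) -> w = push f v.
Proof.
move=> fg gf h; apply: push_eq => //; first by apply: fmap_inj => l; exact: can_inj (fg l).
move=> o /(_ (fmap g o)) /eqP[]; apply/ffunP => l; rewrite !ffunE gf//.
Qed.

Lemma nrm_push T U (f : forall l, T l -> U l) (v : vec T) :
  injective (fmap f) -> nrm (push f v) = nrm v.
Proof.
move=> hf; apply: (@complexI R); rewrite !nrmE.
transitivity (\sum_o \sum_i conj (push f v o) * ((o == fmap f i)%:R * v i)).
  by apply: eq_bigr => o _; rewrite -mulr_sumr.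
rewrite exchange_big; apply: eq_bigr => i _ /=.
rewrite (bigD1 (fmap f i))//= eqxx mul1r push_fmap// big1 ?addr0// => o /negbTE ->.
by rewrite mul0r mulr0.
Qed.

Definition bop T U (f : forall l, T l -> U l) : lop U T :=
  fun l o t => (o == f l t)%:R.

Lemma app_bop T U (f : forall l, T l -> U l) (v : vec T) :
  app (prodop (bop f)) v = push f v.
Proof.
apply: funext => o; apply: eq_bigr => i _; congr (_ * _).
by rewrite -prod_delta; apply: eq_bigr => l _; rewrite ffunE.
Qed.

Lemma gram_bop T U (f : forall l, T l -> U l) : (forall l, injective (f l)) ->
  forall l t t0, gram (bop f) t t0 = (t == t0 :> T l)%:R.
Proof.
by move=> hf l t t0; rewrite /gram /bop gram_delta (inj_eq (hf l)).
Qed.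

(** Exact deterministic conversion. The vectors need not be normalized, so both sides may be
    rescaled together. *)
Definition reach T U (phi : vec T) (psi : vec U) : Prop :=
  exists Lam : dens T -> dens U, LOCC Lam /\ Lam (proj phi) = proj psi.

Lemma reach_refl T (phi : vec T) : reach phi phi.
Proof. by exists (fun rho => rho); split => //; exact: LOCC_id. Qed.

Lemma reach_trans T U W (phi : vec T) (psi : vec U) (chi : vec W) :
  reach phi psi -> reach psi chi -> reach phi chi.
Proof.
move=> [f [hf ef]] [g [hg eg]]; exists (fun rho => g (f rho)).
by rewrite ef; split => //; exact: LOCC_comp.
Qed.

Lemma reach_nrm T U (phi : vec T) (psi : vec U) : reach phi psi -> nrm psi = nrm phi.
Proof.
move=> [f [hf ef]]; have := LOCC_trace hf (proj phi); rewrite ef => h.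
apply: (@complexI R); rewrite !nrmE.
transitivity (\sum_o proj psi o o); first by apply: eq_bigr => o _; rewrite mulrC.
by rewrite h; apply: eq_bigr => o _; rewrite mulrC.
Qed.

Lemma LOCC_local_isometry T U (A : lop U T) :
  (forall l t t0, gram A t t0 = (t == t0 :> T l)%:R) ->
  LOCC (fun rho : dens T => kraus_apply (prodop A) rho).
Proof.
move=> hA; apply: (LOCC_ext (impl_local_isometry hk hA (fun=> @LOCC_id R k U))).
by move=> rho o o'; rewrite big_const card_unit /= addr0.
Qed.

Lemma reach_local_isometry T U (A : lop U T) (v : vec T) :
  (forall l t t0, gram A t t0 = (t == t0 :> T l)%:R) ->
  reach v (app (prodop A) v).
Proof.
by move=> /LOCC_local_isometry hA; exists (kraus_apply (prodop A)); rewrite kraus_proj.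
Qed.

Lemma reach_push T U (f : forall l, T l -> U l) (v : vec T) :
  (forall l, injective (f l)) -> reach v (push f v).
Proof. by move=> hf; rewrite -app_bop; apply/reach_local_isometry/gram_bop. Qed.

(** Each branch applies its own correction towards the same [psi], so the average over outcomes is
    pure again. *)
Lemma reach_step (X : finType) T U W (A : X -> linop U T) (phi : vec T)
    (psi : vec W) (c : X -> C) (v : X -> vec U) :
  impl A -> \sum_x csq (c x) = 1 ->
  (forall x, app (A x) phi = scl (c x) (v x)) ->
  (forall x, reach (v x) psi) -> reach phi psi.
Proof.
move=> hA hc hv hr.
have hr' x : exists L : dens U -> dens W, LOCC L /\ L (proj (v x)) = proj psi.
  exact: hr.
have [L hL] := boolp.choice hr'.
exists (fun rho o o' => \sum_x L x (kraus_apply (A x) rho) o o'); split.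
  by apply: hA => x; exact: (hL x).1.
apply: funext => o; apply: funext => o'.
under eq_bigr => x _ do
  rewrite kraus_proj hv proj_scl (LOCC_scale (hL x).1) (hL x).2.
by rewrite -mulr_suml -rmorph_sum hc mul1r.
Qed.

(** A channel inverting an embedding: a party that finds a basis vector outside the range of [f]
    announces it and resets to [i0], which never happens on [push f v]. *)
Lemma reach_pull T U (f : forall l, T l -> U l) (v : vec T) (i0 : idx T) :
  (forall l, injective (f l)) -> reach (push f v) v.
Proof.
move=> hf.
pose X l : finType := option (U l).
pose K l (x : X l) (t : T l) (u : U l) : C :=
  if x is Some u0 then ((u == u0) && (u \notin codom (f l)) && (t == i0 l))%:R
  else (u == f l t)%:R.
have hK l u u' : \sum_(x : X l) \sum_o conj (K l x o u) * K l x o u' = (u == u')%:R.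
  rewrite big_option /K /=.
  have [/codomP[t ->]|hu] := boolP (u \in codom (f l)).
    rewrite [X in _ + X]big1 ?addr0; last first.
      by move=> u0 _; rewrite big1// => o _; rewrite andbF andFb rmorph0 mul0r.
    rewrite (bigD1 t)//= eqxx rmorph1 mul1r big1 ?addr0; first by rewrite eq_sym.
    by move=> o /negbTE ho; rewrite (inj_eq (hf l)) eq_sym ho rmorph0 mul0r.
  rewrite big1 ?add0r; last first.
    move=> o _; have -> : (u == f l o) = false; last by rewrite rmorph0 mul0r.
    by apply: contraNF hu => /eqP ->; exact: codom_f.
  rewrite (bigD1 u)//= [X in _ + X]big1 ?addr0; last first.
    move=> u0 hu0; rewrite big1// => o _.
    by rewrite eq_sym (negbTE hu0) rmorph0 mul0r.
  rewrite (bigD1 (i0 l))//= !eqxx rmorph1 mul1r big1 ?addr0; last first.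
    by move=> o /negbTE ->; rewrite andbF rmorph0 mul0r.
  rewrite andbT eq_sym; have [<-|//] := eqVneq u u'.
  by rewrite hu.
pose x0 : idx X := finfun (fun l => None).
apply: (reach_step (impl_prod hk hK x0) (c := fun x => (x == x0)%:R) (v := fun=> v)).
- rewrite (bigD1 x0)//= eqxx csq1 big1 ?addr0// => x /negbTE ->; exact: csq0.
- move=> x; rewrite -(app_bop f) app_prodopM; apply: funext => t.
  rewrite /scl; case: eqVneq => [->|hx].
    rewrite mul1r /app -[RHS](sum_deltal t v); apply: eq_bigr => i _; congr (_ * _).
    rewrite -prod_delta; apply: eq_bigr => l _.
    rewrite /mulop ffunE /K /bop sum_deltar (inj_eq (hf l)) eq_sym.
    by [].
  have [l hl] : exists l, x l != None.
    apply/existsP; apply: contraR hx => /existsPn hx.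
    by apply/eqP/ffunP => l; rewrite ffunE; apply/eqP; move: (hx l); rewrite negbK.
  rewrite mul0r /app big1// => i _.
  rewrite /prodop (bigD1 l)//= /mulop /bop sum_deltar /K.
  by case: (x l) hl => // u0 _; rewrite codom_f andbF !mul0r.
- by move=> _; exact: reach_refl.
Qed.

Definition one_vec : vec (fun=> unit : finType) := fun=> 1.

Definition pairi T U (i : idx T) (j : idx U) : idx (fun l => (T l * U l)%type : finType) :=
  finfun (fun l => (i l, j l)).

Lemma sum_pairi T U (S : nmodType) (F : idx (fun l => (T l * U l)%type : finType) -> S) :
  \sum_i F i = \sum_i \sum_j F (pairi i j).
Proof.
rewrite pair_big /= (reindex (fun p : idx T * idx U => pairi p.1 p.2)) //=.
exists (fun i => (fmap (fun l => fst) i, fmap (fun l => snd) i)) => [[i j]|i] _ /=.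
  by congr (_, _); apply/ffunP => l; rewrite !ffunE.
by apply/ffunP => l; rewrite !ffunE -surjective_pairing.
Qed.

Lemma tens_pairi T U (phi : vec T) (psi : vec U) i j :
  tens phi psi (pairi i j) = phi i * psi j.
Proof.
by rewrite /tens; congr (phi _ * psi _); apply/ffunP => l; rewrite !ffunE.
Qed.

Lemma nrm_tens T U (phi : vec T) (psi : vec U) :
  nrm (tens phi psi) = nrm phi * nrm psi.
Proof.
rewrite /nrm sum_pairi mulr_suml; apply: eq_bigr => i _.
by rewrite mulr_sumr; apply: eq_bigr => j _; rewrite tens_pairi csqM.
Qed.

(** Powers over any finite index type; [tpow] is the case ['I_n], while blocks of copies are indexed
    by ['I_n * 'I_N]. *)
Definition gpow T (J : finType) (phi : vec T) : vec (fun l => {ffun J -> T l} : finType) :=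
  fun i => \prod_(t : J) phi (finfun (fun l => i l t)).

Arguments gpow {T} J phi.

Lemma tpow_gpow T n (phi : vec T) : @tpow R k T n phi = gpow 'I_n phi.
Proof. by []. Qed.

(** A basis index of the power is a table of parties against copies; read copy by copy, it is a
    family of indices of [T], and distributivity applies. *)
Lemma sum_gpow T (J : finType) (S : comPzSemiRingType) (F : J -> idx T -> S) :
  \sum_(i : idx (fun l => {ffun J -> T l} : finType)) \prod_t F t (finfun (fun l => i l t))
  = \prod_t \sum_i F t i.
Proof.
rewrite bigA_distr_bigA (reindex (fun f : {ffun J -> idx T} =>
  (finfun (fun l => [ffun t => f t l]) : idx (fun l => {ffun J -> T l} : finType)))) /=.
  apply: eq_bigr => f _; apply: eq_bigr => t _; congr (F t _).
  by apply/ffunP => l; rewrite !ffunE.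
exists (fun i : idx (fun l => {ffun J -> T l} : finType) =>
  [ffun t : J => (finfun (fun l => i l t) : idx T)]) => f _.
  by apply/ffunP => t; apply/ffunP => l; rewrite !ffunE.
by apply/ffunP => l; apply/ffunP => t; rewrite !ffunE.
Qed.

Lemma csq_prod (J : finType) (P : pred J) (F : J -> C) :
  csq (\prod_(t | P t) F t) = \prod_(t | P t) csq (F t).
Proof. by apply: (big_morph csq csqM csq1). Qed.

Lemma nrm_gpow T (J : finType) (phi : vec T) : nrm (gpow J phi) = nrm phi ^+ #|J|.
Proof.
rewrite /nrm; under eq_bigr => i _ do rewrite csq_prod.
by rewrite (sum_gpow (fun _ i => csq (phi i))) prodr_const.
Qed.

Lemma unitv_tpow T n (phi : vec T) : unitv phi -> unitv (@tpow R k T n phi).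
Proof. by rewrite !unitvP tpow_gpow nrm_gpow => ->; rewrite expr1n. Qed.

Lemma unitv_gpow T (J : finType) (phi : vec T) : unitv phi -> unitv (gpow J phi).
Proof. by rewrite !unitvP nrm_gpow => ->; rewrite expr1n. Qed.

Lemma unitv_tens T U (phi : vec T) (psi : vec U) :
  unitv phi -> unitv psi -> unitv (tens phi psi).
Proof. by rewrite !unitvP nrm_tens => -> ->; rewrite mulr1. Qed.

Lemma unitv_push T U (f : forall l, T l -> U l) (v : vec T) :
  (forall l, injective (f l)) -> unitv v -> unitv (push f v).
Proof. by move=> /fmap_inj hf; rewrite !unitvP nrm_push. Qed.

Lemma unitv_idx T (phi : vec T) : unitv phi -> {i0 : idx T | true}.
Proof.
move=> h; case: (pickP (@predT (idx T))) => [i _|hn]; first by exists i.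
exfalso; move: h; rewrite unitvP /nrm big_pred0//.
by move/esym/eqP; rewrite oner_eq0.
Qed.

End Conversions.
Arguments gpow {R k T} J phi _.
Arguments tpow {R k T} n phi _.

(** * Consequences of monotonicity and additivity *)

Lemma sum_unit (S : nmodType) (F : unit -> S) : \sum_x F x = F tt.
Proof. by rewrite (bigD1 tt)//= big1 ?addr0// => -[]. Qed.

Section Measure.
Context {R : realType} {k : nat}.
Local Notation C := (R[i]).
Local Notation conj x := (conjc x).
Local Notation vec := (@vec R k).
Local Notation dens := (@dens R k).
Local Notation linop := (@linop R k).
Local Notation lop := (@lop R k).
Local Notation LOCC := (@LOCC R k _ _).
Implicit Types T U W : 'I_k -> finType.
Hypothesis hk : (0 < k)%N.
Variable E : forall T : 'I_k -> finType, dens T -> R.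
Hypothesis Eadd : fully_additive E.
Hypothesis Emon : monotone_on_average E.

(** As continuation, every party copies the outcome [x] into a register of its own, which produces
    exactly the flagged ensemble in [monotone_on_average]. *)
Lemma E_avg (X : finType) T U (A : X -> linop U T) (phi : vec T)
    (c : X -> C) (v : X -> vec U) :
  impl A -> unitv phi -> (forall x, unitv (v x)) ->
  (forall x, app (A x) phi = scl (c x) (v x)) ->
  \sum_x csq (c x) * Ep E (v x) <= Ep E phi.
Proof.
move=> hA hphi hv hc.
pose B (x : X) : lop (fun l => (X * U l)%type : finType) U := bop (fun l u => (x, u)).
have hB x : LOCC (fun rho : dens U => kraus_apply (prodop (B x)) rho).
  by apply: LOCC_local_isometry => // l t t0; apply: gram_bop => l' u u' [].
apply: (Emon (hA _ _ hB) hphi hv).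
apply: funext => o; apply: funext => o'; apply: eq_bigr => x _.
rewrite kraus_proj hc proj_scl (LOCC_scale (hB x)); congr (_ * _).
by rewrite kraus_proj app_bop.
Qed.

Lemma E_reach T U (phi : vec T) (psi : vec U) :
  unitv phi -> reach phi psi -> Ep E psi <= Ep E phi.
Proof.
move=> hphi hr; have hpsi : unitv psi by move: hphi; rewrite !unitvP (reach_nrm hr).
case: hr => Lam [hL eL].
pose B : lop (fun l => (unit * U l)%type : finType) U := bop (fun l u => (tt, u)).
have hB : LOCC (fun rho : dens U => kraus_apply (prodop B) rho).
  by apply: LOCC_local_isometry => // l t t0; apply: gram_bop => l' u u' [].
have := Emon (P := fun=> 1) (phix := fun=> psi) (LOCC_comp hL hB) hphi (fun=> hpsi).
rewrite sum_unit mul1r; apply.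
apply: funext => o; apply: funext => o'.
by rewrite sum_unit mul1r eL kraus_proj app_bop.
Qed.

(** The embedding and its inverse are both LOCC conversions. All later regroupings of tensor factors
    rest on this invariance. *)
Lemma E_push T U (f : forall l, T l -> U l) (v : vec T) :
  (forall l, injective (f l)) -> unitv v -> Ep E (push f v) = Ep E v.
Proof.
move=> hf hv; have [i0 _] := unitv_idx hv; apply: le_anti; apply/andP; split.
  by apply: E_reach => //; exact: reach_push.
by apply: E_reach; [exact: unitv_push | exact: reach_pull].
Qed.

Lemma E_scl T c (v : vec T) : csq c = 1 -> Ep E (scl c v) = Ep E v.
Proof.
move=> hc; congr (E _); rewrite proj_scl hc.
by apply: funext => i; apply: funext => i'; rewrite mul1r.
Qed.

Lemma unitv_one : unitv (one_vec : vec _).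
Proof.
apply/unitvP; rewrite /nrm /one_vec (bigD1 (finfun (fun=> tt)))//= csq1 big1 ?addr0//.
by move=> i /eqP[]; apply/ffunP => l; rewrite ffunE; case: (i l).
Qed.

(** The trivial state is its own tensor square up to relabelling, so additivity gives
    [e = e + e]. *)
Lemma E_one : Ep E (one_vec : vec _) = 0.
Proof.
have := Eadd unitv_one unitv_one.
have -> : tens one_vec one_vec = push (fun l u => (u, tt)) (one_vec : vec _).
  apply: (push_bij_eq (g := fun l u => u.1)) => //; first by move=> l [[] []].
  by move=> i; rewrite /tens /one_vec mul1r.
rewrite E_push; [|by move=> l [] []|exact: unitv_one].
by move=> h; lra.
Qed.

(** All parties measure in the computational basis and keep a trivial system, whose value is
    zero. *)
Lemma E_ge0 T (phi : vec T) : unitv phi -> 0 <= Ep E phi.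
Proof.
move=> hphi; have [i0 _] := unitv_idx hphi.
pose K (l : 'I_k) (t : T l) (u : unit) (t' : T l) : C := (t' == t)%:R.
have hK l t t' : \sum_(x : T l) \sum_o conj (K l x o t) * K l x o t' = (t == t')%:R.
  under eq_bigr => x _ do rewrite sum_unit.
  rewrite -gram_delta; apply: eq_bigr => x _; rewrite /K.
  by rewrite ![x == _]eq_sym.
have := E_avg (c := fun x => phi x) (v := fun=> one_vec) (impl_prod hk hK i0) hphi
  (fun=> unitv_one).
under eq_bigr => x _ do rewrite E_one mulr0.
rewrite sumr_const mul0rn; apply => x; apply: funext => o.
rewrite /scl /one_vec mulr1 /app -[RHS](sum_deltal x phi); apply: eq_bigr => i _.
congr (_ * _); rewrite eq_sym -prod_delta; apply: eq_bigr => l _.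
by rewrite /K.
Qed.

Lemma E_tpow T (phi : vec T) n : unitv phi -> Ep E (tpow n phi) = n%:R * Ep E phi.
Proof.
move=> hphi; have [i0 _] := unitv_idx hphi; elim: n => [|n IH].
  rewrite mul0r -E_one.
  have -> : tpow 0 phi = push (fun l (u : unit) => [ffun x : 'I_0 => i0 l]) (one_vec : vec _).
    apply: (push_bij_eq (g := fun l u => tt)) => //; first by move=> l [].
      by move=> l u; apply/ffunP => -[].
    by move=> i; rewrite /tpow big_ord0.
  by rewrite E_push; [|by move=> l [] []|exact: unitv_one].
pose f l (p : T l * {ffun 'I_n -> T l}) : {ffun 'I_n.+1 -> T l} :=
  [ffun i => if unlift ord0 i is Some j then p.2 j else p.1].
pose g l (h : {ffun 'I_n.+1 -> T l}) : T l * {ffun 'I_n -> T l} :=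
  (h ord0, [ffun j => h (lift ord0 j)]).
have fg l : cancel (f l) (g l).
  move=> [a b]; rewrite /g /f !ffunE unlift_none /=; congr (_, _).
  by apply/ffunP => j; rewrite !ffunE liftK.
have gf l : cancel (g l) (f l).
  move=> h; apply/ffunP => i; rewrite ffunE; case: unliftP => [j ->|->] //=.
  by rewrite ffunE.
have -> : tpow n.+1 phi = push f (tens phi (tpow n phi)).
  apply: (push_bij_eq fg gf) => i; rewrite /tpow big_ord_recl /tens; congr (phi _ * _).
    by apply/ffunP => l; rewrite !ffunE unlift_none.
  apply: eq_bigr => t _; congr (phi _); apply/ffunP => l.
  by rewrite !ffunE liftK.
rewrite E_push; last 2 first.
- by move=> l; exact: can_inj (fg l).
- by apply: unitv_tens => //; exact: unitv_tpow.
rewrite Eadd//; last exact: unitv_tpow.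
by rewrite IH -natr1 mulrDl mul1r addrC.
Qed.

End Measure.

(** * GHZ states *)

Lemma sum_cst (S : pzSemiRingType) (Z : finType) (x : S) : \sum_(z : Z) x = #|Z|%:R * x.
Proof. by rewrite sumr_const mulr_natl. Qed.

Section DiagonalStates.
Context {R : realType} {k : nat}.
Local Notation C := (R[i]).
Local Notation conj x := (conjc x).
Local Notation vec := (@vec R k).
Local Notation dens := (@dens R k).
Local Notation linop := (@linop R k).
Local Notation lop := (@lop R k).
Implicit Types T U V W Q : 'I_k -> finType.
Hypothesis hk : (0 < k)%N.

Definition cidx (Z : finType) (z : Z) : idx (fun _ : 'I_k => Z) := finfun (fun=> z).

Lemma cidx_inj (Z : finType) : injective (@cidx Z).
Proof. by move=> z z' /ffunP /(_ (Ordinal hk)); rewrite !ffunE. Qed.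

Definition diag (Z : finType) (c : Z -> C) : vec (fun=> Z) :=
  fun i => \sum_z (i == cidx z)%:R * c z.

Lemma diag_cidx (Z : finType) (c : Z -> C) z : diag c (cidx z) = c z.
Proof.
rewrite /diag (bigD1 z)//= eqxx mul1r big1 ?addr0// => z' hz'.
by rewrite (inj_eq (@cidx_inj Z)) eq_sym (negbTE hz') mul0r.
Qed.

Lemma sum_diag (Z : finType) (c : Z -> C) (F : idx (fun _ : 'I_k => Z) -> C) :
  \sum_i F i * diag c i = \sum_z F (cidx z) * c z.
Proof.
rewrite /diag; under eq_bigr => i _ do rewrite mulr_sumr.
rewrite exchange_big; apply: eq_bigr => z _ /=.
rewrite (bigD1 (cidx z))//= eqxx mul1r big1 ?addr0// => i /negbTE ->.
by rewrite mul0r mulr0.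
Qed.

Lemma nrm_diag (Z : finType) (c : Z -> C) : nrm (diag c) = \sum_z csq (c z).
Proof.
apply: (@complexI R); rewrite nrmE sum_diag rmorph_sum.
by apply: eq_bigr => z _; rewrite diag_cidx -csqE.
Qed.

Lemma app_dst (Z : finType) V W (K : linop W (fun l => (Z * V l)%type : finType))
    (c : Z -> C) (phi : vec V) o :
  app K (tens (diag c) phi) o
  = \sum_z c z * \sum_v K o (pairi (cidx z) v) * phi v.
Proof.
rewrite /app sum_pairi.
transitivity (\sum_i (\sum_v K o (pairi i v) * phi v) * diag c i).
  apply: eq_bigr => i _; rewrite mulr_suml; apply: eq_bigr => v _.
  by rewrite tens_pairi; ring.
by rewrite sum_diag; apply: eq_bigr => z _; rewrite mulrC.
Qed.

Lemma diag_perm (Z : finType) (s : {perm Z}) (c : Z -> C) i :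
  diag c (fmap (fun l => s) i) = diag (fun z => c (s z)) i.
Proof.
rewrite /diag (reindex_inj (@perm_inj _ s)); apply: eq_bigr => z _.
congr ((nat_of_bool _)%:R * _); apply/eqP/eqP => [/ffunP h|->].
  by apply/ffunP => l; move: (h l); rewrite !ffunE => /perm_inj.
by apply/ffunP => l; rewrite !ffunE.
Qed.

(** Composition with [tperm y z] shows that the sum does not depend on the point: a random
    permutation sends each label to a uniform one. *)
Lemma sum_perm_orbit (Z : finType) (F : Z -> R) (z : Z) :
  (\sum_(s : {perm Z}) F (s z)) * #|Z|%:R = #|{perm Z}|%:R * \sum_y F y.
Proof.
have h y : \sum_(s : {perm Z}) F (s y) = \sum_(s : {perm Z}) F (s z).
  rewrite (reindex_inj (mulgI (tperm y z))); apply: eq_bigr => s _.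
  by rewrite permM tpermL.
transitivity (\sum_y \sum_(s : {perm Z}) F (s y)).
  by rewrite (eq_bigr _ (fun y _ => h y)) sum_cst mulrC.
rewrite exchange_big /=.
transitivity (\sum_(s : {perm Z}) \sum_y F y).
  by apply: eq_bigr => s _; rewrite [RHS](reindex_inj (@perm_inj _ s)).
by rewrite sum_cst.
Qed.

Definition ghz (Z : finType) : vec (fun=> Z) :=
  diag (fun=> ((Num.sqrt (#|Z|%:R : R))^-1)%:C%C).

Arguments ghz Z : clear implicits.

Lemma nrm_ghz (Z : finType) : (0 < #|Z|)%N -> nrm (ghz Z) = 1.
Proof.
move=> hZ; rewrite nrm_diag; under eq_bigr => z _ do rewrite csq_real exprVn sqr_sqrtr//.
by rewrite sum_cst divff// pnatr_eq0 -lt0n.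
Qed.

(* One party applies the Kraus operators [diag (c o s)], [s] a uniformly random
   permutation of the labels; every outcome is the target up to relabelling. *)
Lemma reach_ghz_diag (Z : finType) V (c : Z -> C) (phi : vec V) (i0 : idx V) :
  \sum_z csq (c z) = 1 -> reach (tens (ghz Z) phi) (tens (diag c) phi).
Proof.
move=> hc.
have [z0 _] : {z0 : Z | true}.
  case: (pickP (@predT Z)) => [z _|hn]; first by exists z.
  by exfalso; move: hc; rewrite big_pred0// => /esym/eqP; rewrite oner_eq0.
have hZ : (0 < #|Z|)%N by apply/card_gt0P; exists z0.
have hP : (0 < #|{perm Z}|)%N by apply/card_gt0P; exists 1%g.
pose T l := (Z * V l)%type : finType.
pose j0 := Ordinal hk.
(* With this factor the squared Kraus operators add up to the identity, and every outcome has
   probability [1 / #|{perm Z}|]. *)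
pose kap : R := Num.sqrt (#|Z|%:R / #|{perm Z}|%:R).
have hkap : kap ^+ 2 = #|Z|%:R / #|{perm Z}|%:R.
  by rewrite sqr_sqrtr// divr_ge0.
pose D (s : {perm Z}) (t : Z) : C := kap%:C%C * c (s t).
pose A (s : {perm Z}) : lop T T := fun l t t0 =>
  (t == t0)%:R * (if l == j0 then D s t.1 else 1).
have hI : impl (fun s => prodop (A s)).
  apply: (impl_one_party (j := j0)) => [s l hl|t t0].
    apply: funext => t; apply: funext => t0.
    by rewrite /A (negbTE hl) mulr1.
  have [<-|hne] := eqVneq t t0; last first.
    rewrite big1// => s _; rewrite /gram big1// => o _; rewrite /A eqxx.
    have [->|_] := eqVneq o t; last by rewrite mul0r rmorph0 mul0r.
    by rewrite (negbTE hne) mul0r mulr0.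
  transitivity ((\sum_(s : {perm Z}) kap ^+ 2 * csq (c (s t.1)))%:C%C).
    rewrite rmorph_sum; apply: eq_bigr => s _.
    rewrite /gram (bigD1 t)//= /A !eqxx !mul1r big1 ?addr0; last first.
      by move=> o /negbTE ->; rewrite mul0r rmorph0 mul0r.
    by rewrite -csqE /D csqM csq_real.
  have hs : \sum_(s : {perm Z}) csq (c (s t.1)) = #|{perm Z}|%:R / #|Z|%:R.
    apply: (canRL (mulfK _)); first by rewrite pnatr_eq0 -lt0n.
    by rewrite (sum_perm_orbit (fun z => csq (c z))) hc mulr1.
  rewrite -mulr_sumr hs hkap -[RHS](rmorph1 (real_complex R)); congr (_%:C)%C.
  by field; rewrite !pnatr_eq0 -!lt0n hZ hP.
have happ s v : app (prodop (A s)) v = fun i => D s (i j0).1 * v i :> C.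
  apply: funext => o; rewrite /app (bigD1 o)//= big1 ?addr0.
    congr (_ * _); rewrite /prodop (bigD1 j0)//= /A !eqxx mul1r big1 ?mulr1// => l hl.
    by rewrite eqxx (negbTE hl) mulr1.
  move=> i hi; suff -> : prodop (A s) o i = 0 by rewrite mul0r.
  rewrite /prodop /A big_split /= prod_delta eq_sym (negbTE hi) mul0r//.
apply: (reach_step hI (c := fun s : {perm Z} => (kap * (Num.sqrt (#|Z|%:R))^-1)%:C%C)
   (v := fun s : {perm Z} => tens (diag (fun z => c (s z))) phi)).
- under eq_bigr => s _ do rewrite csq_real exprMn hkap exprVn sqr_sqrtr//.
  rewrite sum_cst; field.
  by rewrite !pnatr_eq0 -!lt0n hZ hP.
- move=> s; rewrite happ; apply: funext => i; rewrite /scl /tens mulrA [RHS]mulrA.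
  congr (_ * _); rewrite /ghz /diag !mulr_sumr; apply: eq_bigr => z _.
  case: eqP => [/ffunP /(_ j0)|_]; last by rewrite !mul0r !mulr0.
  by rewrite !ffunE /D => ->; rewrite !mul1r rmorphM; ring.
- move=> s; have -> : tens (diag c) phi
      = push (fun l (p : Z * V l) => (s p.1, p.2)) (tens (diag (fun z => c (s z))) phi).
    apply: (push_bij_eq (g := fun l (p : Z * V l) => ((s^-1)%g p.1, p.2))).
    + by move=> l [a b]; rewrite /= permK.
    + by move=> l [a b]; rewrite /= permKV.
    + move=> i; rewrite /tens -diag_perm; congr (diag c _ * phi _);
        by apply/ffunP => l; rewrite !ffunE.
  by apply: reach_push => // l [a b] [a' b'] [/perm_inj -> ->].
Qed.

Lemma reach_ghz_sub (Z Z' : finType) V (c : Z' -> C) (phi : vec V) :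
  unitv phi -> \sum_z csq (c z) = 1 -> (#|Z'| <= #|Z|)%N ->
  reach (tens (ghz Z) phi) (tens (diag c) phi).
Proof.
move=> hphi hc hcard; have [i0 _] := unitv_idx hphi.
have [z0 _] : {z0 : Z' | true}.
  case: (pickP (@predT Z')) => [z _|hn]; first by exists z.
  by exfalso; move: hc; rewrite big_pred0// => /esym/eqP; rewrite oner_eq0.
pose e (z : Z') : Z := enum_val (widen_ord hcard (enum_rank z)).
have he : injective e by move=> z z' /enum_val_inj /(congr1 val) /= /val_inj /enum_rank_inj.
pose c' (z : Z) : C := \sum_y (z == e y)%:R * c y.
have hc'e y : c' (e y) = c y.
  rewrite /c' (bigD1 y)//= eqxx mul1r big1 ?addr0// => y' hy'.
  by rewrite (inj_eq he) eq_sym (negbTE hy') mul0r.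
have hpush : tens (diag c') phi
    = push (fun l (p : Z' * V l) => (e p.1, p.2)) (tens (diag c) phi).
  have hinj : injective (fmap (fun l (p : Z' * V l) => (e p.1, p.2))).
    by apply: fmap_inj => l [a b] [a' b'] [/he -> ->].
  apply: push_eq => // [i|o ho].
    rewrite /tens; congr (_ * phi _); last by apply/ffunP => l; rewrite !ffunE.
    rewrite /diag; under eq_bigr => z _ do rewrite /c' mulr_sumr.
    rewrite exchange_big; apply: eq_bigr => y _ /=.
    rewrite (bigD1 (e y))//= eqxx mul1r big1 ?addr0; last first.
      by move=> z /negbTE ->; rewrite mul0r mulr0.
    congr ((nat_of_bool _)%:R * _); apply/eqP/eqP => /ffunP h; apply/ffunP => l.
      by move: (h l); rewrite !ffunE => /he.
    by move: (h l); rewrite !ffunE => ->.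
  rewrite /tens [X in X * _](_ : _ = 0) ?mul0r// /diag big1// => z _.
  case: eqP => [/ffunP h|]; last by rewrite mul0r.
  rewrite mul1r /c' big1// => y _; case: eqP => [hz|]; last by rewrite mul0r.
  have /eqP[] := ho (pairi (cidx y) (finfun (fun l => (o l).2))).
  apply/ffunP => l; move: (h l); rewrite !ffunE /= hz => <-.
  by rewrite -surjective_pairing.
apply: (reach_trans (psi := tens (diag c') phi)).
  apply: reach_ghz_diag => //; have hphi1 : nrm phi = 1 by apply/unitvP.
  have : nrm (tens (diag c') phi) = nrm (tens (diag c) phi).
    by rewrite hpush nrm_push//; apply: fmap_inj => l [a b] [a' b'] [/he -> ->].
  by rewrite !nrm_tens hphi1 !mulr1 !nrm_diag hc.
rewrite hpush; apply: reach_pull => //; last by move=> l [a b] [a' b'] [/he -> ->].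
exact: (pairi (cidx z0) i0).
Qed.

(** * Coherent erasure of a control label *)

Section Erasure.
Variables (Z : finType) (V W Q : 'I_k -> finType) (c : Z -> C) (phi : vec V).
Variables (g : Z -> forall l, V l -> W l) (q : forall l, Z -> Q l).
Variable (rd : forall l, W l -> Q l).
Hypothesis g_inj : forall z l, injective (@g z l).
Hypothesis rdE : forall z l v, rd (@g z l v) = q l z.
Hypothesis q_inj : forall z z', (forall l, q l z = q l z') -> z = z'.

(** A table with one sign for each party [l] and each local share in [Q l]; [sg u z] below
    multiplies the signs that the label [z] meets. *)
Let S : finType := {ffun {l : 'I_k & Q l} -> bool}.
Let sgn (b : bool) : C := (-1) ^+ b.
Let sg (u : S) (z : Z) : C := \prod_l sgn (u (Tagged Q (q l z))).

Let sgn_sq b : sgn b * sgn b = 1.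
Proof. by case: b; rewrite /sgn /= ?expr1 ?expr0 ?mulrNN mulr1. Qed.

Let sgn_conj b : conj (sgn b) = sgn b.
Proof. by case: b; rewrite /sgn ?expr1 ?expr0 ?rmorphN rmorph1. Qed.

Let sg_conj u z : conj (sg u z) = sg u z.
Proof. by rewrite rmorph_prod; apply: eq_bigr => l _; exact: sgn_conj. Qed.

Let sg_sq u z : sg u z * sg u z = 1.
Proof. by rewrite -big_split big1// => l _; exact: sgn_sq. Qed.

(* Random local signs: flipping one of them changes the sign of exactly one of
   the two products, so distinct labels are orthogonal on average. *)
Lemma signs_orthogonal z z' : \sum_(u : S) sg u z * sg u z' = #|S|%:R * (z == z')%:R.
Proof.
have [<-|hne] := eqVneq z z'.
  by under eq_bigr => u _ do rewrite sg_sq; rewrite sum_cst.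
rewrite mulr0; have [l hl] : exists l, q l z != q l z'.
  apply/existsP; apply: contraR hne => /existsPn h; apply/eqP/q_inj => l.
  by apply/eqP; move: (h l); rewrite negbK.
pose s0 := Tagged Q (q l z).
pose flip (u : S) : S := [ffun s => u s (+) (s == s0)].
have flipK : involutive flip.
  by move=> u; apply/ffunP => s; rewrite !ffunE -addbA addbb addbF.
have hflip u y : sg (flip u) y = (if q l y == q l z then -1 else 1) * sg u y.
  rewrite /sg (bigD1 l)//= [in RHS](bigD1 l)//= mulrA; congr (_ * _).
    rewrite ffunE /s0 eq_Tagged /=; case: (q l y == q l z); rewrite /sgn ?addbT ?addbF ?mul1r//.
    by case: (u _); rewrite /= ?expr0 ?expr1 mulN1r ?opprK.
  apply: eq_bigr => l' hl'; rewrite ffunE; congr (sgn _).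
  case: eqP => [h|]; last by rewrite addbF.
  by case/eqP: hl'; move: (congr1 tag h).
have h : \sum_(u : S) sg u z * sg u z' = - \sum_(u : S) sg u z * sg u z'.
  rewrite {1}(reindex_inj (inv_inj flipK)) -sumrN; apply: eq_bigr => u _.
  by rewrite !hflip eqxx eq_sym (negbTE hl); ring.
by apply/eqP; move/eqP: h; rewrite -addr_eq0 -mulr2n -mulr_natr mulf_eq0 pnatr_eq0 orbF.
Qed.

(** Every party applies [g z] controlled by its copy of [z] and measures that copy with the Kraus
    operators given by random sign tables. By [signs_orthogonal] this preserves the trace, and the
    only trace of the outcome is a sign on each branch [z]. *)
Lemma reach_controlled (i0 : idx V) :
  reach (tens (diag c) phi) (fun o => \sum_z c z * push (g z) phi o).
Proof.
pose X (l : 'I_k) : finType := S.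
have hS : (0 < #|S|)%N by apply/card_gt0P; exists [ffun=> true].
pose kap : C := ((Num.sqrt (#|S|%:R : R))^-1)%:C%C.
have hkap : conj kap * kap = (#|S|%:R)^-1.
  rewrite -csqE csq_real exprVn sqr_sqrtr// fmorphV; congr (_^-1).
  by rewrite rmorph_nat.
pose K l (u : X l) (w : W l) (p : Z * V l) : C :=
  kap * sg u p.1 * (w == g p.1 p.2)%:R.
have hK l p p' : \sum_(x : X l) \sum_o conj (K l x o p) * K l x o p' = (p == p')%:R.
  transitivity ((#|S|%:R)^-1 * (\sum_(u : S) sg u p.1 * sg u p'.1)
     * (g p.1 p.2 == g p'.1 p'.2 :> W l)%:R).
    rewrite mulr_sumr mulr_suml; apply: eq_bigr => u _.
    rewrite -(gram_delta (g p.1 p.2)) mulr_sumr; apply: eq_bigr => w _.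
    have e : conj (K l u w p) = conj kap * sg u p.1 * conj ((w == g p.1 p.2)%:R : C).
      by rewrite /K !rmorphM /= sg_conj.
    rewrite e /K -hkap; ring.
  rewrite signs_orthogonal mulrA mulVf ?pnatr_eq0 -?lt0n// mul1r -natrM mulnb.
  congr (_%:R); congr nat_of_bool; case: p p' => z v [z' v'] /=.
  rewrite xpair_eqE; case: eqP => //= <-; exact: (inj_eq (@g_inj z l)).
pose x0 : idx X := finfun (fun=> [ffun=> true]).
pose Sx (x : idx X) z := \prod_l sg (x l) z.
apply: (reach_step (impl_prod hk hK x0) (c := fun x => \prod_(l : 'I_k) kap)
  (v := fun x o => \sum_z Sx x z * c z * push (g z) phi o)).
- under eq_bigr => x _ do rewrite csq_prod.
  rewrite -(prod_sum_dffun (fun (l : 'I_k) (u : X l) => csq kap)) big1// => l _.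
  rewrite sum_cst /kap csq_real exprVn sqr_sqrtr// divff//.
  by rewrite pnatr_eq0 -lt0n.
- move=> x; apply: funext => o; rewrite app_dst /scl mulr_sumr; apply: eq_bigr => z _.
  rewrite /push !mulr_sumr; apply: eq_bigr => v _.
  have -> : prodop (fun l => K l (x l)) o (pairi (cidx z) v)
     = (\prod_(l : 'I_k) kap) * Sx x z * (o == fmap (g z) v)%:R.
    rewrite /Sx -prod_delta -!big_split; apply: eq_bigr => l _.
    by rewrite /K !ffunE.
  ring.
- move=> x.
  (* The sign of branch [z] is a product over parties [l] of signs depending on [q l z] alone. Party
     [l] reads [q l z] off its own system with [rd] and, knowing all announced tables, cancels its
     factor. *)
  pose eps l (w : W l) : C := \prod_j sgn (x j (Tagged Q (rd w))).
  pose A : lop W W := fun l w w' => (w == w')%:R * eps l w.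
  have hA l t t0 : gram A t t0 = (t == t0 :> W l)%:R.
    rewrite /gram /A -gram_delta; apply: eq_bigr => w _.
    have he : conj (eps l w) * eps l w = 1.
      by rewrite rmorph_prod -big_split big1// => j _; rewrite /= sgn_conj sgn_sq.
    rewrite rmorphM -[RHS]mulr1 -he; ring.
  have := reach_local_isometry hk (fun o => \sum_z Sx x z * c z * push (g z) phi o) hA.
  congr reach; apply: funext => o.
  have hp i : prodop A o i = (o == i)%:R * \prod_l eps l (o l).
    by rewrite /prodop big_split prod_delta.
  rewrite /app; under eq_bigr => i _ do rewrite hp -mulrA.
  rewrite sum_deltal mulr_sumr; apply: eq_bigr => z _.
  case: (pickP (fun i => o == fmap (g z) i)) => [i /eqP ->|hn]; last first.
    by rewrite push_out ?mulr0// => i; rewrite hn.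
  have -> : \prod_l eps l (fmap (g z) i l) = Sx x z.
    rewrite /Sx /eps /sg exchange_big /=; apply: eq_bigr => l _.
    by apply: eq_bigr => j _; rewrite ffunE rdE.
  have hSS : Sx x z * Sx x z = 1 by rewrite -big_split big1// => l _; exact: sg_sq.
  by rewrite !mulrA hSS mul1r.
Qed.
End Erasure.
End DiagonalStates.
Arguments ghz {R k} Z _.

(** * The value on GHZ states and the logarithmic bound *)

Section LogBounds.
Context {R : realType} {k : nat}.
Local Notation C := (R[i]).
Local Notation vec := (@vec R k).
Local Notation dens := (@dens R k).
Implicit Types T U V W Q : 'I_k -> finType.
Hypothesis hk : (0 < k)%N.
Variable E : forall T : 'I_k -> finType, dens T -> R.
Hypothesis Eadd : fully_additive E.
Hypothesis Emon : monotone_on_average E.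
Hypothesis Eghz : Ep E GHZ = 1.

Lemma unitv_ghz (Z : finType) : (0 < #|Z|)%N -> unitv (ghz Z : vec _).
Proof. by move=> hZ; apply/unitvP; exact: nrm_ghz. Qed.

Lemma GHZ_ghz : GHZ = ghz 'I_2 :> vec _.
Proof.
apply: funext => i; rewrite /GHZ /ghz /diag card_ord.
pose j0 := Ordinal hk.
have h z : (i == cidx z) = [forall j, i j == z].
  apply/eqP/forallP => [-> j|h]; first by rewrite ffunE.
  by apply/ffunP => j; rewrite ffunE; apply/eqP.
rewrite !big_ord_recl big_ord0 addr0 !h.
have -> : lift ord0 ord0 = ord_max :> 'I_2 by apply: val_inj.
case h0 : [forall j, i j == ord0]; case h1 : [forall j, i j == ord_max] => /=.
- by move/forallP: h0 => /(_ j0) /eqP h0; move/forallP: h1 => /(_ j0); rewrite h0.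
- by rewrite mul1r mul0r addr0.
- by rewrite mul1r mul0r add0r.
- by rewrite !mul0r addr0.
Qed.

(** An index of the power is constant over the parties iff each of its slots is; off the diagonal
    some slot already contributes a factor zero. *)
Lemma gpow_ghz (J Z : finType) : (0 < #|Z|)%N ->
  gpow J (ghz Z) = ghz {ffun J -> Z} :> vec _.
Proof.
move=> hZ; apply: funext => i; rewrite /gpow.
pose j0 := Ordinal hk.
pose sl (t : J) : idx (fun _ : 'I_k => Z) := finfun (fun l => i l t).
case: (pickP (fun z : {ffun J -> Z} => i == cidx z)) => [z /eqP hz|hn].
  rewrite hz /ghz diag_cidx//.
  rewrite (eq_bigr (fun=> ((Num.sqrt (#|Z|%:R : R))^-1)%:C%C)); last first.
    move=> t _; transitivity ((ghz Z : vec _) (cidx (z t))); last by rewrite /ghz diag_cidx.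
    by congr (ghz _ _); apply/ffunP => l; rewrite !ffunE.
  rewrite prodr_const card_ffun natrX -rmorphXn; congr (_%:C)%C.
  rewrite exprVn; congr (_^-1); elim: #|J| => [|n IH]; first by rewrite !expr0 sqrtr1.
  by rewrite !exprS sqrtrM// IH.
have -> : (ghz {ffun J -> Z} : vec _) i = 0.
  by rewrite /ghz /diag big1// => z _; rewrite hn mul0r.
have [t ht] : exists t, [forall z, sl t != cidx z].
  apply/existsP; apply: contraT => /existsPn h.
  pose z : {ffun J -> Z} := i j0; move: (hn z) => /negbT /eqP[].
  apply/ffunP => l; apply/ffunP => t; rewrite ffunE.
  have /forallPn[y] := h t; rewrite negbK => /eqP /ffunP hy.
  by rewrite /z; move: (hy l) (hy j0); rewrite !ffunE => -> ->.
rewrite (bigD1 t)//= /ghz /diag big1 ?mul0r// => z _.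
by move/forallP: ht => /(_ z) /negbTE ->; rewrite mul0r.
Qed.

Lemma E_ghz_le (Z Z' : finType) : (0 < #|Z'|)%N -> (#|Z'| <= #|Z|)%N ->
  Ep E (ghz Z') <= Ep E (ghz Z).
Proof.
move=> h0 hle.
have hZ := unitv_ghz (leq_trans h0 hle); have hZ' := unitv_ghz h0.
(* The conversion lemmas carry a spectator factor; the trivial state takes this role at no cost. *)
have := Eadd hZ unitv_one; have := Eadd hZ' unitv_one.
rewrite (E_one hk Eadd Emon) !addr0 => <- <-.
apply: (E_reach hk Emon); first exact: unitv_tens hZ unitv_one.
apply: reach_ghz_sub => //; first exact: unitv_one.
by rewrite -(nrm_diag hk) -/(ghz Z') nrm_ghz.
Qed.

Lemma E_ghz_ffun (Z : finType) n : (0 < #|Z|)%N ->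
  Ep E (ghz {ffun 'I_n -> Z}) = n%:R * Ep E (ghz Z).
Proof.
by move=> hZ; rewrite -gpow_ghz// -tpow_gpow (E_tpow hk Eadd Emon)//; exact: unitv_ghz.
Qed.

Lemma ln2_gt0 : 0 < ln (2 : R).
Proof. by rewrite ln_gt0// ltr1n. Qed.

Lemma log2X n : log2 ((2 ^ n)%:R : R) = n%:R.
Proof.
by rewrite /log2 natrX lnXn ?ltr0n// -(mulr_natl (ln _)) mulfK// gt_eqF// ln2_gt0.
Qed.

Lemma ler_log2 (x y : R) : 0 < x -> x <= y -> log2 x <= log2 y.
Proof.
move=> hx hxy; rewrite /log2 ler_pM2r ?invr_gt0 ?ln2_gt0// ler_ln// posrE//.
exact: lt_le_trans hxy.
Qed.

Lemma log2M (x y : R) : 0 < x -> 0 < y -> log2 (x * y) = log2 x + log2 y.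
Proof. by move=> hx hy; rewrite /log2 lnM// mulrDl. Qed.

Lemma log2_natX (n m : nat) : (0 < n)%N -> log2 ((n ^ m)%:R : R) = m%:R * log2 (n%:R : R).
Proof. by move=> hn; rewrite /log2 natrX lnXn ?ltr0n// -(mulr_natl (ln _)) mulrA. Qed.

(** The Archimedean step that turns estimates on many copies with a bounded error into exact
    inequalities for one copy. *)
Lemma le0_of_bounded_multiples (x c : R) : (forall M : nat, M%:R * x <= c) -> x <= 0.
Proof.
move=> h; rewrite leNgt; apply/negP => hp.
have := h (Num.Def.truncn (c / x)).+1; rewrite leNgt => /negP; apply.
by rewrite -ltr_pdivrMr// truncnS_gt.
Qed.

(** [#|Z| ^ M] lies between consecutive powers of two, and both [E] and [log2] are monotone and
    exact on powers of two. Hence the two sides, multiplied by [M], differ by at most one. *)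
Lemma E_ghz (Z : finType) : (0 < #|Z|)%N -> Ep E (ghz Z) = log2 (#|Z|%:R : R).
Proof.
move=> hZ; set x := Ep E (ghz Z); set y := log2 _.
have two m : Ep E (ghz {ffun 'I_m -> 'I_2}) = m%:R.
  by rewrite E_ghz_ffun ?card_ord// -GHZ_ghz Eghz mulr1.
have h M : let L := trunc_log 2 (#|Z| ^ M) in
    [/\ L%:R <= M%:R * x, M%:R * x <= L.+1%:R, L%:R <= M%:R * y & M%:R * y <= L.+1%:R :> R].
  move=> L; have hp : (0 < #|Z| ^ M)%N by rewrite expn_gt0 hZ.
  have h1 : (2 ^ L <= #|Z| ^ M)%N by apply: trunc_logP.
  have h2 : (#|Z| ^ M <= 2 ^ L.+1)%N by apply: ltnW; apply: trunc_log_ltn.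
  have hx : M%:R * x = Ep E (ghz {ffun 'I_M -> Z}) by rewrite E_ghz_ffun.
  split.
  - by rewrite hx -two; apply: E_ghz_le; rewrite !card_ffun !card_ord// expn_gt0.
  - by rewrite hx -two; apply: E_ghz_le; rewrite !card_ffun !card_ord.
  - rewrite /y -log2_natX// -[X in X <= _]log2X; apply: ler_log2; first by rewrite ltr0n expn_gt0.
    by rewrite ler_nat.
  - rewrite /y -log2_natX// -[X in _ <= X]log2X; apply: ler_log2; first by rewrite ltr0n.
    by rewrite ler_nat.
apply: le_anti; apply/andP; split; rewrite -subr_le0; apply: (@le0_of_bounded_multiples _ 1) => M;
  by case: (h M); rewrite -natr1 mulrBr => *; lra.
Qed.

Lemma E_le_log T (psi : vec T) : unitv psi -> Ep E psi <= log2 (#|idx T|%:R : R).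
Proof.
move=> hpsi; have [i0 _] := unitv_idx hpsi.
have hZ : (0 < #|idx T|)%N by apply/card_gt0P; exists i0.
have hu := unitv_ghz hZ.
rewrite -(E_ghz hZ) -[X in _ <= X]addr0 -(E_one hk Eadd Emon).
rewrite -(Eadd hu unitv_one).
apply: (E_reach hk Emon); first exact: unitv_tens hu unitv_one.
have hc : \sum_i csq (psi i) = 1 by apply/unitvP.
apply: (reach_trans (psi := tens (diag psi) one_vec)).
  by apply: reach_ghz_sub => //; exact: unitv_one.
(* The label is the full basis index of [psi]; each party prepares its component [z l] out of the
   trivial system, so the label is readable from the output. *)
pose g (z : idx T) l (u : unit) := z l.
have e : psi = (fun o => \sum_z psi z * push (g z) (one_vec : vec _) o).
  apply: funext => o; rewrite -[LHS](sum_deltar o psi); apply: eq_bigr => z _.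
  congr (_ * _); rewrite /push (bigD1 (cidx tt))//= big1 ?addr0; last first.
    by move=> i /eqP[]; apply/ffunP => l; rewrite ffunE; case: (i l).
  rewrite mulr1; congr ((nat_of_bool _)%:R); rewrite eq_sym; congr (_ == _).
  by apply/ffunP => l; rewrite !ffunE.
rewrite [X in reach _ X]e; apply: (reach_controlled hk psi one_vec (g := g) (rd := fun l => id) (q := fun l (z : idx T) => z l)) => //.
- by move=> z l [] [].
- by move=> z z' h; apply/ffunP.
- exact: (cidx tt).
Qed.

End LogBounds.

(** * Powers of direct sums *)

Lemma reach_scl (R : realType) (k : nat) (T U : 'I_k -> finType) c
    (phi : @vec R k T) (psi : @vec R k U) :
  reach phi psi -> reach (scl c phi) (scl c psi).
Proof.
move=> [L [hL e]]; exists L; split => //.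
by rewrite !proj_scl (LOCC_scale hL) e.
Qed.

Lemma scl_tens_diag (R : realType) (k : nat) (Z : finType) (V : 'I_k -> finType)
    (r : R[i]) (c : Z -> R[i]) (phi : vec V) :
  scl r (tens (diag c) phi) = tens (diag (fun z => r * c z)) phi.
Proof.
apply: funext => i; rewrite /scl /tens mulrA; congr (_ * _).
by rewrite /diag mulr_sumr; apply: eq_bigr => z _; rewrite mulrCA.
Qed.

Lemma scl_push (R : realType) (k : nat) (T U : 'I_k -> finType)
    (f : forall l, T l -> U l) (r : R[i]) (v : vec T) :
  scl r (push f v) = push f (scl r v).
Proof.
by apply: funext => o; rewrite /scl /push mulr_sumr; apply: eq_bigr => i _; rewrite mulrCA.
Qed.

Section DirectSumPowers.
Context {R : realType} {k : nat}.
Local Notation C := (R[i]).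
Local Notation conj x := (conjc x).
Local Notation vec := (@vec R k).
Local Notation lop := (@lop R k).
Hypothesis hk : (0 < k)%N.
Variables (T U : 'I_k -> finType) (a b : C) (phi : vec T) (psi : vec U).
Hypothesis (hphi : unitv phi) (hpsi : unitv psi).

Definition slice (V : 'I_k -> finType) (J : finType)
  (i : idx (fun l => {ffun J -> V l} : finType)) (t : J) : idx V :=
  finfun (fun l => i l t).

Definition sumT (l : 'I_k) : finType := (T l + U l)%type.

Definition branch (s : bool) : vec sumT :=
  if s then scl a (push (fun l => inl) phi) else scl b (push (fun l => inr) psi).

Definition wt (s : bool) : R := if s then csq a else csq b.

Lemma inl_fmap_inj : injective (fmap (fun l => inl) : idx T -> idx sumT).
Proof. by apply: fmap_inj => l x y []. Qed.

Lemma inr_fmap_inj : injective (fmap (fun l => inr) : idx U -> idx sumT).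
Proof. by apply: fmap_inj => l x y []. Qed.

(** Every single party can tell the two summands apart. This makes different patterns orthogonal and
    each pattern readable at any party. *)
Lemma branch_mismatch s (i : idx sumT) l : (if i l is inl _ then true else false) != s -> branch s i = 0.
Proof.
case: s => h; rewrite /branch /scl push_out ?mulr0// => j;
  by apply: contra h => /eqP ->; rewrite ffunE.
Qed.

Lemma branch_ip s s' :
  \sum_i conj (branch s i) * branch s' i = if s == s' then (wt s)%:C%C else 0.
Proof.
case: eqP => [<-|hne]; last first.
  rewrite big1// => i _.
  have [h|h] := eqVneq (if i (Ordinal hk) is inl _ then true else false) s.
    by rewrite (@branch_mismatch s' i (Ordinal hk)) ?mulr0// h; apply/eqP.
  by rewrite (@branch_mismatch s i (Ordinal hk)) ?rmorph0 ?mul0r.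
rewrite -nrmE; congr (_%:C)%C; case: s; rewrite /branch nrm_scl nrm_push.
- by move/unitvP: hphi => ->; rewrite mulr1.
- exact: inl_fmap_inj.
- by move/unitvP: hpsi => ->; rewrite mulr1.
- exact: inr_fmap_inj.
Qed.

Section Patterns.
Variable J : finType.
Local Notation pat := {ffun J -> bool}.
Local Notation TUJ := (fun l => {ffun J -> sumT l} : finType).

(** The part of the power of the direct sum carried by the patterns in [S], left unnormalized. *)
Definition chi (S : {set pat}) : vec TUJ :=
  fun o => \sum_(s in S) \prod_t branch (s t) (slice o t).

Lemma chi_setT : chi setT = gpow J (dsum a b phi psi).
Proof.
apply: funext => o; rewrite /chi /gpow.
transitivity (\prod_(t : J) \sum_(s : bool) branch s (slice o t)).
  by rewrite bigA_distr_bigA; apply: eq_bigl => s; rewrite in_setT.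
by apply: eq_bigr => t _; rewrite big_bool.
Qed.

Definition weight (s : pat) : R := \prod_t wt (s t).
Definition mass (S : {set pat}) : R := \sum_(s in S) weight s.

(** Orthogonality of different patterns. It yields both the norm of a restriction and its overlap
    with the full power. *)
Lemma chi_ip (S S' : {set pat}) :
  \sum_o conj (chi S o) * chi S' o = (mass (S :&: S'))%:C%C.
Proof.
transitivity (\sum_(s in S) \sum_(s' in S') \prod_(t : J)
    (if s t == s' t then (wt (s t))%:C%C else 0)).
  under eq_bigr => o _ do rewrite /chi rmorph_sum mulr_suml.
  rewrite exchange_big; apply: eq_bigr => s _ /=.
  under eq_bigr => o _ do rewrite mulr_sumr.
  rewrite exchange_big; apply: eq_bigr => s' _ /=.
  under [RHS]eq_bigr => t _ do rewrite -branch_ip.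
  rewrite -(sum_gpow (fun t i => conj (branch (s t) i) * branch (s' t) i)).
  by apply: eq_bigr => o _; rewrite rmorph_prod -big_split.
rewrite /mass rmorph_sum [RHS](eq_bigl (fun s => (s \in S) && (s \in S'))); last first.
  by move=> s; rewrite in_setI.
rewrite [RHS]big_mkcondr; apply: eq_bigr => s _.
have hne s' : s' != s -> \prod_(t : J) (if s t == s' t then (wt (s t))%:C%C else 0 : C) = 0.
  move=> h; have [t ht] : exists t, s t != s' t.
    apply/existsP; apply: contraR h => /existsPn h; apply/eqP/ffunP => t.
    by apply/esym/eqP; move: (h t); rewrite negbK.
  by rewrite (bigD1 t)//= (negbTE ht) mul0r.
case: ifP => hs; last first.
  rewrite big1// => s' hs'; apply: hne; apply: contraTneq hs' => ->.
  by rewrite hs.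
rewrite (bigD1 s)//= [X in _ + X]big1 ?addr0; last by move=> s' /andP[_ /hne].
by rewrite rmorph_prod; apply: eq_bigr => t _; rewrite eqxx.
Qed.

Lemma nrm_chi (S : {set pat}) : nrm (chi S) = mass S.
Proof. by apply: (@complexI R); rewrite nrmE chi_ip setIid. Qed.

Lemma weight_ge0 s : 0 <= weight s.
Proof. by apply: prodr_ge0 => t _; rewrite /wt; case: ifP => _; exact: csq_ge0. Qed.

Lemma mass_setT : mass setT = (csq a + csq b) ^+ #|J|.
Proof.
rewrite -prodr_const; under [RHS]eq_bigr => t _ do rewrite -(big_bool _ wt).
by rewrite bigA_distr_bigA; apply: eq_bigl => s; rewrite in_setT.
Qed.

(** * Placing copies of the two states along a pattern *)

Section Sorting.
Variables (B D F : finType) (sigma : pat -> B + (D + F) -> J).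
Variable (tau : pat -> J -> B + (D + F)) (S : {set pat}).
Hypothesis sigmaK : forall s, cancel (sigma s) (tau s).
Hypothesis tauK : forall s, cancel (tau s) (sigma s).
Hypothesis sigmaB : forall s, s \in S -> forall x, s (sigma s (inl x)) = true.
Hypothesis sigmaF : forall s, s \in S -> forall x, s (sigma s (inr (inr x))) = false.

Local Notation base := (fun l => ({ffun B -> T l} * {ffun F -> U l})%type : finType).
Local Notation free := (fun l => {ffun D -> sumT l} : finType).

(** The label [z] holds a pattern and the contents of the positions in [D]. Copies of [phi] and
    [psi] go where [sigma] sends [B] and [F]; what stands at the free positions is written from the
    label, so it is paid for by GHZ states. *)
Definition place (z : pat * idx free) l (v : base l) : TUJ l :=
  [ffun t => match tau z.1 t with
             | inl x => inl (v.1 x)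
             | inr (inl y) => z.2 l y
             | inr (inr x) => inr (v.2 x)
             end].

Definition fits (z : pat * idx free) : bool :=
  (z.1 \in S) && [forall l, [forall y : D,
     (if z.2 l y is inl _ then true else false) == z.1 (sigma z.1 (inr (inl y)))]].

Definition coeff (z : pat * idx free) : C :=
  a ^+ #|B| * b ^+ #|F| *
  \prod_(y : D) branch (z.1 (sigma z.1 (inr (inl y)))) (slice z.2 y).

(** Along [sigma s] the positions split into [B], [D] and [F], and the Kronecker delta for the whole
    table is a product of deltas over positions; each position then contributes its own branch. *)
Lemma sum_place s o : s \in S ->
  \sum_(kap : idx free) coeff (s, kap) * push (place (s, kap))
     (tens (gpow B phi) (gpow F psi)) o
  = \prod_t branch (s t) (slice o t).
Proof.
move=> hs.
rewrite [RHS](reindex (sigma s)); last first.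
  by exists (tau s) => x _; [exact: sigmaK | exact: tauK].
rewrite !big_sumType.
pose dl (V : 'I_k -> finType) (i j : idx V) : C := (i == j)%:R.
have hdl kap al ga : ((o == fmap (place (s, kap)) (pairi al ga))%:R : C)
   = (\prod_x dl _ (slice o (sigma s (inl x))) (fmap (fun l => inl) (slice al x)))
   * ((\prod_y dl _ (slice o (sigma s (inr (inl y)))) (slice kap y))
   * (\prod_x dl _ (slice o (sigma s (inr (inr x)))) (fmap (fun l => inr) (slice ga x)))).
  have -> : (o == fmap (place (s, kap)) (pairi al ga))
     = [forall x, slice o (sigma s (inl x)) == fmap (fun l => inl) (slice al x)]
     && ([forall y, slice o (sigma s (inr (inl y))) == slice kap y]
     && [forall x, slice o (sigma s (inr (inr x))) == fmap (fun l => inr) (slice ga x)]).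
    apply/eqP/and3P => [->|[/forallP h1 /forallP h2 /forallP h3]].
      by split; apply/forallP => x; apply/eqP/ffunP => l; rewrite !ffunE /= sigmaK.
    apply/ffunP => l; rewrite ffunE; apply/ffunP => t; rewrite ffunE ffunE /=.
    case e : (tau s t) => [x|[y|x]]; move: (congr1 (sigma s) e); rewrite tauK => ->.
    - by move: (h1 x) => /eqP/ffunP/(_ l); rewrite !ffunE.
    - by move: (h2 y) => /eqP/ffunP/(_ l); rewrite !ffunE.
    - by move: (h3 x) => /eqP/ffunP/(_ l); rewrite !ffunE.
  have hA (V : finType) (P : pred V) : ([forall x, P x]%:R : C) = \prod_x (P x)%:R.
    case: (pickP (fun x => ~~ P x)) => [x hx|hn].
      rewrite (bigD1 x)//= (negbTE hx) mul0r.
      by case: forallP => // /(_ x); rewrite (negbTE hx).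
    have hP x : P x by move: (hn x) => /negbFE.
    rewrite big1 ?(introT forallP hP)// => x _; by rewrite hP.
  by rewrite -!mulnb !natrM !hA.
transitivity ((\prod_x \sum_i dl _ (slice o (sigma s (inl x))) (fmap (fun l => inl) i)
                  * (a * phi i))
  * ((\prod_y \sum_i dl _ (slice o (sigma s (inr (inl y)))) i
       * branch (s (sigma s (inr (inl y)))) i)
  * (\prod_x \sum_i dl _ (slice o (sigma s (inr (inr x)))) (fmap (fun l => inr) i)
                  * (b * psi i)))); last first.
  congr (_ * (_ * _)).
  - apply: eq_bigr => x _; rewrite sigmaB// /branch /scl /push mulr_sumr.
    by apply: eq_bigr => i _; rewrite mulrCA.
  - by apply: eq_bigr => y _; rewrite sum_deltal.
  - apply: eq_bigr => x _; rewrite sigmaF// /branch /scl /push mulr_sumr.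
    by apply: eq_bigr => i _; rewrite mulrCA.
rewrite -(sum_gpow (fun x i => dl _ (slice o (sigma s (inl x))) (fmap (fun l => inl) i)
                  * (a * phi i))).
rewrite -(sum_gpow (fun y i => dl _ (slice o (sigma s (inr (inl y)))) i
       * branch (s (sigma s (inr (inl y)))) i)).
rewrite -(sum_gpow (fun x i => dl _ (slice o (sigma s (inr (inr x)))) (fmap (fun l => inr) i)
                  * (b * psi i))).
rewrite mulrCA mulr_suml; apply: eq_bigr => kap _.
rewrite [X in _ * X = _]sum_pairi mulr_suml !mulr_sumr; apply: eq_bigr => al _.
rewrite !mulr_sumr; apply: eq_bigr => ga _.
rewrite hdl tens_pairi /coeff /gpow !big_split !prodr_const /slice /=; ring.
Qed.

(** Only for fitting labels does the output of a party display the pattern, as erasure requires. The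
    other labels with pattern in [S] have coefficient zero. *)
Definition fitting : finType := {z : pat * idx free | z \in [set z | fits z]}.
Local Notation Phi := (tens (gpow B phi) (gpow F psi)).
Local Notation cf := (fun z : fitting => coeff (val z)).

Lemma chi_sorted : chi S = fun o => \sum_(z : fitting) cf z * push (place (val z)) Phi o.
Proof.
apply: funext => o.
rewrite -(big_sub [in [set z | fits z]] (fun z => coeff z * push (place z) Phi o)).
transitivity (\sum_(z : pat * idx free | z.1 \in S) coeff z * push (place z) Phi o).
  transitivity (\sum_(s in S) \sum_(kap : idx free)
      coeff (s, kap) * push (place (s, kap)) Phi o).
    by apply: eq_bigr => s hs; rewrite sum_place.
  rewrite pair_big_dep /=; apply: eq_big => [z|[s kap] _ //].
  by rewrite andbT.
rewrite [RHS](eq_bigl (fun z : pat * idx free => (z.1 \in S) && fits z)); last first.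
  by move=> z; rewrite !inE /fits andbA andbb.
rewrite [RHS]big_mkcondr; apply: eq_bigr => z hz; case: ifP => // /negbT.
rewrite /fits hz /= => /forallPn[l /forallPn[y hy]].
rewrite [coeff z](_ : _ = 0) ?mul0r// /coeff (bigD1 y)//= (@branch_mismatch _ _ l).
  by rewrite mul0r mulr0.
by rewrite ffunE.
Qed.

Definition pattern l (w : TUJ l) : pat := [ffun t => if w t is inl _ then true else false].

Lemma pattern_place z l v : fits z -> pattern (@place z l v) = z.1.
Proof.
move=> /andP[hs /forallP/(_ l)/forallP h]; apply/ffunP => t; rewrite !ffunE.
case e : (tau z.1 t) => [x|[y|x]]; move: (congr1 (sigma z.1) e); rewrite tauK => ->.
- by rewrite sigmaB.
- by move: (h y) => /eqP.
- by rewrite sigmaF.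
Qed.

Lemma place_inj z l : injective (@place z l).
Proof.
move=> [v1 v2] [v1' v2'] /ffunP h; congr (_, _); apply/ffunP => x.
  by move: (h (sigma z.1 (inl x))); rewrite !ffunE sigmaK => -[].
by move: (h (sigma z.1 (inr (inr x)))); rewrite !ffunE sigmaK => -[].
Qed.

Lemma free_place z l v : [ffun y => @place z l v (sigma z.1 (inr (inl y)))] = z.2 l.
Proof. by apply/ffunP => y; rewrite !ffunE sigmaK. Qed.

Lemma fitting_fits (z : fitting) : fits (val z).
Proof. by have := valP z; rewrite inE. Qed.

(** A party reads the pattern and its own share of the free contents; jointly these shares determine
    the label, so [reach_controlled] can erase it. *)
Lemma reach_sorted : reach (tens (diag cf) Phi) (chi S).
Proof.
have [i0 _] := unitv_idx hphi; have [j0 _] := unitv_idx hpsi.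
rewrite chi_sorted.
pose Q l : finType := (pat * {ffun D -> sumT l})%type.
pose q l (z : fitting) : Q l := ((val z).1, (val z).2 l).
pose rd l (w : TUJ l) : Q l :=
  (pattern w, [ffun y => w (sigma (pattern w) (inr (inl y)))]).
apply: (reach_controlled hk cf Phi (g := fun z : fitting => place (val z)) (q := q) (rd := rd)).
- by move=> z l; exact: place_inj.
- by move=> z l v; rewrite /rd pattern_place ?fitting_fits// free_place.
- move=> z z' h; apply: val_inj; apply/eqP; rewrite -pair_eqE; apply/andP; split; apply/eqP.
    by have [] := h (Ordinal hk).
  by apply/ffunP => l; have [_ ->] := h l.
- exact: (pairi (finfun (fun l => [ffun=> i0 l])) (finfun (fun l => [ffun=> j0 l]))).
Qed.

(** An identity of vectors, not yet a conversion: this relabelling becomes isometric when no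
    position is free, see [place_fitting_inj]. *)
Lemma chi_push :
  chi S = push (fun l (p : fitting * base l) => place (val p.1) p.2) (tens (diag cf) Phi).
Proof.
rewrite -app_bop; apply: funext => o; rewrite chi_sorted app_dst//.
apply: eq_bigr => z _; congr (_ * _); apply: eq_bigr => v _; congr (_ * _).
rewrite -prod_delta; apply: eq_bigr => l _.
by rewrite /bop !ffunE.
Qed.

Lemma unitv_Phi : unitv Phi.
Proof.
apply/unitvP; rewrite nrm_tens !nrm_gpow.
move/unitvP: hphi => ->; move/unitvP: hpsi => ->.
by rewrite !expr1n mulr1.
Qed.

(** No summation over labels: the conversion [reach_sorted] preserves norms, and the norm of its
    target is known. *)
Lemma sum_cf : \sum_z csq (cf z) = mass S.
Proof.
rewrite -nrm_chi (reach_nrm reach_sorted) nrm_tens nrm_diag//.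
by move/unitvP: unitv_Phi => ->; rewrite mulr1.
Qed.

Lemma card_fitting : (#|fitting| <= #|S| * #|idx free|)%N.
Proof.
rewrite card_sig -[#|idx _|]cardsT -cardsX; apply/subset_leq_card/subsetP => z.
by rewrite !inE => /andP[->].
Qed.

(** The cost in GHZ labels is the number of patterns times the full dimension of the free positions,
    which bounds the number of fitting labels. *)
Lemma reach_chi (Z : finType) : 0 < mass S -> (#|S| * #|idx free| <= #|Z|)%N ->
  reach (tens (ghz Z) Phi) (scl ((Num.sqrt (mass S))^-1)%:C%C (chi S)).
Proof.
move=> hm hZ; set r := (_^-1)%:C%C.
apply: (reach_trans (psi := scl r (tens (diag cf) Phi))); last first.
  by apply: reach_scl; exact: reach_sorted.
rewrite scl_tens_diag.
apply: (reach_ghz_sub hk) => //; first exact: unitv_Phi.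
  under eq_bigr => z _ do rewrite csqM.
  rewrite -mulr_sumr sum_cf /r csq_real exprVn sqr_sqrtr ?mulVf ?gt_eqF//.
  exact: ltW.
exact: leq_trans card_fitting hZ.
Qed.

(* Without free positions the pattern determines the position of every copy,
   so that the restricted power is locally equivalent to its sorted form. *)
Lemma chi_ghz : #|D| = 0 -> 0 < mass S ->
  scl ((Num.sqrt (mass S))^-1)%:C%C (chi S)
  = push (fun l (p : fitting * base l) => place (val p.1) p.2)
      (tens (diag (fun z : fitting => ((Num.sqrt (mass S))^-1)%:C%C * (a ^+ #|B| * b ^+ #|F|))) Phi).
Proof.
move=> hD hm; rewrite chi_push.
have hc (z : fitting) : cf z = a ^+ #|B| * b ^+ #|F|.
  rewrite /coeff big_pred0 ?mulr1// => y.
  by have := fintype0 y hD.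
rewrite scl_push scl_tens_diag; congr (push _ (tens (diag _) _)).
by apply: funext => z; rewrite hc.
Qed.

Lemma place_fitting_inj : #|D| = 0 -> forall l,
  injective (fun p : fitting * base l => @place (val p.1) l p.2).
Proof.
move=> hD l [z v] [z' v'] /= h.
have hz : z = z'.
  apply: val_inj; apply/eqP; rewrite -pair_eqE; apply/andP; split; apply/eqP.
    by rewrite -(pattern_place v (fitting_fits z)) h pattern_place// fitting_fits.
  by apply/ffunP => l'; apply/ffunP => y; have := fintype0 y hD.
by move: h; rewrite hz => /place_inj ->.
Qed.

Lemma card_fitting0 : #|D| = 0 -> #|fitting| = #|S|.
Proof.
move=> hD; rewrite card_sig.
have hk1 : idx free by apply: finfun => l; apply: finfun => y; have := fintype0 y hD.
rewrite -(card_in_imset (f := fun z : pat * idx free => z.1)) /=; last first.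
  move=> [s kap] [s' kap'] _ _ /= ->; congr (_, _).
  by apply/ffunP => l; apply/ffunP => y; have := fintype0 y hD.
apply: eq_card => s; apply/imsetP/idP => [[z]|hs]; first by rewrite inE => /andP[? _] ->.
exists (s, hk1) => //; rewrite inE /fits hs; apply/forallP => l; apply/forallP => y.
by have := fintype0 y hD.
Qed.

End Sorting.
End Patterns.
End DirectSumPowers.

(** * The direct-sum formula *)

(** For [s] in [S] there is room for [B] among the true and for [F] among the false positions, and
    [D] takes the rest. Outside [S] any bijection will do, which keeps [sigma s] invertible for
    every [s]. *)
Lemma sorting_exists (J B D F : finType) (S : {set {ffun J -> bool}}) :
  #|J| = (#|B| + (#|D| + #|F|))%N ->
  (forall s, s \in S -> (#|B| <= #|[set t | s t]|)%N) ->
  (forall s, s \in S -> (#|F| <= #|[set t | ~~ s t]|)%N) ->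
  exists (sigma : {ffun J -> bool} -> B + (D + F) -> J)
         (tau : {ffun J -> bool} -> J -> B + (D + F)),
  [/\ forall s, cancel (sigma s) (tau s), forall s, cancel (tau s) (sigma s),
      forall s, s \in S -> forall x, s (sigma s (inl x)) = true &
      forall s, s \in S -> forall x, s (sigma s (inr (inr x))) = false].
Proof.
move=> hJ hB hF.
have hcard : #|{: B + (D + F)}| = #|J| by rewrite !card_sum hJ.
suff h s : exists st : (B + (D + F) -> J) * (J -> B + (D + F)),
  [/\ cancel st.1 st.2, cancel st.2 st.1,
      s \in S -> forall x, s (st.1 (inl x)) = true &
      s \in S -> forall x, s (st.1 (inr (inr x))) = false].
  have [f hf] := boolp.choice h.
  by exists (fun s => (f s).1), (fun s => (f s).2); split => s; have [] := hf s.
suff [sg [[ta h1 h2] h3 h4]] : exists sg : B + (D + F) -> J, [/\ bijective sg,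
   s \in S -> forall x, s (sg (inl x)) = true &
   s \in S -> forall x, s (sg (inr (inr x))) = false].
  by exists (sg, ta).
case hs : (s \in S); last first.
  exists (fun x => enum_val (cast_ord hcard (enum_rank x))); split => //.
  exists (fun t => enum_val (cast_ord (esym hcard) (enum_rank t))) => x.
    by rewrite enum_valK cast_ordK enum_rankK.
  by rewrite enum_valK cast_ordKV enum_rankK.
pose e1 (x : B) : J := enum_val (widen_ord (hB s hs) (enum_rank x)).
pose e2 (x : F) : J := enum_val (widen_ord (hF s hs) (enum_rank x)).
have e1i : injective e1.
  by move=> x y /enum_val_inj /(congr1 val) /= /val_inj /enum_rank_inj.
have e2i : injective e2.
  by move=> x y /enum_val_inj /(congr1 val) /= /val_inj /enum_rank_inj.
have e1s x : s (e1 x) = true.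
  by have := enum_valP (widen_ord (hB s hs) (enum_rank x)); rewrite inE.
have e2s x : s (e2 x) = false.
  by have := enum_valP (widen_ord (hF s hs) (enum_rank x)); rewrite inE => /negbTE.
pose A := ~: (e1 @: setT :|: e2 @: setT).
have hA : #|A| = #|D|.
  have hdis : e1 @: setT :&: e2 @: setT = set0.
    apply/setP => t; rewrite !inE; apply/negP => /andP[].
    by move=> /imsetP[x _ ->] /imsetP[y _ e]; have := e1s x; rewrite e e2s.
  have := cardsC (e1 @: setT :|: e2 @: setT); rewrite -/A.
  rewrite cardsU hdis cards0 subn0 !card_imset// !cardsT hJ.
  by move=> h; lia.
pose e3 (x : D) : J := enum_val (cast_ord (esym hA) (enum_rank x)).
have e3i : injective e3.
  by move=> x y /enum_val_inj /cast_ord_inj /enum_rank_inj.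
have e3A x : e3 x \in A by exact: enum_valP.
have e31 x y : e3 x <> e1 y.
  move=> e; have := e3A x; rewrite e !inE negb_or => /andP[/negP[]].
  exact: imset_f.
have e32 x y : e3 x <> e2 y.
  move=> e; have := e3A x; rewrite e !inE negb_or => /andP[_ /negP[]].
  exact: imset_f.
have e12 x y : e1 x <> e2 y by move=> e; have := e1s x; rewrite e e2s.
exists (fun x => match x with inl b => e1 b | inr (inl d) => e3 d | inr (inr f) => e2 f end).
split => //; apply: inj_card_bij; last by rewrite hcard.
move=> [x|[x|x]] [y|[y|y]] e.
- by rewrite (e1i _ _ e).
- by case: (e31 _ _ (esym e)).
- by case: (e12 _ _ e).
- by case: (e31 _ _ e).
- by rewrite (e3i _ _ e).
- by case: (e32 _ _ e).
- by case: (e12 _ _ (esym e)).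
- by case: (e32 _ _ (esym e)).
- by rewrite (e2i _ _ e).
Qed.

(** * The inequality from measuring the type of the pattern *)

Section LowerBound.
Context {R : realType} {k : nat}.
Local Notation C := (R[i]).
Local Notation vec := (@vec R k).
Local Notation dens := (@dens R k).
Local Notation lop := (@lop R k).
Hypothesis hk : (0 < k)%N.
Variable E : forall T : 'I_k -> finType, dens T -> R.
Hypothesis Eadd : fully_additive E.
Hypothesis Emon : monotone_on_average E.
Hypothesis Eghz : Ep E GHZ = 1.
Variables (T U : 'I_k -> finType) (phi : vec T) (psi : vec U).
Hypothesis (hphi : unitv phi) (hpsi : unitv psi).
Variable (p : R).
Hypothesis (hp : 0 < p < 1).
Let q := 1 - p.
Let a : C := (Num.sqrt p)%:C%C.
Let b : C := (Num.sqrt (1 - p))%:C%C.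

Let p_gt0 : 0 < p. Proof. by case/andP: hp. Qed.
Let q_gt0 : 0 < q. Proof. by rewrite subr_gt0; case/andP: hp. Qed.

Lemma wt_true : wt a b true = p.
Proof. by rewrite /wt csq_real sqr_sqrtr// ltW. Qed.
Lemma wt_false : wt a b false = q.
Proof. by rewrite /wt csq_real sqr_sqrtr// ltW. Qed.

Lemma weightE (J : finType) (s : {ffun J -> bool}) :
  weight a b s = p ^+ #|[set t | s t]| * q ^+ #|[set t | ~~ s t]|.
Proof.
rewrite /weight (bigID (fun t => s t)) /=; congr (_ * _).
  by rewrite (eq_bigr (fun=> p)) ?prodr_const ?cardsE// => t ->; exact: wt_true.
by rewrite (eq_bigr (fun=> q)) ?prodr_const ?cardsE// => t /negbTE ->; exact: wt_false.
Qed.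

Lemma mass1 (J : finType) : mass a b [set: {ffun J -> bool}] = 1.
Proof.
rewrite mass_setT -[csq a]/(wt a b true) -[csq b]/(wt a b false) wt_true wt_false.
by rewrite /q addrC subrK expr1n.
Qed.

Lemma card_falses (J : finType) (s : {ffun J -> bool}) :
  #|[set t | ~~ s t]| = (#|J| - #|[set t | s t]|)%N.
Proof.
rewrite -(cardsC [set t | s t]) addKn; apply: eq_card => t.
by rewrite !inE.
Qed.

Definition type_class (J : finType) (m : nat) : {set {ffun J -> bool}} :=
  [set s : {ffun J -> bool} | #|[set t | s t]| == m].

Lemma mass_type_class (J : finType) m :
  mass a b (type_class J m) = #|type_class J m|%:R * (p ^+ m * q ^+ (#|J| - m)).
Proof.
rewrite /mass (eq_bigr (fun=> p ^+ m * q ^+ (#|J| - m))).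
  by rewrite sumr_const mulr_natl.
by move=> s; rewrite inE => /eqP hs; rewrite weightE card_falses hs.
Qed.

(** Linearity of expectation: [weight] is a product measure in which each position is true with
    probability [p]. *)
Lemma mean_type (J : finType) :
  \sum_(s : {ffun J -> bool}) weight a b s * #|[set t | s t]|%:R = #|J|%:R * p.
Proof.
transitivity (\sum_(t0 : J) \sum_(s : {ffun J -> bool}) weight a b s * (s t0)%:R).
  rewrite exchange_big; apply: eq_bigr => s _ /=; rewrite -mulr_sumr; congr (_ * _).
  rewrite -sum1_card natr_sum [LHS](eq_bigl (fun t => s t)); last by move=> t; rewrite inE.
  by rewrite big_mkcond; apply: eq_bigr => t _; case: (s t).
rewrite -sum_cst; apply: eq_bigr => t0 _.
transitivity (\prod_(t : J) \sum_(x : bool) wt a b x * (if t == t0 then x%:R else 1)).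
  rewrite bigA_distr_bigA; apply: eq_bigr => s _; rewrite big_split /=; congr (_ * _).
  rewrite (bigD1 t0)//= eqxx big1 ?mulr1// => t /negbTE ->//.
rewrite (bigD1 t0)//= eqxx [X in _ * X]big1 ?mulr1; last first.
  by move=> t /negbTE ->; rewrite big_bool !mulr1 wt_true wt_false /q /=; ring.
by rewrite big_bool wt_true wt_false mulr1 mulr0 /= addr0.
Qed.

Lemma E_type_class N m : 0 < mass a b (type_class 'I_N m) ->
  Ep E (scl ((Num.sqrt (mass a b (type_class 'I_N m)))^-1)%:C%C
         (chi a b phi psi (type_class 'I_N m)))
  = log2 (#|type_class 'I_N m|%:R) + m%:R * Ep E phi + (N - m)%:R * Ep E psi.
Proof.
set S := type_class 'I_N m => hm.
have hS0 : (0 < #|S|)%N.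
  by rewrite lt0n; apply/eqP => h; move: hm; rewrite mass_type_class -/S h mul0r ltxx.
have hmN : (m <= N)%N.
  have /card_gt0P[s] := hS0; rewrite inE => /eqP <-.
  by rewrite -[X in (_ <= X)%N]card_ord max_card.
(* With [D] empty the copies fill all positions. As all patterns of one type have the same weight,
   the label state is a uniform GHZ state. *)
have [||| sg [ta [h1 h2 h3 h4]]] := @sorting_exists 'I_N 'I_m 'I_0 'I_(N - m) S.
- by rewrite !card_ord add0n subnKC.
- by move=> s; rewrite inE card_ord => /eqP ->.
- by move=> s; rewrite inE card_falses !card_ord => /eqP ->.
have hD : #|'I_0| = 0%N by rewrite card_ord.
rewrite (chi_ghz phi psi h1 h2 h3 h4 hD hm).
have hf : #|fitting T U sg S| = #|S| by rewrite card_fitting0.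
have hf0 : (0 < #|fitting T U sg S|)%N by rewrite hf.
set dg := diag _.
have -> : dg = ghz (fitting T U sg S) :> vec _.
  rewrite /dg /ghz; congr diag; apply: funext => z.
  rewrite !card_ord hf mass_type_class -/S card_ord /a /b -!rmorphXn -!rmorphM.
  congr (_%:C)%C; rewrite -/q !sqrtrM ?exprn_ge0 ?ltW ?ltr0n// ?sqrtr_exp ?ltW//.
  have hp0 : Num.sqrt p != 0 by rewrite gt_eqF// sqrtr_gt0.
  have hq0 : Num.sqrt q != 0 by rewrite gt_eqF// sqrtr_gt0.
  have hs0 : Num.sqrt #|S|%:R != 0 :> R by rewrite gt_eqF// sqrtr_gt0 ltr0n.
  by field; rewrite hs0 !expf_neq0.
have hu1 := unitv_gpow 'I_m hphi; have hu2 := unitv_gpow 'I_(N - m) hpsi.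
have hu3 := unitv_tens hu1 hu2; have hu4 := unitv_ghz hk hf0.
rewrite (E_push hk Emon); last 2 first.
- exact: (place_fitting_inj h1 h2 h3 h4 hD).
- exact: unitv_tens.
rewrite !Eadd// (E_ghz hk Eadd Emon Eghz hf0) hf -!tpow_gpow.
by rewrite !(E_tpow hk Eadd Emon)// addrA.
Qed.

(** Gibbs' inequality against the uniform distribution, from [ln y <= y - 1]. It bounds what the
    type measurement loses by a logarithm in [N]. *)
Lemma entropy_le (n : nat) (w : 'I_n.+1 -> R) :
  (forall i, 0 <= w i) -> \sum_i w i = 1 ->
  - log2 (n.+1%:R) <= \sum_i xlogx (w i).
Proof.
move=> hw h1; rewrite -(ler_pM2r (@ln2_gt0 R)) mulr_suml mulNr /log2 divfK; last first.
  by rewrite gt_eqF// ln2_gt0.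
have h i : w i * (1 - ln n.+1%:R) - n.+1%:R^-1 <= xlogx (w i) * ln 2.
  rewrite /xlogx; case: eqP => [->|/eqP h0].
    by rewrite !mul0r sub0r oppr_le0 invr_ge0.
  have hwi : 0 < w i by rewrite lt_neqAle eq_sym h0 hw.
  rewrite /log2 -mulrA divfK ?gt_eqF ?ln2_gt0//.
  have hx : 0 < (w i * n.+1%:R)^-1 by rewrite invr_gt0 mulr_gt0.
  have hl : - (ln (w i) + ln n.+1%:R) <= (w i * n.+1%:R)^-1 - 1.
    rewrite -lnM ?posrE// -lnV ?posrE ?mulr_gt0//.
    move: hx; set y := _^-1 => hx; have hy : -1 < y - 1 by lra.
    have := le_ln1Dx hy; have -> : 1 + (y - 1) = y by ring.
    by [].
  have := ler_wpM2l (hw i) hl; rewrite invfM mulrBr mulrA divff// mul1r mulr1.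
  by rewrite mulrN mulrDr [w i * (1 - _)]mulrBr mulr1;
    move: (w i * ln (w i)) (w i * ln n.+1%:R) (n.+1%:R^-1) => x y z *; lra.
have : \sum_i (w i * (1 - ln n.+1%:R) - n.+1%:R^-1) <= \sum_i xlogx (w i) * ln 2.
  by apply: ler_sum => i _; exact: h.
rewrite sumrB -[X in X - _]mulr_suml h1 mul1r sum_cst card_ord divff ?pnatr_eq0//.
by move=> hh; apply: le_trans hh; lra.
Qed.

Lemma app_diag_op (V : 'I_k -> finType) (D : forall l, V l -> C) (v : vec V) :
  app (prodop (fun l (t t0 : V l) => (t == t0)%:R * D l t)) v
  = fun i => (\prod_l D l (i l)) * v i.
Proof.
apply: funext => o; rewrite /app (bigD1 o)//= big1 ?addr0.
  by congr (_ * _); apply: eq_bigr => l _; rewrite eqxx mul1r.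
move=> i hi; rewrite /prodop big_split /= prod_delta eq_sym (negbTE hi).
by rewrite !mul0r.
Qed.

(** Since a pattern is visible at any party, the party [j0] alone measures its type, by a projective
    measurement. *)
Lemma E_dsum_pow_ge N :
  \sum_(m < N.+1) mass a b (type_class 'I_N m)
     * (log2 (#|type_class 'I_N m|%:R) + m%:R * Ep E phi + (N - m)%:R * Ep E psi)
  <= N%:R * Ep E (dsum a b phi psi).
Proof.
pose chiN := gpow 'I_N (dsum a b phi psi).
have hchi : chiN = chi a b phi psi [set: {ffun 'I_N -> bool}] by rewrite chi_setT.
have hu1 : unitv (dsum a b phi psi).
  apply/unitvP; have := nrm_chi hk a b hphi hpsi [set: {ffun 'I_1 -> bool}].
  by rewrite mass1 chi_setT nrm_gpow card_ord expr1.
have hu : unitv chiN by apply: unitv_gpow.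
rewrite -(E_tpow hk Eadd Emon)// tpow_gpow -/chiN.
pose V l : finType := {ffun 'I_N -> sumT T U l}.
pose j0 := Ordinal hk.
pose M (m : 'I_N.+1) l (w : V l) : C :=
  if l == j0 then (#|[set t | pattern w t]| == m :> nat)%:R else 1.
pose A (m : 'I_N.+1) : lop V V := fun l t t0 => (t == t0)%:R * M m l t.
have hI : impl (fun m => prodop (A m)).
  apply: (impl_one_party (j := j0)) => [m l hl|t t0].
    by apply: funext => t; apply: funext => t0; rewrite /A /M (negbTE hl) mulr1.
  have hlt : (#|[set x | pattern t x]| < N.+1)%N.
    by rewrite ltnS -[X in (_ <= X)%N]card_ord max_card.
  rewrite -gram_delta (bigD1 (Ordinal hlt))//= [X in _ + X]big1 ?addr0; last first.
    move=> m hm; rewrite /gram big1// => o _; rewrite /A /M eqxx.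
    have [->|_] := eqVneq o t; last by rewrite mul0r rmorph0 mul0r.
    rewrite eq_sym; have -> : (m == #|[set x | pattern t x]| :> nat) = false.
      by apply/negbTE; move: hm; rewrite -val_eqE.
    by rewrite mulr0 rmorph0 mul0r.
  apply: eq_bigr => o _; rewrite /A /M eqxx.
  have [->|_] := eqVneq o t; last by rewrite mul0r rmorph0 !mul0r.
  by rewrite /= eqxx !mulr1.
have happ m : app (prodop (A m)) chiN = chi a b phi psi (type_class 'I_N m).
  rewrite hchi app_diag_op; apply: funext => o; rewrite /chi mulr_sumr.
  rewrite [LHS](eq_bigl xpredT); last by move=> s; rewrite in_setT.
  rewrite [RHS]big_mkcond; apply: eq_bigr => s _.
  have [hs|hs] := eqVneq (pattern (o j0)) s; last first.
    have [t ht] : exists t, pattern (o j0) t != s t.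
      apply/existsP; apply: contraR hs => /existsPn h; apply/eqP/ffunP => t.
      by apply/eqP; move: (h t); rewrite negbK.
    rewrite (bigD1 t)//= (@branch_mismatch _ _ _ _ _ _ _ _ _ _ j0).
      by rewrite mul0r mulr0 if_same.
    by move: ht; rewrite ffunE /slice ffunE.
  rewrite (bigD1 j0)//= big1 ?mulr1; last by move=> l hl; rewrite /M (negbTE hl).
  by rewrite /M eqxx hs inE; case: ifP => _; rewrite ?mul1r ?mul0r.
pose w (m : 'I_N.+1) := mass a b (type_class 'I_N m).
have hw (m : 'I_N.+1) : nrm (chi a b phi psi (type_class 'I_N m)) = w m by exact: nrm_chi.
(* For types of weight zero the unit vector is arbitrary; [chiN] is taken. *)
pose v (m : 'I_N.+1) : vec V := if 0 < w m then
  scl ((Num.sqrt (w m))^-1)%:C%C (chi a b phi psi (type_class 'I_N m)) else chiN.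
have hv (m : 'I_N.+1) : unitv (v m).
  rewrite /v; case: ifP => // h; apply/unitvP; rewrite nrm_scl hw csq_real exprVn.
  by rewrite sqr_sqrtr ?ltW// mulVf// gt_eqF.
have := @E_avg _ _ hk E Emon _ _ _ _ chiN (fun m => (Num.sqrt (w m))%:C%C) v hI hu hv.
have hw0 (m : 'I_N.+1) : 0 <= w m by rewrite -hw nrm_ge0.
move=> /(_ _) h; apply: le_trans (h _).
  apply: ler_sum => m _; rewrite csq_real sqr_sqrtr// /v; case: ifP => [hm|/negbT hm].
    by rewrite E_type_class.
  have -> : w m = 0 by apply/eqP; rewrite eq_le hw0 andbT leNgt.
  by rewrite -/(w m) mul0r; move: hm; rewrite lt_neqAle hw0 andbT negbK eq_sym => /eqP ->; rewrite mul0r.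
move=> m; rewrite happ /v; case: ifP => [hm|/negbT hm].
  apply: funext => o; rewrite /scl mulrA -rmorphM divff ?rmorph1 ?mul1r//.
  by rewrite gt_eqF// sqrtr_gt0.
have e : w m = 0 by apply/eqP; rewrite eq_le hw0 andbT leNgt.
rewrite e sqrtr0; rewrite (nrm_eq0 (etrans (hw m) e)).
by apply: funext => o; rewrite /scl mul0r.
Qed.

Lemma sum_type_class N (f : nat -> R) :
  \sum_(m < N.+1) mass a b (type_class 'I_N m) * f m
  = \sum_(s : {ffun 'I_N -> bool}) weight a b s * f #|[set t | s t]|.
Proof.
have hlt (s : {ffun 'I_N -> bool}) : (#|[set t | s t]| < N.+1)%N.
  by rewrite ltnS -[X in (_ <= X)%N]card_ord max_card.
rewrite [RHS](partition_big (fun s => Ordinal (hlt s)) xpredT)//=.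
apply: eq_bigr => m _; rewrite /mass mulr_suml; apply: eq_big => [s|s].
  by rewrite inE -val_eqE.
by rewrite inE => /eqP ->.
Qed.

(** Taking the logarithm of the mass of a type class replaces any estimate of binomial coefficients;
    what remains is an entropy, controlled by [entropy_le]. *)
Lemma xlogx_mass N (m : 'I_N.+1) : let w := mass a b (type_class 'I_N m) in
  w * log2 (#|type_class 'I_N m|%:R) = xlogx w - w * (m%:R * log2 p + (N - m)%:R * log2 q).
Proof.
move=> w; rewrite /xlogx; case: eqP => [->|/eqP hw]; first by rewrite !mul0r subr0.
have hw' : w = #|type_class 'I_N m|%:R * (p ^+ m * q ^+ (N - m)).
  by rewrite /w mass_type_class card_ord.
have hc : 0 < #|type_class 'I_N m|%:R :> R.
  rewrite ltr0n lt0n; apply: contraNneq hw => h; by rewrite hw' h mul0r.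
rewrite [log2 w](congr1 log2 hw') log2M ?mulr_gt0 ?exprn_gt0// log2M ?exprn_gt0//.
have hX x n : 0 < x -> log2 (x ^+ n) = n%:R * log2 x :> R.
  by move=> hx; rewrite /log2 lnXn// -(mulr_natl (ln _)) mulrA.
rewrite !hX//; ring.
Qed.

Lemma E_dsum_ge :
  p * Ep E phi + (1 - p) * Ep E psi + hbin p <= Ep E (dsum a b phi psi).
Proof.
set x := Ep E _; set y := Ep E psi; set z := Ep E _.
rewrite -subr_le0; set dl := _ - z.
have hN N : N%:R * dl <= log2 (N.+1%:R).
  have := E_dsum_pow_ge N; rewrite -/x -/y -/z => h.
  have h1 : \sum_(m < N.+1) mass a b (type_class 'I_N m) = 1.
    have := sum_type_class N (fun=> 1); under eq_bigr do rewrite mulr1.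
    move=> ->; under eq_bigr do rewrite mulr1.
    by rewrite -(mass1 'I_N) /mass; apply: eq_bigl => s; rewrite in_setT.
  have hm : \sum_(m < N.+1) mass a b (type_class 'I_N m) * m%:R = N%:R * p.
    by rewrite (sum_type_class N (fun m => m%:R)) mean_type card_ord.
  have h2 : \sum_(m < N.+1) mass a b (type_class 'I_N m)
     * (log2 (#|type_class 'I_N m|%:R) + m%:R * x + (N - m)%:R * y)
     = \sum_(m < N.+1) xlogx (mass a b (type_class 'I_N m))
       + (N%:R * p) * ((x - log2 p) - (y - log2 q)) + N%:R * (y - log2 q).
    have -> : N%:R * (y - log2 q)
        = \sum_(m < N.+1) mass a b (type_class 'I_N m) * (N%:R * (y - log2 q)).
      by rewrite -mulr_suml h1 mul1r.
    rewrite -hm mulr_suml -!big_split.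
    apply: eq_bigr => m _ /=; have := xlogx_mass m => /= h3.
    have hmN : (m <= N)%N by rewrite -ltnS.
    rewrite !mulrDr h3 natrB//; ring.
  have h4 := @entropy_le N (fun m => mass a b (type_class 'I_N m)) _ h1.
  have {}h4 : - log2 N.+1%:R <= \sum_(m < N.+1) xlogx (mass a b (type_class 'I_N m)).
    by apply: h4 => m; apply: sumr_ge0 => s _; exact: weight_ge0.
  have hdl : dl = p * (x - log2 p) + (1 - p) * (y - log2 q) - z.
    rewrite /dl /hbin /xlogx gt_eqF// [1 - p == 0]gt_eqF// /q; ring.
  move: h; rewrite h2 => h; rewrite hdl.
  have -> : N%:R * (p * (x - log2 p) + (1 - p) * (y - log2 q) - z)
     = N%:R * p * (x - log2 p - (y - log2 q)) + N%:R * (y - log2 q) - N%:R * z by ring.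
  lra.
apply: (@le0_of_bounded_multiples R _ (2 / ln 2)) => M.
have [h0|h0] := leP dl 0.
  apply: (le_trans (y := 0)); first by rewrite mulr_ge0_le0.
  by rewrite divr_ge0// ltW// ln2_gt0.
(* For [N = M (M + 2)] one has [N + 1 = (M + 1)^2], so the error is at most [2 M / ln 2]; dividing
   by [M] leaves multiples of [dl] under a fixed bound. *)
have := hN (M * M.+2)%N.
have -> : (M * M.+2).+1 = (M.+1 * M.+1)%N by lia.
rewrite !natrM log2M// => h.
have [->|hM] := eqVneq M 0%N; first by rewrite mul0r divr_ge0// ltW// ln2_gt0.
have hM0 : 0 < M%:R :> R by rewrite ltr0n lt0n.
have hl : log2 M.+1%:R <= M%:R / ln 2 :> R.
  rewrite /log2 ler_pM2r ?invr_gt0 ?ln2_gt0// -natr1 addrC le_ln1Dx//.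
  by apply: lt_trans hM0; rewrite ltrN10.
have h5 : M%:R * (M.+2%:R * dl) <= M%:R * (2 / ln 2).
  by rewrite mulrA; apply: le_trans h _; rewrite mulrCA; lra.
move: h5; rewrite ler_pM2l// => h5; apply: le_trans h5.
by rewrite ler_pM2r// ler_nat; lia.
Qed.

End LowerBound.

(** * Tail estimates for random patterns *)

Section UpperBound.
Context {R : realType} {k : nat}.
Local Notation C := (R[i]).
Local Notation vec := (@vec R k).
Local Notation dens := (@dens R k).
Hypothesis hk : (0 < k)%N.
Variables (T U : 'I_k -> finType) (phi : vec T) (psi : vec U).
Hypothesis (hphi : unitv phi) (hpsi : unitv psi).
Variable (p : R).
Hypothesis (hp : 0 < p < 1).
Let q := 1 - p.
Let a : C := (Num.sqrt p)%:C%C.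
Let b : C := (Num.sqrt (1 - p))%:C%C.

Let p_gt0 : 0 < p. Proof. by case/andP: hp. Qed.
Let q_gt0 : 0 < q. Proof. by rewrite subr_gt0; case/andP: hp. Qed.
Let p_le1 : p <= 1. Proof. by case/andP: hp => _ /ltW. Qed.
Let q_le1 : q <= 1. Proof. by rewrite /q lerBlDr lerDl ltW. Qed.

Lemma fid2_proj (V : 'I_k -> finType) (v w : vec V) :
  fid2 (proj v) w = csq (\sum_i conjc (w i) * v i).
Proof.
rewrite /fid2 /csq rmorph_sum mulrC mulr_suml; congr complex.Re.
apply: eq_bigr => i _; rewrite mulr_sumr; apply: eq_bigr => i' _.
by rewrite /proj rmorphM /= conjcK; ring.
Qed.

Lemma ip_push (V W : 'I_k -> finType) (f : forall l, V l -> W l) (v w : vec V) :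
  (forall l, injective (f l)) ->
  \sum_o conjc (push f w o) * push f v o = \sum_i conjc (w i) * v i.
Proof.
move=> /fmap_inj hf.
transitivity (\sum_o \sum_i conjc (push f w o) * ((o == fmap f i)%:R * v i)).
  by apply: eq_bigr => o _; rewrite -mulr_sumr.
rewrite exchange_big; apply: eq_bigr => i _ /=.
rewrite (bigD1 (fmap f i))//= eqxx mul1r push_fmap// big1 ?addr0// => o /negbTE ->.
by rewrite mul0r mulr0.
Qed.

Lemma card_idx_ffun (V : 'I_k -> finType) (D : finType) :
  #|idx (fun l => {ffun D -> V l} : finType)| = (#|idx V| ^ #|D|)%N.
Proof.
have h := @sum_gpow _ V D nat (fun _ _ => 1%N).
transitivity (\sum_(i : idx (fun l => {ffun D -> V l} : finType)) \prod_(t : D) 1)%N.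
  by rewrite -sum1_card; apply: eq_bigr => i _; rewrite big1.
apply: (etrans h); rewrite -prod_nat_const; apply: eq_bigr => t _.
by rewrite -sum1_card.
Qed.

(** The binomial generating function; [be] selects the true or the false positions, so one tail
    bound serves both ingredients. *)
Lemma generating_weight (J : finType) (be : bool) (x : R) :
  \sum_(s : {ffun J -> bool}) weight a b s * x ^+ #|[set t | s t == be]|
  = (wt a b be * x + (1 - wt a b be)) ^+ #|J|.
Proof.
transitivity (\prod_(t : J) \sum_(c : bool) wt a b c * (if c == be then x else 1)).
  rewrite bigA_distr_bigA; apply: eq_bigr => s _; rewrite big_split /=; congr (_ * _).
  rewrite -big_mkcond /= prodr_const; congr (_ ^+ _).
  by apply: eq_card => t; rewrite inE.
rewrite prodr_const; congr (_ ^+ _); rewrite big_bool (wt_true hp) (wt_false hp).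
by case: be; rewrite ?(wt_true hp) ?(wt_false hp) /=; ring.
Qed.

(* Exponential Markov inequality with parameter [x = 1 - y]; the constant
   [y = (N w - m) / (2 N w)] makes [m y / (1 - y) < N w y]. *)
Lemma chernoff (N m : nat) (be : bool) : m%:R < N%:R * wt a b be ->
  exists rho : R, [/\ 0 <= rho, rho < 1 & forall n : nat,
    mass a b [set s : {ffun 'I_n * 'I_N -> bool} |
      (#|[set t | s t == be]| < n * m)%N] <= rho ^+ n].
Proof.
move=> hm; set w := wt a b be in hm *.
have hw : 0 < w <= 1.
  by rewrite /w; case: be {hm w}; rewrite ?(wt_true hp) ?(wt_false hp);
    apply/andP.
have hNw : 0 < N%:R * w by apply: le_lt_trans hm.
pose y := (N%:R * w - m%:R) / (2 * (N%:R * w)).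
have hy0 : 0 < y by rewrite divr_gt0// ?subr_gt0// mulr_gt0.
have hy1 : y < 1.
  have hd : 0 < 2 * (N%:R * w) by lra.
  rewrite /y ltr_pdivrMr// mul1r.
  have : 0 <= m%:R :> R by []; lra.
have h1y : 0 < 1 - y by rewrite subr_gt0.
have hNy : N%:R * w * (1 - y) = (N%:R * w + m%:R) / 2.
  rewrite /y; field; have := lt0r_neq0 hNw; rewrite mulf_eq0 negb_or => /andP[-> ->] //.
pose x := 1 - y.
pose rho := (w * x + (1 - w)) ^+ N / x ^+ m.
have hbase : w * x + (1 - w) = 1 - w * y by rewrite /x; ring.
have hwy : w * y < 1.
  case/andP: hw => hw0 hw1; apply: le_lt_trans hy1.
  by rewrite -[leRHS]mul1r ler_pM2r.
exists rho; split.
- by rewrite divr_ge0 ?exprn_ge0// ?ltW// hbase subr_gt0.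
- rewrite ltr_pdivrMr ?exprn_gt0// mul1r hbase.
  have h1 : (1 - w * y) ^+ N <= expR (N%:R * - (w * y)).
    rewrite expRM_natl; apply: lerXn2r; rewrite ?nnegrE ?expR_ge0 ?subr_ge0 ?(ltW hwy)//.
    exact: expR_ge1Dx.
  have h2 : expR (m%:R * - (y / (1 - y))) <= x ^+ m.
    rewrite expRM_natl; apply: lerXn2r; rewrite ?nnegrE ?expR_ge0 ?(ltW h1y)//.
    rewrite expRN -[leRHS]invrK lef_pV2 ?posrE ?expR_gt0 ?invr_gt0//.
    apply: le_trans (expR_ge1Dx _); rewrite /x le_eqVlt; apply/orP; left; apply/eqP.
    by field; rewrite gt_eqF.
  apply: le_lt_trans h1 (lt_le_trans _ h2).
  rewrite ltr_expR !mulrN ltrN2 mulrA ltr_pdivrMr//.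
  have -> : N%:R * (w * y) * (1 - y) = N%:R * w * (1 - y) * y by ring.
  by rewrite hNy ltr_pM2r//; lra.
move=> n; set Bd := [set s | _].
have hx0 : 0 < x by [].
have hx1 : x <= 1 by rewrite /x; lra.
have -> : rho ^+ n = (w * x + (1 - w)) ^+ (n * N) / x ^+ (n * m).
  by rewrite /rho expr_div_n -!exprM ![(n * _)%N]mulnC.
rewrite ler_pdivlMr ?exprn_gt0//.
have <- : #|{: 'I_n * 'I_N}| = (n * N)%N by rewrite card_prod !card_ord.
rewrite /w -generating_weight /mass mulr_suml.
rewrite [leRHS](bigID (mem Bd)) /= -[leLHS]addr0 lerD//; last first.
  by apply: sumr_ge0 => s _; rewrite mulr_ge0 ?weight_ge0 ?exprn_ge0// ltW.
apply: ler_sum => s; rewrite inE => hs.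
apply: ler_wpM2l; first exact: weight_ge0.
by apply: ler_wiXn2l; [exact: ltW | exact: hx1 | exact: ltnW].
Qed.

Lemma geometric_small (rho eps : R) : 0 <= rho -> rho < 1 -> 0 < eps ->
  exists n0 : nat, forall n, (n0 <= n)%N -> rho ^+ n <= eps.
Proof.
move=> h0 h1 he; pose d := 1 - rho; have hd : 0 < d by rewrite subr_gt0.
exists (Num.Def.truncn (eps^-1 / d)).+1 => n hn.
have h : eps^-1 <= n%:R * d.
  rewrite -ler_pdivrMr//; apply: (le_trans (ltW (truncnS_gt _))).
  by rewrite ler_nat.
have hr : rho ^+ n <= (expR (n%:R * d))^-1.
  rewrite -expRN -mulrN expRM_natl; apply: lerXn2r; rewrite ?nnegrE ?expR_ge0//.
  by apply: le_trans (expR_ge1Dx _); rewrite /d; lra.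
apply: le_trans hr _; rewrite -[leRHS]invrK lef_pV2 ?posrE ?expR_gt0 ?invr_gt0//.
by apply: le_trans h _; apply: le_trans (expR_ge1Dx _); lra.
Qed.

Lemma mass_sub_le (J : finType) (S S' : {set {ffun J -> bool}}) :
  S \subset S' -> mass a b S <= mass a b S'.
Proof.
move=> /subsetP h; rewrite /mass [leRHS](bigID (mem S)) /=.
rewrite [X in _ <= X + _](eq_bigl (mem S)); last first.
  by move=> s; rewrite inE; case hs : (s \in S); rewrite ?andbF// h.
by rewrite lerDl sumr_ge0// => s _; exact: weight_ge0.
Qed.

Lemma mass_setU_le (J : finType) (S S' : {set {ffun J -> bool}}) :
  mass a b (S :|: S') <= mass a b S + mass a b S'.
Proof.
rewrite /mass [leLHS](bigID (mem S)) /= lerD//.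
  rewrite (eq_bigl (mem S))// => s; rewrite !inE.
  by case: (s \in S); rewrite ?andbF.
rewrite -/(mass _ _ _) [leRHS](bigID (mem S)) /= -[leLHS]add0r lerD//.
  by apply: sumr_ge0 => s _; exact: weight_ge0.
rewrite (eq_bigl (fun s => (s \in S') && (s \notin S)))// => s; rewrite !inE.
by case: (s \in S); rewrite ?andbF ?andbT.
Qed.

Lemma massC (J : finType) (S : {set {ffun J -> bool}}) : mass a b S + mass a b (~: S) = 1.
Proof.
rewrite -(mass1 hp J) /mass [RHS](bigID (mem S)) /=.
by congr (_ + _); apply: eq_bigl => s; rewrite !inE.
Qed.
End UpperBound.

(** * Approximate preparation of powers of the direct sum *)

Section UpperConversion.
Context {R : realType} {k : nat}.
Local Notation C := (R[i]).
Local Notation vec := (@vec R k).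
Local Notation dens := (@dens R k).
Hypothesis hk : (0 < k)%N.
Variables (T U : 'I_k -> finType) (phi : vec T) (psi : vec U).
Hypothesis (hphi : unitv phi) (hpsi : unitv psi).
Variable (p : R).
Hypothesis (hp : 0 < p < 1).
Let q := 1 - p.
Let a : C := (Num.sqrt p)%:C%C.
Let b : C := (Num.sqrt (1 - p))%:C%C.

Let p_gt0 : 0 < p. Proof. by case/andP: hp. Qed.
Let q_gt0 : 0 < q. Proof. by rewrite subr_gt0; case/andP: hp. Qed.
Let p_le1 : p <= 1. Proof. by case/andP: hp => _ /ltW. Qed.
Let q_le1 : q <= 1. Proof. by rewrite /q lerBlDr lerDl ltW. Qed.

Lemma tpow_tpow (V : 'I_k -> finType) n N (v : vec V) :
  tpow n (tpow N v)
  = push (fun l (h : {ffun 'I_n * 'I_N -> V l}) => [ffun t => [ffun i => h (t, i)]])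
      (gpow ('I_n * 'I_N)%type v).
Proof.
apply: (push_bij_eq (g := fun l (h : {ffun 'I_n -> {ffun 'I_N -> V l}}) =>
  [ffun ti : 'I_n * 'I_N => h ti.1 ti.2])).
- by move=> l h; apply/ffunP => -[t i]; rewrite !ffunE.
- by move=> l h; apply/ffunP => t; apply/ffunP => i; rewrite !ffunE.
- move=> i; rewrite /gpow /tpow pair_big /=; apply: eq_bigr => -[t j] _ /=.
  by congr (v _); apply/ffunP => l; rewrite !ffunE.
Qed.

(** The [n] blocks are regrouped by kind, which merges all copies of GHZ into a single state with
    [2 ^ (n na)] labels. *)
Lemma reach_tpow_tens n na nb nc :
  reach (tpow n (tens (tpow na GHZ) (tens (tpow nb phi) (tpow nc psi))))
    (tens (ghz {ffun 'I_n -> {ffun 'I_na -> 'I_2}})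
      (tens (gpow ('I_n * 'I_nb)%type phi) (gpow ('I_n * 'I_nc)%type psi))).
Proof.
have h2 : (0 < #|'I_2|)%N by rewrite card_ord.
have h2' : (0 < #|{ffun 'I_na -> 'I_2}|)%N by rewrite card_ffun expn_gt0 h2.
rewrite -(gpow_ghz hk 'I_n h2') -(gpow_ghz hk 'I_na h2) -(GHZ_ghz hk).
pose X l : finType := ({ffun 'I_na -> 'I_2} * ({ffun 'I_nb -> T l} * {ffun 'I_nc -> U l}))%type.
pose Y l : finType := ({ffun 'I_n -> {ffun 'I_na -> 'I_2}} *
  ({ffun 'I_n * 'I_nb -> T l} * {ffun 'I_n * 'I_nc -> U l}))%type.
pose f l (h : {ffun 'I_n -> X l}) : Y l :=
  ([ffun t => (h t).1], ([ffun ti : 'I_n * 'I_nb => (h ti.1).2.1 ti.2],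
                         [ffun ti : 'I_n * 'I_nc => (h ti.1).2.2 ti.2])).
pose g l (y : Y l) : {ffun 'I_n -> X l} :=
  [ffun t => (y.1 t, ([ffun i => y.2.1 (t, i)], [ffun i => y.2.2 (t, i)]))].
have fg l : cancel (f l) (g l).
  move=> h; apply/ffunP => t; rewrite !ffunE; case e : (h t) => [x [y z]] /=.
  by congr (_, (_, _)); apply/ffunP => i; rewrite !ffunE e.
have gf l : cancel (g l) (f l).
  move=> [x [y z]]; congr (_, (_, _)); apply/ffunP; first by move=> t; rewrite !ffunE.
    by move=> [t i]; rewrite !ffunE.
  by move=> [t i]; rewrite !ffunE.
rewrite (_ : tens (gpow _ _) _ = push f (tpow n (tens (tpow na GHZ) (tens (tpow nb phi) (tpow nc psi))))).
  by apply: reach_push => // l; exact: can_inj (fg l).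
apply: (push_bij_eq fg gf) => i.
rewrite /tpow /tens /gpow !big_split /=; congr (_ * (_ * _)).
- apply: eq_bigr => t _; apply: eq_bigr => j _; congr (GHZ _).
  by apply/ffunP => l; rewrite !ffunE.
- rewrite pair_big /=; apply: eq_bigr => -[t j] _ /=; congr (phi _).
  by apply/ffunP => l; rewrite !ffunE.
- rewrite pair_big /=; apply: eq_bigr => -[t j] _ /=; congr (psi _).
  by apply/ffunP => l; rewrite !ffunE.
Qed.

(** A one-sided typicality: just enough true and false positions to place all available copies. *)
Definition typical n N nb nc : {set {ffun 'I_n * 'I_N -> bool}} :=
  [set s : {ffun 'I_n * 'I_N -> bool} | (n * nb <= #|[set t | s t]|)%N && (n * nc <= #|[set t | ~~ s t]|)%N].

(** The lower bound on one count is an upper bound on the other, so each typical pattern weighs at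
    least the displayed power, while the total mass is one. *)
Lemma card_typical n N nb nc :
  #|typical n N nb nc|%:R * (p ^+ (N - nc) * q ^+ (N - nb)) ^+ n <= 1 :> R.
Proof.
rewrite -[leRHS](mass1 hp ('I_n * 'I_N)%type).
apply: le_trans (mass_sub_le p (subsetT (typical n N nb nc))).
rewrite /mass mulr_natl -sumr_const; apply: ler_sum => s.
rewrite inE => /andP[h1 h2]; rewrite (weightE hp).
have hc := card_falses s; have hm : (#|[set t | s t]| <= n * N)%N.
  by rewrite -[X in (_ <= X)%N](_ : #|{: 'I_n * 'I_N}| = _) ?max_card// card_prod !card_ord.
move: hc; rewrite card_prod !card_ord => hc.
have hp0 := ltW p_gt0; have hq0 := ltW q_gt0.
rewrite exprMn -!exprM; apply: ler_pM; rewrite ?exprn_ge0//; apply: ler_wiXn2l => //;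
  rewrite mulnBl ![(_ * n)%N]mulnC; move: h1 h2 hm; rewrite hc;
  move: (n * nb)%N (n * nc)%N (n * N)%N #|[set t | s t]| => x y z t; lia.
Qed.

Lemma mass_typical N nb nc : nb%:R < N%:R * p -> nc%:R < N%:R * q ->
  forall eps : R, 0 < eps -> exists n0 : nat, forall n, (n0 <= n)%N ->
    1 - eps <= mass a b (typical n N nb nc).
Proof.
move=> hb hc eps he.
have [|r1 [h10 h11 h1]] := @chernoff R p hp N nb true; first by rewrite (wt_true hp).
have [|r2 [h20 h21 h2]] := @chernoff R p hp N nc false; first by rewrite (wt_false hp).
have he2 : 0 < eps / 2 by rewrite divr_gt0.
have [n1 hn1] := geometric_small h10 h11 he2.
have [n2 hn2] := geometric_small h20 h21 he2.
exists (maxn n1 n2) => n; rewrite geq_max => /andP[hna hnb].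
have := massC hp (typical n N nb nc).
move: h1 h2 => /(_ n) h1 /(_ n) h2.
have hsub : mass a b (~: typical n N nb nc) <= r1 ^+ n + r2 ^+ n.
  apply: le_trans (lerD h1 h2).
  apply: le_trans (mass_setU_le p _ _); apply: (mass_sub_le p).
  apply/subsetP => s; rewrite !inE negb_and -!ltnNge => /orP[h|h]; apply/orP.
    by left; rewrite (eq_card (B := [set t | s t]))// => t; rewrite !inE eqb_id.
  by right; rewrite (eq_card (B := [set t | ~~ s t]))// => t; rewrite !inE eqbF_neg.
have := hn1 n hna; have := hn2 n hnb.
move: hsub; rewrite -/a -/b; lra.
Qed.

(* The [N - nb - nc] positions not covered by a copy of [phi] or [psi] are filled
   from the GHZ state, at the price of the full dimension for each of them. *)
Lemma asym_ge_dsum_pow N na nb nc : (nb + nc <= N)%N ->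
  nb%:R < N%:R * p -> nc%:R < N%:R * q ->
  (#|idx (sumT T U)| ^ (N - nb - nc))%:R <= 2 ^+ na * (p ^+ (N - nc) * q ^+ (N - nb)) ->
  asym_ge (tens (tpow na GHZ) (tens (tpow nb phi) (tpow nc psi)))
    (tpow N (dsum a b phi psi)).
Proof.
move=> hN hb hc hcard eps he.
(* The square converts infidelity into purified distance; the bound [1 / 2] keeps the mass positive,
   so that normalization is possible. *)
pose eps' := Num.min (eps ^+ 2) (1 / 2).
have he' : 0 < eps' by rewrite lt_min exprn_gt0//= divr_gt0.
have [n0 hn0] := mass_typical hb hc he'.
exists n0 => n hn; have {hn hn0} hmass := hn0 n hn.
set S := typical n N nb nc in hmass.
have hm0 : 0 < mass a b S.
  apply: lt_le_trans hmass; rewrite subr_gt0 gt_min; apply/orP; right; lra.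
have [||| sg [ta [h1 h2 h3 h4]]] := @sorting_exists ('I_n * 'I_N)%type ('I_n * 'I_nb)%type
    ('I_n * 'I_(N - nb - nc))%type ('I_n * 'I_nc)%type S.
- rewrite !card_prod !card_ord; nia.
- by move=> s; rewrite inE card_prod !card_ord => /andP[].
- by move=> s; rewrite inE card_prod !card_ord => /andP[].
set r := ((Num.sqrt (mass a b S))^-1)%:C%C.
have hr : reach (tpow n (tens (tpow na GHZ) (tens (tpow nb phi) (tpow nc psi))))
    (push (fun l (h : {ffun 'I_n * 'I_N -> sumT T U l}) => [ffun t => [ffun i => h (t, i)]])
       (scl r (chi a b phi psi S))).
  apply: (reach_trans (reach_tpow_tens n na nb nc)).
  apply: (reach_trans (psi := scl r (chi a b phi psi S))); last first.
    apply: reach_push => // l x y /ffunP h; apply/ffunP => -[t i].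
    by move: (h t) => /ffunP /(_ i); rewrite !ffunE.
  apply: (reach_chi hk hphi hpsi h1 h2 h3 h4 hm0).
  rewrite -(ler_nat R) natrM card_idx_ffun card_prod !card_ord [(n * _)%N]mulnC expnM.
  have hcT := card_typical n N nb nc; rewrite -/S in hcT.
  rewrite !card_ffun !card_ord natrX [leRHS]natrX [(2 ^ na)%:R]natrX.
  set W := p ^+ (N - nc) * q ^+ (N - nb) in hcT hcard.
  have hW : 0 <= W by rewrite mulr_ge0 ?exprn_ge0 ?ltW.
  apply: (@le_trans _ _ (#|S|%:R * (2 ^+ na * W) ^+ n)).
    have hp0 := ltW p_gt0; have hq0 := ltW q_gt0.
    by apply: ler_wpM2l => //; apply: lerXn2r; rewrite ?nnegrE ?mulr_ge0 ?exprn_ge0.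
  rewrite exprMn mulrCA -[leRHS]mulr1; apply: ler_wpM2l => //.
  by rewrite !exprn_ge0.
case: hr => Lam [hL eL]; exists Lam; split=> //.
rewrite eL tpow_tpow /pdist fid2_proj ip_push; last first.
  move=> l x y /ffunP h; apply/ffunP => -[t i].
  by move: (h t) => /ffunP /(_ i); rewrite !ffunE.
(* The squared overlap of the normalized typical part with the full power is its mass. *)
have -> : csq (\sum_i conjc (gpow ('I_n * 'I_N)%type (dsum a b phi psi) i)
    * scl r (chi a b phi psi S) i) = mass a b S.
  rewrite -chi_setT (eq_bigr (fun i => r * (conjc (chi a b phi psi setT i)
    * chi a b phi psi S i))); last by move=> i _; rewrite /scl mulrCA.
  rewrite -mulr_sumr chi_ip// setTI csqM !csq_real exprVn sqr_sqrtr ?ltW//.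
  by rewrite expr2 mulKf// gt_eqF.
apply: (@le_trans _ _ (Num.sqrt (eps ^+ 2))); last first.
  by rewrite sqrtr_sqr ger0_norm// ltW.
apply: ler_wsqrtr; have : eps' <= eps ^+ 2 by rewrite ge_min lexx.
lra.
Qed.
End UpperConversion.

(** * From asymptotic monotonicity to the direct-sum formula *)

Section DirectSumFormula.
Context {R : realType} {k : nat}.
Local Notation C := (R[i]).
Local Notation vec := (@vec R k).
Local Notation dens := (@dens R k).
Hypothesis hk : (0 < k)%N.
Variable E : forall T : 'I_k -> finType, dens T -> R.
Hypothesis Eadd : fully_additive E.
Hypothesis Emon : monotone_on_average E.
Hypothesis Eghz : Ep E GHZ = 1.

Lemma unitv_dsum T U (phi : vec T) (psi : vec U) (p : R) : 0 <= p <= 1 ->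
  unitv phi -> unitv psi ->
  unitv (dsum (Num.sqrt p)%:C%C (Num.sqrt (1 - p))%:C%C phi psi).
Proof.
move=> /andP[h0 h1] hphi hpsi; apply/unitvP.
have := nrm_chi hk (Num.sqrt p)%:C%C (Num.sqrt (1 - p))%:C%C hphi hpsi
  [set: {ffun 'I_1 -> bool}].
rewrite mass_setT chi_setT nrm_gpow card_ord !expr1 !csq_real !sqr_sqrtr ?subr_ge0//.
by move=> ->; ring.
Qed.

Lemma log2_ge0 (n : nat) : 0 <= log2 (n%:R : R).
Proof.
case: n => [|n]; first by rewrite /log2 ln0// mul0r.
by rewrite /log2 divr_ge0 ?ln_ge0 ?ler1n// ler1n.
Qed.

Lemma E_dsum_le T U (phi : vec T) (psi : vec U) (p : R) : in_Fpure E ->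
  unitv phi -> unitv psi -> 0 < p < 1 ->
  Ep E (dsum (Num.sqrt p)%:C%C (Num.sqrt (1 - p))%:C%C phi psi)
    <= p * Ep E phi + (1 - p) * Ep E psi + hbin p.
Proof.
move=> [_ _ hF] hphi hpsi hp; have [p0 p1] := andP hp.
set q := 1 - p; have q0 : 0 < q by rewrite subr_gt0.
set chi1 := dsum _ _ _ _; set x := Ep E phi; set y := Ep E psi; set z := Ep E chi1.
have hchi1 : unitv chi1 by apply: unitv_dsum => //; rewrite (ltW p0) (ltW p1).
have hx : 0 <= x by apply: (E_ge0 hk Eadd Emon).
have hy : 0 <= y by apply: (E_ge0 hk Eadd Emon).
pose D := #|idx (sumT T U)|.
have hD : (0 < D)%N by apply/card_gt0P; have [i _] := unitv_idx hchi1; exists i.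
(* The total rounding loss, independent of [N]: at most four free positions, two units in each
   exponent of [p] and [q], and one for rounding up the number of GHZ states. *)
pose K := 1 + 4 * log2 D%:R - 2 * log2 p - 2 * log2 q.
pose dl := z - (p * x + q * y + hbin p).
have hlp : log2 p <= 0 by rewrite /log2 pmulr_lle0 ?invr_gt0 ?ln2_gt0//; apply: ln_le0; exact: ltW.
have hlq : log2 q <= 0.
  by rewrite /log2 pmulr_lle0 ?invr_gt0 ?ln2_gt0//; apply: ln_le0; rewrite /q lerBlDr lerDl ltW.
have main (N : nat) : 1 <= N%:R * p -> 1 <= N%:R * q -> N%:R * dl <= K.
  move=> hNp hNq.
  (* One below the integer part, which secures the strict inequality that the tail bound demands for
     each fixed [N]. *)
  have trunc (w : R) : 1 <= w -> exists m : nat, m%:R <= w - 1 /\ w - 2 <= m%:R.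
    move=> hw; have hw0 : 0 <= w by apply: le_trans hw.
    have := truncn_itv hw0; have h1 : (0 < Num.Def.truncn w)%N.
      by rewrite truncn_gt0.
    case: (Num.Def.truncn w) h1 => // m _ /andP[]; rewrite -!natr1 => h2 h3.
    by exists m; split; lra.
  have [nb [hb1 hb2]] := trunc _ hNp; have [nc [hc1 hc2]] := trunc _ hNq.
  have hpq : N%:R * p + N%:R * q = N%:R by rewrite /q; ring.
  have hbc : (nb + nc <= N)%N by rewrite -(ler_nat R) natrD; lra.
  have hnb : (nb <= N)%N := leq_trans (leq_addr _ _) hbc.
  have hnc : (nc <= N)%N := leq_trans (leq_addl _ _) hbc.
  have hX : 0 < (D ^ (N - nb - nc))%:R / (p ^+ (N - nc) * q ^+ (N - nb)).
    by rewrite divr_gt0 ?mulr_gt0 ?exprn_gt0// ltr0n expn_gt0 hD.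
  set X := _ / _ in hX.
  have logX w n : 0 < w -> log2 (w ^+ n) = n%:R * log2 w :> R.
    by move=> hw; rewrite /log2 lnXn// -(mulr_natl (ln _)) mulrA.
  have hL : log2 X = (N - nb - nc)%:R * log2 D%:R - (N - nc)%:R * log2 p - (N - nb)%:R * log2 q.
    rewrite /X [log2 (_ / _)]/log2 ln_div ?posrE ?mulr_gt0 ?exprn_gt0 ?ltr0n ?expn_gt0 ?hD//.
    rewrite mulrBl -!/(log2 _) log2M ?exprn_gt0// natrX !logX ?ltr0n//; ring.
  have hr4 : (N - nb - nc)%:R <= 4 :> R.
    rewrite -subnDA natrB// natrD; lra.
  have hLle : log2 X <= 4 * log2 D%:R - (N%:R * p + 2) * log2 p - (N%:R * q + 2) * log2 q.
    rewrite hL; apply: lerB; first apply: lerB.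
    - by apply: ler_wpM2r => //; exact: log2_ge0.
    - apply: ler_wnM2r => //; rewrite natrB//; lra.
    - apply: ler_wnM2r => //; rewrite natrB//; lra.
  have hL0 : 0 <= log2 X.
    rewrite hL; have h1 : 0 <= (N - nb - nc)%:R * log2 D%:R :> R by rewrite mulr_ge0// log2_ge0.
    have h2 : (N - nc)%:R * log2 p <= 0 by rewrite mulr_ge0_le0.
    have h3 : (N - nb)%:R * log2 q <= 0 by rewrite mulr_ge0_le0.
    lra.
  have [na [hna1 hna2]] : exists na : nat, log2 X < na%:R /\ na%:R <= log2 X + 1.
    exists (Num.Def.truncn (log2 X)).+1; split; first exact: truncnS_gt.
    by rewrite -natr1 lerD2r; have /andP[] := truncn_itv hL0.
  have h2na : X <= 2 ^+ na.
    rewrite -natrX; move: hna1; rewrite -(log2X na) /log2 ltr_pM2r ?invr_gt0 ?ln2_gt0//.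
    by rewrite ltr_ln ?posrE ?ltr0n ?expn_gt0// => /ltW.
  have hb : nb%:R < N%:R * p by apply: (le_lt_trans hb1); rewrite gtrDl ltrN10.
  have hc : nc%:R < N%:R * q by apply: (le_lt_trans hc1); rewrite gtrDl ltrN10.
  have hA : asym_ge (tens (tpow na GHZ) (tens (tpow nb phi) (tpow nc psi))) (tpow N chi1).
    apply: (asym_ge_dsum_pow hk hphi hpsi hp hbc hb hc).
    by rewrite -ler_pdivrMr ?mulr_gt0 ?exprn_gt0.
  have hG : unitv (GHZ : vec _) by rewrite (GHZ_ghz hk); apply: unitv_ghz; rewrite ?card_ord.
  have hu1 := unitv_tpow na hG; have hu2 := unitv_tpow nb hphi.
  have hu3 := unitv_tpow nc hpsi; have hu4 := unitv_tens hu2 hu3.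
  have := hF _ _ _ _ (unitv_tens hu1 hu4) (unitv_tpow N hchi1) hA.
  rewrite !Eadd// !(E_tpow hk Eadd Emon)// Eghz mulr1 -/x -/y -/z => h.
  have h3 : nb%:R * x <= N%:R * p * x by apply: ler_wpM2r => //; exact: ltW.
  have h4 : nc%:R * y <= N%:R * q * y by apply: ler_wpM2r => //; exact: ltW.
  have e : N%:R * dl = N%:R * z - (N%:R * p * x + N%:R * q * y
      - N%:R * p * log2 p - N%:R * q * log2 q).
    rewrite /dl /hbin /xlogx gt_eqF// [1 - p == 0]gt_eqF// -/q; ring.
  rewrite e /K; move: hLle hna2 h h3 h4; rewrite !mulrDl.
  move: (N%:R * p * log2 p) (N%:R * q * log2 q) (N%:R * p * x) (N%:R * q * y) => *.
  lra.
pose N0 := (Num.Def.truncn p^-1 + Num.Def.truncn q^-1 + 2)%N.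
have hN0 N : (N0 <= N)%N -> 1 <= N%:R * p /\ 1 <= N%:R * q.
  move=> hN; have hw (w : R) : 0 < w -> ((Num.Def.truncn w^-1).+1 <= N)%N -> 1 <= N%:R * w.
    move=> w0 h; rewrite -ler_pdivrMr// mul1r; apply: (le_trans (ltW (truncnS_gt _))).
    by rewrite ler_nat.
  rewrite /N0 addn2 in hN.
  by split; apply: hw => //; apply: leq_trans hN; rewrite ltnS leqW ?leq_addr ?leq_addl.
(* Multiples too small for the asymptotic estimate are covered by the crude second term of the
   maximum. *)
rewrite -subr_le0 -/dl; apply: (@le0_of_bounded_multiples R _ (Num.max K (N0%:R * `|dl|))) => M.
rewrite le_max; case: (leqP N0 M) => [/hN0[h1 h2]|h].
  by rewrite main.
apply/orP; right; apply: (le_trans (y := M%:R * `|dl|)).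
  by apply: ler_wpM2l => //; exact: ler_norm.
by apply: ler_wpM2r => //; rewrite ler_nat ltnW.
Qed.

Lemma hbin0 : hbin (0 : R) = 0.
Proof. by rewrite /hbin /xlogx eqxx subr0 oner_eq0 /log2 ln1 mul0r mulr0 subr0 oppr0. Qed.

Lemma hbin1 : hbin (1 : R) = 0.
Proof. by rewrite /hbin /xlogx subrr eqxx oner_eq0 /log2 ln1 mul0r mulr0 subr0 oppr0. Qed.

Lemma cond_sum_of_in_Fpure : in_Fpure E -> cond_sum E.
Proof.
move=> hF T U phi psi p hphi hpsi /andP[p0 p1].
(* At the endpoints the direct sum is a single embedded summand, and [E_push] replaces the
   estimates, which assume [0 < p < 1]. *)
have [->|pn0] := eqVneq p 0.
  rewrite hbin0 mul0r subr0 mul1r add0r addr0.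
  rewrite sqrtr0 sqrtr1 -(@E_push R k hk E Emon U (sumT T U) (fun l => inr) psi _ hpsi); last by move=> l u v [].
  congr (Ep E _); apply: funext => i; rewrite /dsum rmorph0 rmorph1 mul0r add0r mul1r.
  by [].
have [->|pn1] := eqVneq p 1.
  rewrite hbin1 mul1r subrr mul0r !addr0.
  rewrite sqrtr0 sqrtr1 -(@E_push R k hk E Emon T (sumT T U) (fun l => inl) phi _ hphi); last by move=> l u v [].
  congr (Ep E _); apply: funext => i; rewrite /dsum rmorph0 rmorph1 mul0r addr0 mul1r.
  by [].
have hp : 0 < p < 1 by rewrite !lt_neqAle eq_sym pn0 p0 pn1 p1.
apply: le_anti; apply/andP; split; first exact: E_dsum_le.
exact: (E_dsum_ge hk Eadd Emon Eghz hphi hpsi hp).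
Qed.
End DirectSumFormula.

(** * Continuity *)

Section Continuity.
Context {R : realType} {k : nat}.
Local Notation C := (R[i]).
Local Notation vec := (@vec R k).
Local Notation dens := (@dens R k).
Local Notation LOCC := (@LOCC R k _ _).
Implicit Types T U W : 'I_k -> finType.
Hypothesis hk : (0 < k)%N.
Variable E : forall T : 'I_k -> finType, dens T -> R.
Hypothesis Eadd : fully_additive E.
Hypothesis Emon : monotone_on_average E.

Lemma fid2_sum T (X : finType) (c : X -> R) (rho : X -> dens T) (psi : vec T) :
  fid2 (fun i i' => \sum_x (c x)%:C%C * rho x i i') psi = \sum_x c x * fid2 (rho x) psi.
Proof.
rewrite /fid2.
have -> : \sum_i \sum_i' conjc (psi i) * (\sum_x (c x)%:C%C * rho x i i') * psi i'
  = \sum_x (c x)%:C%C * \sum_i \sum_i' conjc (psi i) * rho x i i' * psi i'.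
  under [RHS]eq_bigr => x _ do rewrite mulr_sumr.
  rewrite [RHS]exchange_big; apply: eq_bigr => i _ /=.
  under [RHS]eq_bigr => x _ do rewrite mulr_sumr.
  rewrite [RHS]exchange_big; apply: eq_bigr => i' _ /=.
  rewrite mulr_sumr mulr_suml; apply: eq_bigr => x _; ring.
have hRe (c0 : R) (z : C) : complex.Re (c0%:C%C * z) = c0 * complex.Re z.
  by case: z => u v /=; rewrite mul0r subr0.
have hsum (F : X -> C) : complex.Re (\sum_x F x) = \sum_x complex.Re (F x).
  by apply: (big_morph (@complex.Re R)) => // -[? ?] [? ?].
by rewrite hsum; apply: eq_bigr => x _; rewrite hRe.
Qed.

Lemma unit_vector_exists T (i0 : idx T) : exists u : vec T, unitv u.
Proof.
exists (fun i => (i == i0)%:R); apply/unitvP; rewrite /nrm (bigD1 i0)//= eqxx csq1.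
by rewrite big1 ?addr0// => i /negbTE ->; exact: csq0.
Qed.

(* An affine lower bound in the fidelity survives LOCC because the ensemble
   decomposition of the output is linear, and so are trace and fidelity. *)
Lemma LOCC_fidelity_bound T W (Lam : dens T -> dens W) : LOCC Lam ->
  forall (psi : vec W) (al be : R),
  (forall v, unitv v -> al + be * fid2 (proj v) psi <= Ep E v) ->
  forall phi : vec T, unitv phi -> al + be * fid2 (Lam (proj phi)) psi <= Ep E phi.
Proof.
elim=> {T W Lam} [T|T U W j X M A L hA hTP hL IH] psi al be h phi hphi; first exact: h.
have [i0 _] := unitv_idx hphi.
have [o0 _] : {o0 : idx U | true}.
  case: (pickP (@predT (idx U))) => [o _|hn]; first by exists o.
  exfalso; move: (hTP i0 i0); rewrite eqxx big1 => [/esym/eqP|x _].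
    by rewrite oner_eq0.
  by rewrite big1// => m _; rewrite big_pred0.
have [u0 hu0] := unit_vector_exists o0.
(* The discarded index [m] is treated as a further outcome, so that every branch stays pure and has
   a value under [E]; the channel forgets [m] only through the linearity of [L x]. *)
pose B (xm : X * M) := prodop (A xm.1 xm.2).
have hB : impl B.
  apply: (@impl_round R k _ _ _ j (fun xm : X * M => A xm.1 xm.2)).
    by move=> x x' l; exact: hA.
  move=> i i1; rewrite -hTP pair_big /=; apply: eq_bigr => xm _.
  by rewrite prodop_gram.
have hn xm : exists cv : C * vec U, unitv cv.2 /\ app (B xm) phi = scl cv.1 cv.2.
  by have [c [v [h1 h2 _]]] := normalize (app (B xm) phi) hu0; exists (c, v).
have [cv hcv] := boolp.choice hn.
have havg := E_avg hk Emon hB hphi (fun x => (hcv x).1) (fun x => (hcv x).2).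
apply: le_trans havg.
have hc1 : \sum_xm csq (cv xm).1 = 1.
  have := LOCC_trace (hB _ _ (fun _ => @LOCC_id R k U)) (proj phi).
  move=> ht; apply: (@complexI R); rewrite rmorph_sum rmorph1.
  transitivity (\sum_i proj phi i i); last first.
    by rewrite -hphi; apply: eq_bigr => i _; rewrite mulrC.
  rewrite -ht exchange_big; apply: eq_bigr => xm _ /=.
  rewrite kraus_proj (hcv xm).2 proj_scl -mulr_sumr.
  have -> : \sum_o proj (cv xm).2 o o = 1.
    by rewrite -(hcv xm).1; apply: eq_bigr => o _; rewrite mulrC.
  by rewrite mulr1.
have -> : (fun o o' => \sum_x L x (fun i i' => \sum_m kraus_apply (prodop (A x m)) (proj phi) i i') o o')
  = (fun o o' => \sum_(xm : X * M) (csq (cv xm).1)%:C%C * L xm.1 (proj (cv xm).2) o o').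
  apply: funext => o; apply: funext => o'.
  transitivity (\sum_x \sum_m (csq (cv (x, m)).1)%:C%C * L x (proj (cv (x, m)).2) o o');
    last by rewrite pair_big; apply: eq_bigr => -[x m].
  apply: eq_bigr => x _.
  rewrite -(congr1 (fun f => f o o') (LOCC_linear (hL x)
    (fun m => (csq (cv (x, m)).1)%:C%C) (fun m => proj (cv (x, m)).2))).
  congr (L x _ o o'); apply: funext => i; apply: funext => i'.
  apply: eq_bigr => m _; rewrite kraus_proj.
  by have := (hcv (x, m)).2; rewrite /B /= => ->; rewrite proj_scl.
rewrite fid2_sum mulr_sumr -[al]mulr1 -hc1 mulr_sumr -big_split.
apply: ler_sum => xm _ /=; rewrite mulrCA [al * _]mulrC -mulrDr.
by apply: ler_wpM2l; [exact: csq_ge0 | apply: IH; [exact: h | exact: (hcv xm).1]].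
Qed.

Lemma card_idx T : #|idx T| = (\prod_l #|T l|)%N.
Proof.
have h := @prod_sum_dffun nat _ T (fun _ _ => 1%N).
transitivity (\sum_(i : idx T) \prod_(l : 'I_k) 1)%N.
  by rewrite -sum1_card; apply: eq_bigr => i _; rewrite big1.
by rewrite -[LHS]h; apply: eq_bigr => l _; rewrite -sum1_card.
Qed.

(** [asym_continuous] speaks of the bases ['I_d] only; enumerating the local bases preserves values,
    distances and dimension. *)
Lemma E_uniform (eps eta : R) : 
  (forall (d : 'I_k -> nat) (phi psi : vec (cdims d)),
      unitv phi -> unitv psi -> pdist (proj phi) psi < eta ->
      `|Enorm E phi - Enorm E psi| < eps) ->
  forall T (phi psi : vec T), unitv phi -> unitv psi -> pdist (proj phi) psi < eta ->
  `|Ep E phi - Ep E psi| <= eps * (1 + log2 #|idx T|%:R).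
Proof.
move=> h T phi psi hphi hpsi hd.
pose f l (x : T l) : 'I_#|T l| := enum_rank x.
have hf l : injective (f l) by exact: enum_rank_inj.
have h1 := unitv_push hf hphi; have h2 := unitv_push hf hpsi.
have := h _ (push f phi : vec (cdims (fun l => #|T l|))) (push f psi) h1 h2.
have hL : 0 < 1 + log2 #|idx T|%:R :> R by have := @log2_ge0 R #|idx T|; lra.
have -> : pdist (proj (push f phi : vec (cdims (fun l => #|T l|)))) (push f psi)
    = pdist (proj phi) psi.
  by rewrite /pdist !fid2_proj ip_push.
move=> /(_ hd); rewrite /Enorm !(E_push hk Emon hf)//.
have -> : #|idx (cdims (fun l => #|T l|))| = #|idx T|.
  by rewrite !card_idx; apply: eq_bigr => l _; rewrite card_ord.
have hLi : 0 < (1 + log2 #|idx T|%:R : R)^-1 by rewrite invr_gt0.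
rewrite -mulrBl normrM (gtr0_norm hLi) ltr_pdivrMr//.
exact: ltW.
Qed.

(** Cauchy-Schwarz: [1 - csq g] is the squared norm of the part of [phi] orthogonal to [psi]. *)
Lemma fid2_le1 T (phi psi : vec T) : unitv phi -> unitv psi -> fid2 (proj phi) psi <= 1.
Proof.
move=> hphi hpsi; rewrite fid2_proj; set g := \sum_i _.
have : 0 <= nrm (fun i => phi i - g * psi i) by exact: nrm_ge0.
suff -> : nrm (fun i => phi i - g * psi i) = 1 - csq g by rewrite subr_ge0.
apply: (@complexI R); rewrite nrmE [RHS](rmorphB (real_complex R)) rmorph1 /= [X in _ = 1 - X]csqE.
transitivity (\sum_i (conjc (phi i) * phi i - g * (conjc (phi i) * psi i)
   - conjc g * (conjc (psi i) * phi i) + conjc g * g * (conjc (psi i) * psi i))).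
  by apply: eq_bigr => i _; rewrite rmorphB rmorphM /=; ring.
rewrite big_split /= !sumrB -!mulr_sumr -/g hphi hpsi.
have -> : \sum_i conjc (phi i) * psi i = conjc g.
  by rewrite rmorph_sum; apply: eq_bigr => i _; rewrite rmorphM /= conjcK mulrC.
ring.
Qed.

Lemma in_Fpure_of_asym_continuous : Ep E GHZ = 1 -> asym_continuous E -> in_Fpure E.
Proof.
move=> Eghz hc; split => // T U phi psi hphi hpsi hge.
set x := Ep E phi; set y := Ep E psi; set D := log2 (#|idx U|%:R : R).
have hx : 0 <= x by apply: (E_ge0 hk Eadd Emon).
have hy : 0 <= y by apply: (E_ge0 hk Eadd Emon).
have hD : 0 <= D by exact: log2_ge0.
(* A single large [n] suffices: every error is at most [e n] times a quantity that does not depend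
   on [n], and division by [n] leaves a bound in which [e] is free. *)
have key (e : R) : 0 < e -> e < 1 -> y - x <= e * (D + 1 + y).
  move=> he0 he1; have [eta [heta [hunif _]]] := hc e he0.
  (* The affine bound has slope [B / eta^2], so an infidelity of at most [(eta e)^2] costs no more
     than [B e^2]. *)
  have [|N hN] := hge (eta * e); first by rewrite mulr_gt0.
  pose n := N.+1; have [Lam [hLam hdist]] := hN n (leqnSn N).
  have hn : 0 < n%:R :> R by rewrite ltr0n.
  have hpn := unitv_tpow n hpsi; have hfn := unitv_tpow n hphi.
  have hlog : log2 (#|idx (fun l => {ffun 'I_n -> U l} : finType)|%:R : R) = n%:R * D.
    rewrite card_idx_ffun card_ord log2_natX//.
    by apply/card_gt0P; have [i _] := unitv_idx hpsi; exists i.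
  pose B := n%:R * y - e * (1 + n%:R * D).
  have hEn : Ep E (tpow n psi) = n%:R * y by rewrite (E_tpow hk Eadd Emon).
  have hEx : Ep E (tpow n phi) = n%:R * x by rewrite (E_tpow hk Eadd Emon).
  have hgood v : unitv v -> pdist (proj v) (tpow n psi) < eta -> B <= Ep E v.
    move=> hv hd; have := E_uniform hunif hv hpn hd; rewrite hEn hlog ler_norml => /andP[h1 _].
    by rewrite /B; lra.
  have hny : 0 <= n%:R * y by rewrite mulr_ge0.
  have hnx : 0 <= n%:R * x by rewrite mulr_ge0.
  have hB : B <= n%:R * y.
    rewrite /B gerBl; apply: mulr_ge0; first exact: ltW.
    by apply: addr_ge0 => //; apply: mulr_ge0.
  have hmain : B - e ^+ 2 * (n%:R * y) <= n%:R * x.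
    have [hB0|hB0] := leP B 0.
      by apply: le_trans hnx; rewrite subr_le0; apply: le_trans hB0 _; rewrite mulr_ge0 ?sqr_ge0.
    (* the affine bound is [0] at fidelity [1 - eta^2] and [B] at fidelity [1] *)
    have heta2 : 0 < eta ^+ 2 by rewrite exprn_gt0.
    have := @LOCC_fidelity_bound _ _ Lam hLam (tpow n psi) (B - B / eta ^+ 2) (B / eta ^+ 2) _
      (tpow n phi) hfn.
    rewrite hEx => hl; apply: le_trans (hl _); last first.
      move=> v hv; have hf1 := fid2_le1 hv hpn.
      have [hd|hd] := ltP (pdist (proj v) (tpow n psi)) eta.
        apply: le_trans (hgood v hv hd).
        rewrite -addrA gerDl addrC subr_le0 -[leRHS]mulr1; apply: ler_wpM2l => //.
        by rewrite divr_ge0 ?ltW.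
      apply: le_trans (E_ge0 hk Eadd Emon hv).
      have hd2 : eta ^+ 2 <= 1 - fid2 (proj v) (tpow n psi).
        rewrite -[leRHS]sqr_sqrtr ?subr_ge0//.
        by apply: lerXn2r; rewrite ?nnegrE ?sqrtr_ge0// ltW.
      have -> : B - B / eta ^+ 2 + B / eta ^+ 2 * fid2 (proj v) (tpow n psi)
        = B / eta ^+ 2 * (eta ^+ 2 - (1 - fid2 (proj v) (tpow n psi))).
        by field; rewrite gt_eqF.
      by apply: mulr_ge0_le0; [apply: divr_ge0; exact: ltW | rewrite subr_le0].
    move: hdist; rewrite /pdist; set F := fid2 _ _ => hdist.
    have hF : 1 - F <= (eta * e) ^+ 2.
      have [hF1|hF1] := leP 0 (1 - F).
        rewrite -[leLHS]sqr_sqrtr//; apply: lerXn2r; rewrite ?nnegrE ?sqrtr_ge0//.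
        by rewrite mulr_ge0 ?ltW.
      by apply: (le_trans (ltW hF1)); exact: sqr_ge0.
    have -> : B - B / eta ^+ 2 + B / eta ^+ 2 * F = B - B * ((1 - F) / eta ^+ 2).
      by field; rewrite gt_eqF.
    rewrite lerD2l lerN2; apply: (@le_trans _ _ (B * e ^+ 2)).
      apply: ler_wpM2l; first exact: ltW.
      by rewrite ler_pdivrMr// mulrC -exprMn.
    by rewrite mulrC; apply: ler_wpM2l => //; exact: sqr_ge0.
  have h1n : 1 <= n%:R :> R by rewrite ler1n.
  have he2 : e ^+ 2 <= e by rewrite expr2 ger_pMl// ltW.
  have h2 : e ^+ 2 * (n%:R * y) <= e * (n%:R * y) by apply: ler_wpM2r.
  have h3 : e <= e * n%:R by rewrite ler_peMr// ltW.
  rewrite -(ler_pM2l hn) mulrBr; move: hmain; rewrite /B => h4.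
  have -> : n%:R * (e * (D + 1 + y)) = e * (n%:R * D) + e * n%:R + e * (n%:R * y) by ring.
  move: h4; rewrite mulrDr mulr1.
  move: (n%:R * y) (n%:R * x) (e * (n%:R * D)) (e * n%:R) h2 h3 => u v w t.
  move: (e ^+ 2 * u) (e * u) => u1 u2 *; lra.
rewrite -subr_le0 leNgt; apply/negP => hyx.
pose c := D + 1 + y; have hc0 : 0 < c by rewrite /c; lra.
pose e := Num.min (1 / 2) ((y - x) / (2 * c)).
have he0 : 0 < e by rewrite lt_min divr_gt0//= divr_gt0// mulr_gt0.
have he1 : e < 1 by rewrite gt_min; apply/orP; left; lra.
have := key e he0 he1; rewrite -/c => h.
have : e * c <= (y - x) / 2.
  have : e <= (y - x) / (2 * c) by rewrite ge_min lexx orbT.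
  rewrite -(ler_pM2r hc0) => h2; apply: le_trans h2 _.
  by rewrite le_eqVlt; apply/orP; left; apply/eqP; field; rewrite gt_eqF.
lra.
Qed.
End Continuity.

(** * Continuity bounds from the direct-sum formula *)

Section Bounds.
Context {R : realType} {k : nat}.
Local Notation C := (R[i]).
Local Notation vec := (@vec R k).
Local Notation dens := (@dens R k).
Implicit Types T U W : 'I_k -> finType.
Hypothesis hk : (0 < k)%N.
Variable E : forall T : 'I_k -> finType, dens T -> R.
Hypothesis Eadd : fully_additive E.
Hypothesis Emon : monotone_on_average E.
Hypothesis Eghz : Ep E GHZ = 1.

(* Each party measures the direct-sum label in the basis
   [(sqrt p, sqrt (1-p)), (- sqrt (1-p), sqrt p)]; keeping only the outcome
   where everybody finds the first vector merges the two summands. *)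
Lemma merge_bound T (psi chi phi : vec T) (p : R) (g : C) :
  unitv psi -> unitv chi -> unitv phi -> 0 <= p <= 1 ->
  (forall i, (Num.sqrt p ^+ k.+1)%:C%C * psi i + (Num.sqrt (1 - p) ^+ k.+1)%:C%C * chi i
             = g * phi i) ->
  csq g * Ep E phi
    <= Ep E (dsum (Num.sqrt p)%:C%C (Num.sqrt (1 - p))%:C%C psi chi).
Proof.
move=> hpsi hchi hphi hp hg; have /andP[p0 p1] := hp.
have hO := unitv_dsum hk hp hpsi hchi.
set Om := dsum _ _ _ _ in hO *.
have [i0 _] := unitv_idx hphi.
pose al : C := (Num.sqrt p)%:C%C; pose be : C := (Num.sqrt (1 - p))%:C%C.
have hal : al * al + be * be = 1.
  rewrite -!rmorphM -rmorphD -!expr2 !sqr_sqrtr ?subr_ge0//.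
  by rewrite addrC subrK rmorph1.
pose X (l : 'I_k) : finType := bool.
pose cl (x : bool) : C := if x then al else - be.
pose cr (x : bool) : C := if x then be else al.
pose K l (x : X l) (w : T l) (s : sumT T T l) : C :=
  match s with inl t => cl x * (w == t)%:R | inr t => cr x * (w == t)%:R end.
have halR : conjc al = al by rewrite /al /= oppr0.
have hbeR : conjc be = be by rewrite /be /= oppr0.
have hclR x : conjc (cl x) = cl x by case: x; [exact: halR | rewrite /cl rmorphN; congr (- _); exact: hbeR].
have hcrR x : conjc (cr x) = cr x by case: x; [exact: hbeR | exact: halR].
have hK l s s' : \sum_(x : X l) \sum_o conjc (K l x o s) * K l x o s' = (s == s')%:R.
  have hS (c d : C) (t t' : T l) : conjc c = c ->
      \sum_o conjc (c * (o == t)%:R) * (d * (o == t')%:R) = c * d * (t == t')%:R.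
    move=> hc; rewrite -gram_delta mulr_sumr; apply: eq_bigr => o _.
    have -> : conjc (c * (o == t)%:R) = c * conjc (o == t)%:R by rewrite -[in RHS]hc; exact: rmorphM.
    ring.
  rewrite big_bool; case: s => t; case: s' => t'; rewrite /K !hS// /cl /cr.
  - have -> : (inl t == inl t' :> sumT T T l) = (t == t') by [].
    by rewrite /= -mulrDl mulrNN hal mul1r.
  - by rewrite /= -mulrDl mulNr [be * al]mulrC subrr mul0r.
  - by rewrite /= -mulrDl mulrN [be * al]mulrC subrr mul0r.
  - have -> : (inr t == inr t' :> sumT T T l) = (t == t') by [].
    by rewrite /= -mulrDl addrC hal mul1r.
pose xT : idx X := finfun (fun=> true).
have hI := impl_prod hk hK xT.
have hOm : Om = fun i => al * push (fun l => inl) psi i + be * push (fun l => inr) chi i by [].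
have happ : app (prodop (fun l => K l (xT l))) Om = scl g phi.
  apply: funext => o.
  have hsplit : app (prodop (fun l => K l (xT l))) Om o
    = al * app (prodop (fun l => K l (xT l))) (push (fun l => inl) psi) o
    + be * app (prodop (fun l => K l (xT l))) (push (fun l => inr) chi) o.
    rewrite hOm /app !mulr_sumr -big_split; apply: eq_bigr => i _ /=; ring.
  rewrite hsplit -!app_bop !app_prodopM.
  have hl : app (prodop (mulop (fun l => K l (xT l)) (bop (fun l => inl)))) psi o
      = al ^+ k * psi o.
    rewrite /app (bigD1 o)//= big1 ?addr0.
      congr (_ * _); rewrite /prodop -[in RHS](card_ord k) -prodr_const.
      apply: eq_bigr => l _; rewrite /mulop /bop sum_deltar /K ffunE eqxx mulr1//.
    move=> i hi; suff -> : prodop (mulop (fun l => K l (xT l)) (bop (fun l => inl))) o i = 0.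
      by rewrite mul0r.
    rewrite /prodop (eq_bigr (fun l => cl true * (o l == i l)%:R)).
      by rewrite big_split /= prod_delta eq_sym (negbTE hi) mulr0.
    by move=> l _; rewrite /mulop /bop sum_deltar /K ffunE.
  have hr : app (prodop (mulop (fun l => K l (xT l)) (bop (fun l => inr)))) chi o
      = be ^+ k * chi o.
    rewrite /app (bigD1 o)//= big1 ?addr0.
      congr (_ * _); rewrite /prodop -[in RHS](card_ord k) -prodr_const.
      apply: eq_bigr => l _; rewrite /mulop /bop sum_deltar /K ffunE eqxx mulr1//.
    move=> i hi; suff -> : prodop (mulop (fun l => K l (xT l)) (bop (fun l => inr))) o i = 0.
      by rewrite mul0r.
    rewrite /prodop (eq_bigr (fun l => cr true * (o l == i l)%:R)).
      by rewrite big_split /= prod_delta eq_sym (negbTE hi) mulr0.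
    by move=> l _; rewrite /mulop /bop sum_deltar /K ffunE.
  (* The exponent [k + 1] arises here: one factor for each projecting party and one for the
     amplitude in the direct sum. *)
  rewrite hl hr /scl -hg !rmorphXn -/al -/be !exprS; ring.
have hn x : exists cv : C * vec T, unitv cv.2 /\
    app (prodop (fun l => K l (x l))) Om = scl cv.1 cv.2.
  by have [c [v [h1 h2 _]]] := normalize (app (prodop (fun l => K l (x l))) Om) hphi;
    exists (c, v).
have [cv hcv] := boolp.choice hn.
pose c x := if x == xT then g else (cv x).1.
pose v x := if x == xT then phi else (cv x).2.
have hv x : unitv (v x) by rewrite /v; case: ifP => // _; exact: (hcv x).1.
have := E_avg hk Emon hI hO hv (c := c).
move=> /(_ _) h; apply: le_trans (h _); last first.
  by move=> x; rewrite /c /v; case: eqP => [->//|_]; exact: (hcv x).2.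
rewrite (bigD1 xT)//= {1}/c {1}/v eqxx lerDl; apply: sumr_ge0 => x _.
by apply: mulr_ge0; [exact: csq_ge0 | exact: (E_ge0 hk Eadd Emon)].
Qed.

Lemma hbin_ge0 (p : R) : 0 <= p <= 1 -> 0 <= hbin p.
Proof.
move=> /andP[p0 p1].
have h (x : R) : 0 <= x -> x <= 1 -> xlogx x <= 0.
  move=> x0 x1; rewrite /xlogx; case: eqP => // _; apply: mulr_ge0_le0 => //.
  by rewrite /log2 pmulr_lle0 ?invr_gt0 ?ln2_gt0//; exact: ln_le0.
rewrite /hbin -opprD oppr_ge0 -[leRHS]addr0; apply: lerD; apply: h => //.
  by rewrite subr_ge0.
by rewrite lerBlDr lerDl.
Qed.

Lemma powR_root (delta : R) : 0 <= delta ->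
  powR delta (2 / (k.+1)%:R) ^+ k.+1 = delta ^+ 2.
Proof.
move=> h; rewrite -powR_mulrn ?powR_ge0// -powRrM divfK ?pnatr_eq0//.
by rewrite -[2]/(2%:R) powR_mulrn.
Qed.

Lemma ip_conj T (phi psi : vec T) :
  \sum_i conjc (psi i) * phi i = conjc (\sum_i conjc (phi i) * psi i).
Proof. by rewrite rmorph_sum; apply: eq_bigr => i _; rewrite rmorphM /= conjcK mulrC. Qed.

Lemma csq_conj (z : C) : csq (conjc z) = csq z.
Proof. by rewrite /csq conjcK mulrC. Qed.

Lemma pdist_sym T (phi psi : vec T) : pdist (proj phi) psi = pdist (proj psi) phi.
Proof. by rewrite /pdist !fid2_proj ip_conj csq_conj. Qed.

(** With [g] the overlap, [g phi = psi + delta chi] for a unit vector [chi]. The choice of [p] makes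
    the ratio of the merged amplitudes equal to [delta], the success probability is then [1 / Q],
    and [merge_bound] with the formula for direct sums gives [E phi <= Q (p E psi + (1 - p) E chi +
    h p)]. *)
Lemma E_sub_le T (phi psi : vec T) : cond_sum E -> unitv phi -> unitv psi ->
  let delta := pdist (proj phi) psi in delta < 1 ->
  Ep E phi - Ep E psi <= cont_a (k := k) delta * log2 (#|idx T|)%:R + cont_b (k := k) delta.
Proof.
move=> hsum hphi hpsi delta hd1.
have hd0 : 0 <= delta by exact: sqrtr_ge0.
pose g : C := \sum_i conjc (phi i) * psi i.
have hf : fid2 (proj phi) psi = csq g by rewrite fid2_proj ip_conj csq_conj.
have hdel : delta ^+ 2 = 1 - csq g.
  by rewrite sqr_sqrtr ?subr_ge0 ?fid2_le1// hf.
have hnrm : nrm (fun i => g * phi i - psi i) = delta ^+ 2.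
  rewrite hdel; apply: (@complexI R); rewrite nrmE [RHS](rmorphB (real_complex R)) rmorph1 /= [X in _ = 1 - X]csqE.
  transitivity (\sum_i (conjc (psi i) * psi i - g * (conjc (psi i) * phi i)
     - conjc g * (conjc (phi i) * psi i) + conjc g * g * (conjc (phi i) * phi i))).
    by apply: eq_bigr => i _; rewrite rmorphB rmorphM /=; ring.
  rewrite big_split /= !sumrB -!mulr_sumr -/g hphi hpsi ip_conj -/g.
  ring.
set L := log2 _; have hL : 0 <= L by exact: log2_ge0.
set t := powR delta (2 / (k.+1)%:R).
have ht0 : 0 <= t by exact: powR_ge0.
have ht : t ^+ k.+1 = delta ^+ 2 by exact: powR_root.
have h1t : 0 < 1 + t by rewrite ltr_wpDr.
have hd2 : 0 < 1 - delta ^+ 2 by rewrite subr_gt0 expr_lt1.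
pose p := (1 + t)^-1.
have hp0 : 0 < p by rewrite invr_gt0.
have hp1 : p <= 1 by rewrite invf_le1// lerDl.
have h1p : 1 - p = t * p by rewrite /p; field; rewrite gt_eqF.
have hp01 : 0 <= p <= 1 by rewrite ltW.
pose Q := (1 + t) ^+ k.+1 / (1 - delta ^+ 2).
(* This makes the coefficient [p Q - 1] of [E psi] nonnegative after subtraction, so that [E psi]
   may be replaced by its logarithmic bound. *)
have hQ1 : 1 <= p * Q.
  rewrite /Q exprS !mulrA /p mulVf ?gt_eqF// mul1r.
  rewrite ler_pdivlMr// mul1r; apply: (@le_trans _ _ 1).
    by rewrite gerBl sqr_ge0.
  by rewrite exprn_ege1// lerDl.
have hQ0 : 0 < Q by rewrite divr_gt0// exprn_gt0.
have ea : cont_a (k := k) delta = Q - 1.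
  by rewrite /cont_a -/t /Q; field; rewrite gt_eqF.
have eb : cont_b (k := k) delta = Q * hbin p by [].
have hEpsi := E_ge0 hk Eadd Emon hpsi.
have hpsiL : Ep E psi <= L := E_le_log hk Eadd Emon Eghz hpsi.
rewrite ea eb.
(* For [delta = 0] there is no direction [chi]; the states then agree up to a phase, which [E] does
   not see. *)
have [d0|dn0] := eqVneq delta 0.
  have hz : (fun i => g * phi i - psi i) = fun _ => 0.
    by apply: nrm_eq0; rewrite hnrm d0 expr0n.
  have -> : psi = scl g phi.
    apply: funext => i; have := congr1 (fun f => f i) hz => /eqP.
    by rewrite subr_eq0 => /eqP.
  rewrite E_scl; last by move: hdel; rewrite d0 expr0n /= => h; lra.
  rewrite subrr; apply: addr_ge0; last by apply: mulr_ge0; [exact: ltW | exact: hbin_ge0].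
  apply: mulr_ge0 => //; rewrite subr_ge0; apply: (le_trans hQ1).
  by rewrite ger_pMl.
have hdp : 0 < delta by rewrite lt_neqAle eq_sym dn0.
pose chi : vec T := scl (delta^-1)%:C%C (fun i => g * phi i - psi i).
have hchi : unitv chi.
  by apply/unitvP; rewrite nrm_scl hnrm csq_real exprVn mulVf// expf_neq0.
have hsq : Num.sqrt (1 - p) ^+ k.+1 = delta * Num.sqrt p ^+ k.+1.
  rewrite h1p sqrtrM// exprMn; congr (_ * _).
  by rewrite -sqrtr_exp// ht sqrtr_sqr ger0_norm.
have := @merge_bound T psi chi phi p ((Num.sqrt p ^+ k.+1)%:C%C * g) hpsi hchi hphi hp01.
rewrite (hsum T T psi chi p hpsi hchi hp01) csqM csq_real.
move=> /(_ _) hm; have {hm} := hm _; rewrite hsq => hm.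
have {}hm : (Num.sqrt p ^+ k.+1) ^+ 2 * csq g * Ep E phi
    <= p * Ep E psi + (1 - p) * Ep E chi + hbin p.
  apply: hm => i; rewrite /chi /scl rmorphM.
  have -> : (delta^-1)%:C%C = ((delta%:C)%C)^-1 :> C by rewrite fmorphV.
  by field; rewrite (inj_eq (@complexI R) _ 0).
have eg : (Num.sqrt p ^+ k.+1) ^+ 2 * csq g = Q^-1.
  rewrite -exprM mulnC exprM sqr_sqrtr ?ltW//.
  have -> : csq g = 1 - delta ^+ 2 by rewrite hdel; ring.
  by rewrite /Q /p invf_div exprVn mulrC.
move: hm; rewrite eg mulrC ler_pdivrMr// => hm.
have hchiL : Ep E chi <= L := E_le_log hk Eadd Emon Eghz hchi.
have h1 : (p * Q - 1) * Ep E psi <= (p * Q - 1) * L.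
  by apply: ler_wpM2l => //; rewrite subr_ge0.
have h2 : (1 - p) * Q * Ep E chi <= (1 - p) * Q * L.
  by apply: ler_wpM2l => //; apply: mulr_ge0; [rewrite subr_ge0 | exact: ltW].
have e1 : (p * Ep E psi + (1 - p) * Ep E chi + hbin p) * Q
  = (p * Q - 1) * Ep E psi + Ep E psi + (1 - p) * Q * Ep E chi + Q * hbin p by ring.
have e2 : (Q - 1) * L = (p * Q - 1) * L + (1 - p) * Q * L by ring.
rewrite e2; move: hm; rewrite e1.
move: (Ep E phi) (Q * hbin p) h1 h2 => u w.
move: ((p * Q - 1) * Ep E psi) ((1 - p) * Q * Ep E chi) ((p * Q - 1) * L) ((1 - p) * Q * L).
move: (Ep E psi) => *; lra.
Qed.

Lemma cond_bound_of_cond_sum : cond_sum E -> cond_bound E.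
Proof.
move=> hsum T phi psi hphi hpsi delta hd; rewrite ler_norml; apply/andP; split.
  rewrite lerNl opprB /delta pdist_sym; apply: E_sub_le => //.
  by rewrite pdist_sym.
exact: E_sub_le.
Qed.

End Bounds.

(** * Uniform continuity from the explicit bound *)

Section AsymptoticContinuity.
Context {R : realType} {k : nat}.
Local Notation vec := (@vec R k).
Local Notation dens := (@dens R k).
Variable E : forall T : 'I_k -> finType, dens T -> R.

(** The chord of a convex function on [[0, 1]], which makes [cont_a] linear in [t]. *)
Lemma exp_1D_le (t : R) n : 0 <= t -> t <= 1 -> (1 + t) ^+ n <= 1 + (2 ^+ n - 1) * t.
Proof.
move=> h0 h1; elim: n => [|n IH]; first by rewrite !expr0; lra.
have h2 : 1 <= (2 : R) ^+ n by apply: exprn_ege1; lra.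
rewrite !exprS; apply: (@le_trans _ _ ((1 + t) * (1 + (2 ^+ n - 1) * t))).
  by apply: ler_wpM2l => //; lra.
move: h2; move: (2 ^+ n : R) => w h2.
have h3 : (w - 1) * (t * t) <= (w - 1) * t.
  by apply: ler_wpM2l; [lra | rewrite -[leRHS]mul1r; apply: ler_wpM2r].
have -> : (1 + t) * (1 + (w - 1) * t) = 1 + w * t + (w - 1) * (t * t) by ring.
lra.
Qed.

(** The entropy behaves like [t log (1 / t)] at zero and is not linear in [t]; in [s], with
    [t = s^2], it is, because [- ln s <= 1 / s]. The constant is generous. *)
Lemma hbin_le_sqrt (s : R) : 0 <= s -> s <= 1 ->
  hbin (1 + s ^+ 2)^-1 <= 5 * s / ln 2.
Proof.
move=> s0 s1; have [->|sn0] := eqVneq s 0.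
  by rewrite expr0n addr0 invr1 hbin1 mulr0 mul0r.
have sp : 0 < s by rewrite lt_neqAle eq_sym sn0.
have hs2 : s ^+ 2 <= s by rewrite expr2 ger_pMl.
have h1 : 0 < 1 + s ^+ 2 by rewrite ltr_wpDr ?sqr_ge0.
have h1ge : 1 <= 1 + s ^+ 2 by rewrite lerDl sqr_ge0.
have e1 : 1 - (1 + s ^+ 2)^-1 = s ^+ 2 / (1 + s ^+ 2) by field; rewrite gt_eqF.
have hx : s ^+ 2 / (1 + s ^+ 2) != 0 by rewrite gt_eqF// divr_gt0// exprn_gt0.
rewrite /hbin /xlogx invr_eq0 gt_eqF// e1 (negbTE hx).
rewrite /log2 lnV ?posrE// ln_div ?posrE ?exprn_gt0// lnXn//.
set u := ln (1 + s ^+ 2); set v := ln s.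
have hu : u <= s ^+ 2.
  by rewrite /u; apply: le_ln1Dx; apply: lt_le_trans (sqr_ge0 s); rewrite ltrN10.
have hu0 : 0 <= u by exact: ln_ge0.
have hv : - v <= s^-1.
  rewrite /v -lnV ?posrE//; have hsv : 0 < s^-1 by rewrite invr_gt0.
  have h : -1 < s^-1 - 1 by lra.
  have := le_ln1Dx h; have -> : 1 + (s^-1 - 1) = s^-1 by ring.
  by move=> h2; lra.
have -> : - ((1 + s ^+ 2)^-1 * (- u / ln 2)) - s ^+ 2 / (1 + s ^+ 2) * ((v *+ 2 - u) / ln 2)
  = ((1 + s ^+ 2)^-1 * (u + s ^+ 2 * (u + 2 * - v))) / ln 2.
  by rewrite mulr2n; ring.
rewrite ler_pM2r ?invr_gt0 ?ln2_gt0//.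
have h2 : s ^+ 2 * - v <= s.
  apply: (@le_trans _ _ (s ^+ 2 * s^-1)); first by apply: ler_wpM2l => //; exact: sqr_ge0.
  by rewrite expr2 mulfK.
have h3 : s ^+ 2 * u <= 1 * u by apply: ler_wpM2r => //; apply: le_trans hs2 _.
apply: (@le_trans _ _ (5 * s)); last by [].
rewrite ler_pdivrMl//; apply: (@le_trans _ _ (5 * s)); last first.
  by rewrite -[leLHS]mul1r; apply: ler_wpM2r => //; lra.
have -> : u + s ^+ 2 * (u + 2 * - v) = u + s ^+ 2 * u + 2 * (s ^+ 2 * - v) by ring.
move: (s ^+ 2 * u) (s ^+ 2 * - v) h2 h3 => *; lra.
Qed.

Lemma asym_continuous_of_cond_bound : cond_bound E -> asym_continuous E.
Proof.
move=> hb eps he.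
pose M := k.+1; pose w : R := 2 ^+ M.
have hw : 1 <= w by apply: exprn_ege1; lra.
have hl2 := @ln2_gt0 R.
(* The summands bound [cont_a / s] and [cont_b / s], where [s] is the root of [t]: [20 w] is [4 w]
   from the prefactor times [5] from [hbin_le_sqrt]. *)
pose c : R := 2 * (w + 1) + 20 * w / ln 2.
have hc : 0 < c.
  have : 0 <= 20 * w / ln 2 by apply: divr_ge0; lra.
  by rewrite /c; lra.
pose s0 : R := Num.min (1 / 2) (eps / (2 * c)).
have hs0 : 0 < s0.
  rewrite lt_min; apply/andP; split; first lra.
  by apply: divr_gt0 => //; apply: mulr_gt0.
have hs0h : s0 <= 1 / 2 by rewrite ge_min lexx.
have hs01 : s0 <= 1 by lra.
have hs0e : s0 * c < eps.
  have : s0 <= eps / (2 * c) by rewrite ge_min lexx orbT.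
  rewrite -(ler_pM2r hc) => h; apply: le_lt_trans h _.
  have -> : eps / (2 * c) * c = eps / 2 by field; rewrite gt_eqF.
  lra.
(* As [delta = s ^ M], this radius forces [s <= s0]. It is at most one, so the clause on different
   spaces is vacuous. *)
exists (s0 ^+ M); split; first exact: exprn_gt0.
split; last first.
  by move=> h; exfalso; move: h; rewrite ltNge exprn_ile1// ltW.
move=> d phi psi hphi hpsi hd.
set delta := pdist _ _ in hd.
have hd0 : 0 <= delta by exact: sqrtr_ge0.
have hd1 : delta < 1 by apply: (lt_le_trans hd); apply: exprn_ile1 => //; exact: ltW.
have := hb _ phi psi hphi hpsi hd1; rewrite -/delta.
set L := log2 _; have hL : 0 <= L by exact: log2_ge0.
have hL1 : 0 < 1 + L by rewrite ltr_wpDr.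
move=> hbd; rewrite /Enorm -/L -mulrBl normrM.
have hLi : 0 < (1 + L)^-1 by rewrite invr_gt0.
rewrite (gtr0_norm hLi) ltr_pdivrMr//; apply: le_lt_trans hbd _.
set t := powR delta (2 / (k.+1)%:R).
have ht0 : 0 <= t by exact: powR_ge0.
have ht : t ^+ M = delta ^+ 2 by exact: powR_root.
pose s := Num.sqrt t; have hs : s ^+ 2 = t by rewrite sqr_sqrtr.
have hsge : 0 <= s by exact: sqrtr_ge0.
have hss0 : s <= s0.
  rewrite leNgt; apply/negP => h.
  have : (s0 ^+ M) ^+ 2 < delta ^+ 2.
    rewrite -ht -hs -!exprM mulnC; apply: ltrXn2r => //; first exact: ltW.
  apply/negP; rewrite -leNgt; apply: lerXn2r; rewrite ?nnegrE//; last exact: ltW.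
  by apply: exprn_ge0; exact: ltW.
have hts : t <= s by rewrite -hs expr2; apply: ler_piMl => //; apply: le_trans hss0 _.
have ht12 : t <= 1 / 2 by apply: (le_trans hts); exact: le_trans hss0 _.
have ht1 : t <= 1 by lra.
have hd2t : delta ^+ 2 <= t.
  by rewrite -ht exprS; apply: ler_piMr => //; apply: exprn_ile1.
have h1d : 1 / 2 <= 1 - delta ^+ 2 by lra.
have h1dp : 0 < 1 - delta ^+ 2 by lra.
have hpow : (1 + t) ^+ M <= 1 + w * t.
  by apply: (le_trans (exp_1D_le M ht0 ht1)); rewrite -/w; lra.
have hpow0 : 0 <= (1 + t) ^+ M by apply: exprn_ge0; lra.
have hinv : (1 - delta ^+ 2)^-1 <= 2.
  by rewrite invf_ple ?posrE//; lra.
have hinv0 : 0 <= (1 - delta ^+ 2)^-1 by rewrite invr_ge0 ltW.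
have ha : cont_a (k := k) delta <= 2 * (w + 1) * s.
  rewrite /cont_a -/t -/M mulrC; apply: (@le_trans _ _ (2 * (w * t + t))).
    apply: (@le_trans _ _ ((1 - delta ^+ 2)^-1 * (w * t + t))).
      by apply: ler_wpM2l => //; lra.
    apply: ler_wpM2r => //; apply: addr_ge0 => //; apply: mulr_ge0 => //; lra.
  have -> : 2 * (w * t + t) = 2 * (w + 1) * t by ring.
  by apply: ler_wpM2l => //; lra.
have hh : hbin (1 + t)^-1 <= 5 * s / ln 2.
  by rewrite -hs; apply: hbin_le_sqrt => //; apply: le_trans hss0 _.
have hh0 : 0 <= hbin (1 + t)^-1.
  apply: hbin_ge0; rewrite invr_ge0 invf_le1; last lra.
  by apply/andP; split; lra.
have hwt : w * t <= w * 1 by apply: ler_wpM2l => //; lra.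
have hcoef : (1 + t) ^+ M / (1 - delta ^+ 2) <= 4 * w.
  apply: (@le_trans _ _ (2 * w * 2)); last by lra.
  by apply: ler_pM => //; lra.
have hbb : cont_b (k := k) delta <= 20 * w / ln 2 * s.
  rewrite /cont_b -/t -/M; apply: (@le_trans _ _ (4 * w * (5 * s / ln 2))).
    by apply: ler_pM => //; apply: mulr_ge0.
  by rewrite le_eqVlt; apply/orP; left; apply/eqP; field; rewrite gt_eqF.
apply: (@le_lt_trans _ _ (c * s * (1 + L))); last first.
  rewrite ltr_pM2r//; apply: le_lt_trans hs0e; rewrite mulrC.
  by apply: ler_wpM2r => //; exact: ltW.
have e : c * s * (1 + L) = 2 * (w + 1) * s * L + 20 * w / ln 2 * s
    + 2 * (w + 1) * s + 20 * w / ln 2 * s * L by rewrite /c; ring.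
rewrite e -addrA; apply: ler_wpDr.
  have h1 : 0 <= 20 * w / ln 2 by apply: divr_ge0; lra.
  apply: addr_ge0; first by apply: mulr_ge0 => //; lra.
  by do 2!apply: mulr_ge0 => //.
apply: lerD => //; exact: ler_wpM2r.
Qed.

End AsymptoticContinuity.

Theorem mainTheorem8 (R : realType) (k : nat) (hk : (0 < k)%N)
  (E : forall T : 'I_k -> finType, @dens R k T -> R) :
  fully_additive E -> monotone_on_average E -> Ep E GHZ = 1 ->
  [<-> asym_continuous E; in_Fpure E; cond_sum E; cond_bound E].
Proof.
move=> Eadd Emon Eghz; tfae.
- exact: in_Fpure_of_asym_continuous.
- exact: cond_sum_of_in_Fpure.
- exact: cond_bound_of_cond_sum.
- exact: asym_continuous_of_cond_bound.
Qed.
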